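(* Every non-singular flexible $3\times 3$ quadrilateral mesh belongs to one of the following eleven classes: the simple classes PR, HQ, IR, RQ, PQ, IQ, Q, or the hybrid classes PR + IR, HQ + IQ, HQ + PQ, PQ + IQ (all defined in the context).
   Context: Indices are modulo 4 ($x_5=x_1$, etc.); $\mathbb{C}P^1=\mathbb{C}\cup\{\infty\}$; vanishing of polynomials at points of $(\mathbb{C}P^1)^n$ is in the usual sense (homogenizing in each variable separately). MESH. A $3\times3$ mesh consists of nine rigid, possibly skew, quadrilateral faces joined by hinges along common edges. Its flexibility is encoded by a closed chain of four spherical quadrilaterals (quads) $Q_1,\dots,Q_4$, one for each vertex of the central face: $Q_i$ has fixed side lengths $\lambda_i,\delta_i,\mu_i,\gamma_i\in(0,\pi)$ in cyclic order ($\lambda_i$ coming from the central face); $\alpha_i$ is the variable angle of $Q_i$ between $\gamma_i,\lambda_i$ and $\beta_i$ the variable angle between $\delta_i,\lambda_i$; and $\beta_i\equiv\alpha_{i+1}+\tau_i+\zeta_i \pmod{2\pi}$ with fixed angles $\tau_i,\zeta_i$. Put $x_i=\tan(\alpha_i/2)$, $y_i=\tan(\beta_i/2)$, $F_i=\tan((\zeta_i+\tau_i)/2)\in\mathbb{R}\cup\{\infty\}$, and $a_i=\frac{\cos(\lambda_i+\gamma_i+\delta_i)-\cos\mu_i}{4\sin\gamma_i\sin\delta_i}$, $b_i=\frac{\cos(\lambda_i+\gamma_i-\delta_i)-\cos\mu_i}{4\sin\gamma_i\sin\delta_i}$, $c_i=\frac{\cos(\lambda_i-\gamma_i+\delta_i)-\cos\mu_i}{4\sin\gamma_i\sin\delta_i}$,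 $e_i=\frac{\cos(\lambda_i-\gamma_i-\delta_i)-\cos\mu_i}{4\sin\gamma_i\sin\delta_i}$. Let $g^{(i)}(x_i,y_i)=a_ix_i^2y_i^2+b_ix_i^2+c_iy_i^2+x_iy_i+e_i$; $H^{(i)}(y_i,x_{i+1})=y_i(1-F_ix_{i+1})-(F_i+x_{i+1})$ if $F_i\in\mathbb{R}$ and $H^{(i)}=y_ix_{i+1}+1$ if $F_i=\infty$; $\tilde g^{(i)}(x_i,x_{i+1})=\mathrm{Res}(g^{(i)},H^{(i)};y_i)$. (Automatically $(1-4a_ie_i-4b_ic_i)^2>64a_ib_ic_ie_i$, $(a_i-b_i)(e_i-c_i)<\frac14$, $(a_i-c_i)(e_i-b_i)<\frac14$.) $g^{(i)}$ and $\tilde g^{(i)}$ are singular if $a_ie_i=b_ic_i=0$, non-singular otherwise. The mesh is non-singular if all four $g^{(i)}$ are non-singular. It is flexible if the ideal $M=(\tilde g^{(1)},\tilde g^{(2)},\tilde g^{(3)},\tilde g^{(4)})\subset\mathbb{C}[x_1,x_2,x_3,x_4]$ has an infinite zero set $Z(M)\subset(\mathbb{C}P^1)^4$ (complex solutions are allowed); then $M$ is called a matching. COUPLINGS. $S_1=(\tilde g^{(1)},\tilde g^{(2)},H^{(1)},H^{(2)})\subset\mathbb{C}[x_1,x_2,x_3,y_1,y_2]$ and $S_2=(\tilde g^{(3)},\tilde g^{(4)},H^{(3)},H^{(4)})\subset\mathbb{C}[x_3,x_4,x_1,y_3,y_4]$. The components of $S_1$ are the irreducible components (Zariski topology) of $Z(S_1)\subset(\mathbb{C}P^1)^5$;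 when $g^{(1)},g^{(2)}$ are non-singular they are irreducible curves on which, away from finitely many points, every coordinate is a local parameter. On a component $W$ regard the coordinates as algebraic functions of one another (elements of the function field of $W$), and let $K_i=\mathbb{C}(x_i)$; note $K_1(y_2)=K_1(x_3)$ and $K_3=\mathbb{C}(y_2)$. $W$ is of Case 1 if $[K_1(x_2):K_1]=[K_1(y_2):K_1]=1$; Case 2 if $[K_1(x_2):K_1]=1$ and $[K_1(y_2):K_1]=2$, or $[K_3(x_2):K_3]=1$ and $[K_3(x_1):K_3]=2$; Case 3 if $[K_1(y_2):K_1]=1$ and $[K_1(x_2):K_1]=2$; Case 4 if $[K_1(x_2,y_2):K_1]=[K_1(y_2):K_1]=[K_2(y_2):K_2]=[K_1(x_2):K_1]=2$; Case 5 if $[K_1(y_2):K_1]=[K_1(x_2):K_1]=2$ and $[K_1(x_2,y_2):K_1]=4$; Case 6 if $[K_1(y_2):K_1]=4$. A non-singular coupling is purely-rational / half-quadratic / involutive-rational / purely-quadratic / involutive-quadratic / quartic if all its components are of Case 1 / 2 / 3 / 4 / 5 / 6 respectively, and rational-quadratic if its components are of Cases 3 and 4, both occurring. The same definitions apply to $S_2$ after shifting indices by 2. CLASSES. Let $\tilde R^{(1)}=\mathrm{Res}(\tilde g^{(1)},\tilde g^{(2)};x_2)$, $\tilde R^{(2)}=\mathrm{Res}(\tilde g^{(3)},\tilde g^{(4)};x_4)$ in $\mathbb{C}[x_1,x_3]$ and $d_M=\gcd(\tilde R^{(1)},\tilde R^{(2)})$. An irreducible factor is called linear (quadratic) if it has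 degree 1 (degree 2) in each of $x_1$ and $x_3$. The mesh is PR if $S_1,S_2$ are both purely-rational (so $d_M$ has linear factors only); HQ if both are half-quadratic (so $d_M$ has quadratic factors only); IR if each $S_i$ is involutive-rational or rational-quadratic and $d_M$ has linear factors only; RQ if both are rational-quadratic and $d_M$ has linear and quadratic factors; PQ if each $S_i$ is rational-quadratic or purely-quadratic and $d_M$ has quadratic factors only; IQ if both are involutive-quadratic (so $d_M$ has quadratic factors only); Q if both are quartic (so $d_M=\tilde R^{(1)}$, up to a constant, is irreducible); PR + IR if one $S_i$ is purely-rational and the other is involutive-rational or rational-quadratic (so $d_M$ has linear factors only); HQ + IQ if one is half-quadratic and the other involutive-quadratic (so $d_M$ has quadratic factors only); HQ + PQ if one is half-quadratic and the other is rational-quadratic or purely-quadratic (so $d_M$ has quadratic factors only); PQ + IQ if one is involutive-quadratic and the other is rational-quadratic or purely-quadratic (so $d_M$ has quadratic factors only). *)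

(* Defs.v *)
From HB Require Import structures.
From mathcomp Require Import all_boot all_order all_algebra.
From mathcomp Require Import complex.
From mathcomp Require Import boolp classical_sets cardinality reals trigo.
From mathcomp Require Import mpoly.

Set Implicit Arguments.
Unset Strict Implicit.
Unset Printing Implicit Defensive.

Import Order.TTheory GRing.Theory Num.Theory.
Local Open Scope classical_set_scope.
Local Open Scope ring_scope.

(* Indices 1, 2, 3, 4 (mod 4) are the elements 0, 1, 2, 3 of 'I_4, whose      *)
(* addition is modulo 4.                                                      *)

(* CP^1 = C u {oo}, with None = oo. *)
Definition CP1 (R : realType) : Type := option R[i].

Section ProjectiveZeros.
Variables (R : realType) (n : nat).
Local Notation C := R[i].

Definition hcoord (z : CP1 R) : C * C := if z is Some w then (w, 1) else (1, 0).

Definition vardeg (j : 'I_n) (f : {mpoly C[n]}) : nat :=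
  (\max_(m <- msupp f) m j)%N.

(* Value at p of the homogenization of f in each variable separately, with    *)
(* degree d j in the j-th variable; meaningful when vardeg j f <= d j.        *)
Definition hval (d : 'I_n -> nat) (f : {mpoly C[n]}) (p : 'I_n -> CP1 R) : C :=
  \sum_(m <- msupp f) f@_m *
    \prod_(j < n) ((hcoord (p j)).1 ^+ m j * (hcoord (p j)).2 ^+ (d j - m j)).

Definition vanishes (f : {mpoly C[n]}) (p : 'I_n -> CP1 R) : Prop :=
  hval (vardeg^~ f) f p = 0.

Definition zeros (G : seq {mpoly C[n]}) : set ('I_n -> CP1 R) :=
  [set p | forall f, f \in G -> vanishes f p].

(* Closed sets are cut out by multihomogeneous polynomials, i.e. by           *)
(* homogenizations of arbitrary admissible multidegree d: with d = vardeg     *)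
(* only, a hyperplane x_j = oo would not be closed.                           *)
Definition zariski_closed (A : set ('I_n -> CP1 R)) : Prop :=
  exists T : set (('I_n -> nat) * {mpoly C[n]}),
    (forall d f, T (d, f) -> forall j, (vardeg j f <= d j)%N) /\
    A = [set p | forall d f, T (d, f) -> hval d f p = 0].

Definition irreducible_closed (W : set ('I_n -> CP1 R)) : Prop :=
  [/\ zariski_closed W, W !=set0 &
      forall A B, zariski_closed A -> zariski_closed B ->
        W `<=` A `|` B -> W `<=` A \/ W `<=` B].

Definition irreducible_component (Z W : set ('I_n -> CP1 R)) : Prop :=
  [/\ irreducible_closed W, W `<=` Z &
      forall V, irreducible_closed V -> V `<=` Z -> W `<=` V -> V = W].

(* (L, phi) is the function field of W: the field of fractions of the         *)
(* coordinate ring of the affine part of W, phi mapping a polynomial to the   *)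
(* rational function it induces on W.  This determines (L, phi) up to         *)
(* isomorphism; it requires W to be irreducible and to meet C^n.              *)
Definition is_function_field (W : set ('I_n -> CP1 R)) (L : fieldType)
    (phi : {rmorphism {mpoly C[n]} -> L}) : Prop :=
  (forall f, phi f = 0 <->
     forall z : 'I_n -> C, W (fun j => Some (z j)) -> f.@[z] = 0) /\
  (forall u : L, exists f g, phi g != 0 /\ u = phi f / phi g).

Definition constants (L : fieldType) (phi : {rmorphism {mpoly C[n]} -> L}) :
    set L :=
  range (fun c : C => phi c%:MP).

End ProjectiveZeros.

Section Degrees.
Variable L : fieldType.

Definition is_subfield (K : set L) : Prop :=
  [/\ K 1, (forall u v, K u -> K v -> K (u - v)) &
      (forall u v, K u -> K v -> K (u / v))].

Definition adjoin (K A : set L) : set L := smallest is_subfield (K `|` A).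

(* [E : K] = r: the K-vector space E has a basis with r elements. *)
Definition ext_degree (K E : set L) (r : nat) : Prop :=
  exists b : 'I_r -> L, (forall i, E (b i)) /\
    forall u, E u -> exists! c : {ffun 'I_r -> L},
      (forall i, K (c i)) /\ u = \sum_i c i * b i.

(* [K(A) : K] = r *)
Definition degree_adjoin (K A : set L) (r : nat) : Prop :=
  ext_degree K (adjoin K A) r.

End Degrees.

Record mesh (R : realType) := Mesh {
  lam : 'I_4 -> R; del : 'I_4 -> R; mu : 'I_4 -> R; gam : 'I_4 -> R;
  tau : 'I_4 -> R; zeta : 'I_4 -> R;
  lam_range : forall i, 0 < lam i < pi;
  del_range : forall i, 0 < del i < pi;
  mu_range : forall i, 0 < mu i < pi;
  gam_range : forall i, 0 < gam i < pi }.

Section Mesh.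
Variables (R : realType) (M : mesh R).
Local Notation C := R[i].

Definition coef_a (i : 'I_4) : R :=
  (cos (lam M i + gam M i + del M i) - cos (mu M i))
    / (4 * sin (gam M i) * sin (del M i)).
Definition coef_b (i : 'I_4) : R :=
  (cos (lam M i + gam M i - del M i) - cos (mu M i))
    / (4 * sin (gam M i) * sin (del M i)).
Definition coef_c (i : 'I_4) : R :=
  (cos (lam M i - gam M i + del M i) - cos (mu M i))
    / (4 * sin (gam M i) * sin (del M i)).
Definition coef_e (i : 'I_4) : R :=
  (cos (lam M i - gam M i - del M i) - cos (mu M i))
    / (4 * sin (gam M i) * sin (del M i)).

(* None stands for F_i = oo. *)
Definition coef_F (i : 'I_4) : option R :=
  let t := (zeta M i + tau M i) / 2 in
  if cos t == 0 then None else Some (tan t).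

Definition mesh_nonsingular : Prop :=
  forall i, ~ (coef_a i * coef_e i = 0 /\ coef_b i * coef_c i = 0).

Definition cst (n : nat) (r : R) : {mpoly C[n]} := (real_complex R r)%:MP.

(* g^(i), with variables 'X_0 = x_i and 'X_1 = y_i. *)
Definition gpoly (i : 'I_4) : {mpoly C[2]} :=
  let x : {mpoly C[2]} := 'X_0 in let y : {mpoly C[2]} := 'X_1 in
  cst 2 (coef_a i) * x ^+ 2 * y ^+ 2 + cst 2 (coef_b i) * x ^+ 2
    + cst 2 (coef_c i) * y ^+ 2 + x * y + cst 2 (coef_e i).

(* H^(i), with variables 'X_0 = y_i and 'X_1 = x_{i+1}. *)
Definition Hpoly (i : 'I_4) : {mpoly C[2]} :=
  let y : {mpoly C[2]} := 'X_0 in let x : {mpoly C[2]} := 'X_1 in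
  if coef_F i is Some r then y * (1 - cst 2 r * x) - (cst 2 r + x)
  else y * x + 1.

(* f(u, v), the coefficients of f being mapped by iota. *)
Definition subst2 (A : nzRingType) (iota : C -> A) (f : {mpoly C[2]})
    (u v : A) : A :=
  mmap iota (fun j : 'I_2 => if j == 0 then u else v) f.

Definition msubst2 (n : nat) (f : {mpoly C[2]}) (u v : {mpoly C[n]}) :
    {mpoly C[n]} :=
  subst2 (fun c => c%:MP) f u v.

(* f(u, v) in C[X_0, X_1][T] *)
Definition psubst2 (f : {mpoly C[2]}) (u v : {poly {mpoly C[2]}}) :
    {poly {mpoly C[2]}} :=
  subst2 (fun c => (c%:MP)%:P) f u v.

(* \tilde g^(i), with variables 'X_0 = x_i and 'X_1 = x_{i+1}; y_i is 'X. *)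
Definition gtilde (i : 'I_4) : {mpoly C[2]} :=
  resultant (psubst2 (gpoly i) ('X_0)%:P 'X) (psubst2 (Hpoly i) 'X ('X_1)%:P).

Definition matching_gens : seq {mpoly C[4]} :=
  [seq msubst2 (gtilde i) 'X_i 'X_(i + 1) | i <- enum 'I_4].

Definition flexible : Prop := infinite_set (zeros matching_gens).

(* For the coupling starting at index s, these are the coordinates            *)
(* x_s, x_{s+1}, x_{s+2}, y_s, y_{s+1}.                                       *)
Definition coord_x1 : {mpoly C[5]} := 'X_(@Ordinal 5 0 isT).
Definition coord_x2 : {mpoly C[5]} := 'X_(@Ordinal 5 1 isT).
Definition coord_x3 : {mpoly C[5]} := 'X_(@Ordinal 5 2 isT).
Definition coord_y1 : {mpoly C[5]} := 'X_(@Ordinal 5 3 isT).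
Definition coord_y2 : {mpoly C[5]} := 'X_(@Ordinal 5 4 isT).

Definition coupling_gens (s : 'I_4) : seq {mpoly C[5]} :=
  [:: msubst2 (gtilde s) coord_x1 coord_x2;
      msubst2 (gtilde (s + 1)) coord_x2 coord_x3;
      msubst2 (Hpoly s) coord_y1 coord_x2;
      msubst2 (Hpoly (s + 1)) coord_y2 coord_x3].

Definition coupling_component (s : 'I_4) (W : set ('I_5 -> CP1 R)) : Prop :=
  irreducible_component (zeros (coupling_gens s)) W.

Section Cases.
Variables (L : fieldType) (phi : {rmorphism {mpoly C[5]} -> L}).

Let K1 : set L := adjoin (constants phi) [set phi coord_x1].
Let K2 : set L := adjoin (constants phi) [set phi coord_x2].
Let K3 : set L := adjoin (constants phi) [set phi coord_x3].

Definition field_case1 : Prop :=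
  degree_adjoin K1 [set phi coord_x2] 1 /\ degree_adjoin K1 [set phi coord_y2] 1.

Definition field_case2 : Prop :=
  (degree_adjoin K1 [set phi coord_x2] 1 /\ degree_adjoin K1 [set phi coord_y2] 2) \/
  (degree_adjoin K3 [set phi coord_x2] 1 /\ degree_adjoin K3 [set phi coord_x1] 2).

Definition field_case3 : Prop :=
  degree_adjoin K1 [set phi coord_y2] 1 /\ degree_adjoin K1 [set phi coord_x2] 2.

Definition field_case4 : Prop :=
  [/\ degree_adjoin K1 [set phi coord_x2; phi coord_y2] 2,
      degree_adjoin K1 [set phi coord_y2] 2,
      degree_adjoin K2 [set phi coord_y2] 2 &
      degree_adjoin K1 [set phi coord_x2] 2].

Definition field_case5 : Prop :=
  [/\ degree_adjoin K1 [set phi coord_y2] 2,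
      degree_adjoin K1 [set phi coord_x2] 2 &
      degree_adjoin K1 [set phi coord_x2; phi coord_y2] 4].

Definition field_case6 : Prop := degree_adjoin K1 [set phi coord_y2] 4.

End Cases.

Definition of_case
    (P : forall L : fieldType, {rmorphism {mpoly C[5]} -> L} -> Prop)
    (W : set ('I_5 -> CP1 R)) : Prop :=
  exists (L : fieldType) (phi : {rmorphism {mpoly C[5]} -> L}),
    is_function_field W phi /\ P L phi.

Definition case1 := of_case field_case1.
Definition case2 := of_case field_case2.
Definition case3 := of_case field_case3.
Definition case4 := of_case field_case4.
Definition case5 := of_case field_case5.
Definition case6 := of_case field_case6.

Definition purely_rational (s : 'I_4) : Prop :=
  forall W, coupling_component s W -> case1 W.
Definition half_quadratic (s : 'I_4) : Prop :=
  forall W, coupling_component s W -> case2 W.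
Definition involutive_rational (s : 'I_4) : Prop :=
  forall W, coupling_component s W -> case3 W.
Definition purely_quadratic (s : 'I_4) : Prop :=
  forall W, coupling_component s W -> case4 W.
Definition involutive_quadratic (s : 'I_4) : Prop :=
  forall W, coupling_component s W -> case5 W.
Definition quartic (s : 'I_4) : Prop :=
  forall W, coupling_component s W -> case6 W.
Definition rational_quadratic (s : 'I_4) : Prop :=
  [/\ forall W, coupling_component s W -> case3 W \/ case4 W,
      exists2 W, coupling_component s W & case3 W &
      exists2 W, coupling_component s W & case4 W].

(* \tilde R^(1), \tilde R^(2), with variables 'X_0 = x_1 and 'X_1 = x_3; the  *)
(* eliminated variable (x_2, resp. x_4) is 'X.                                *)
Definition Rt1 : {mpoly C[2]} :=
  resultant (psubst2 (gtilde 0) ('X_0)%:P 'X) (psubst2 (gtilde 1) 'X ('X_1)%:P).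
Definition Rt2 : {mpoly C[2]} :=
  resultant (psubst2 (gtilde 2) ('X_1)%:P 'X) (psubst2 (gtilde 3) 'X ('X_0)%:P).

Definition mdvd (f h : {mpoly C[2]}) : Prop := exists q, h = q * f.

Definition is_gcd (f h d : {mpoly C[2]}) : Prop :=
  [/\ mdvd d f, mdvd d h & forall d', mdvd d' f -> mdvd d' h -> mdvd d' d].

(* A chosen gcd: gcds exist in C[x_1, x_3] and are unique up to a unit. *)
Definition dM : {mpoly C[2]} := xget 0 [set d | is_gcd Rt1 Rt2 d].

Definition irreducible_mpoly (f : {mpoly C[2]}) : Prop :=
  [/\ f != 0, f \isn't a GRing.unit &
      forall p q, f = p * q -> p \is a GRing.unit \/ q \is a GRing.unit].

Definition irreducible_factor (f h : {mpoly C[2]}) : Prop :=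
  irreducible_mpoly f /\ mdvd f h.

Definition linear_factor (f : {mpoly C[2]}) : Prop :=
  vardeg 0 f = 1%N /\ vardeg 1 f = 1%N.
Definition quadratic_factor (f : {mpoly C[2]}) : Prop :=
  vardeg 0 f = 2%N /\ vardeg 1 f = 2%N.

Definition has_linear (h : {mpoly C[2]}) : Prop :=
  exists2 f, irreducible_factor f h & linear_factor f.
Definition has_quadratic (h : {mpoly C[2]}) : Prop :=
  exists2 f, irreducible_factor f h & quadratic_factor f.
Definition linear_only (h : {mpoly C[2]}) : Prop :=
  has_linear h /\ forall f, irreducible_factor f h -> linear_factor f.
Definition quadratic_only (h : {mpoly C[2]}) : Prop :=
  has_quadratic h /\ forall f, irreducible_factor f h -> quadratic_factor f.

Definition both (P : 'I_4 -> Prop) : Prop := P 0 /\ P 2.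
Definition one_other (P Q : 'I_4 -> Prop) : Prop :=
  (P 0 /\ Q 2) \/ (Q 0 /\ P 2).

Definition inv_or_rat_quadratic (s : 'I_4) : Prop :=
  involutive_rational s \/ rational_quadratic s.
Definition rat_or_pure_quadratic (s : 'I_4) : Prop :=
  rational_quadratic s \/ purely_quadratic s.

Definition class_PR : Prop := both purely_rational.
Definition class_HQ : Prop := both half_quadratic.
Definition class_IR : Prop := both inv_or_rat_quadratic /\ linear_only dM.
Definition class_RQ : Prop :=
  [/\ both rational_quadratic, has_linear dM & has_quadratic dM].
Definition class_PQ : Prop := both rat_or_pure_quadratic /\ quadratic_only dM.
Definition class_IQ : Prop := both involutive_quadratic.
Definition class_Q : Prop := both quartic.
Definition class_PR_IR : Prop := one_other purely_rational inv_or_rat_quadratic.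
Definition class_HQ_IQ : Prop := one_other half_quadratic involutive_quadratic.
Definition class_HQ_PQ : Prop := one_other half_quadratic rat_or_pure_quadratic.
Definition class_PQ_IQ : Prop :=
  one_other involutive_quadratic rat_or_pure_quadratic.

End Mesh.

(* Main.v *)
(* Composing the two correspondences of a coupling gives algebraic functions x_1, x_2, x_3 on each
   component W, with x_1, x_2 and x_2, x_3 related by irreducible equations of degree at most 2 in
   each variable.  Whether x_2 is rational in x_1, x_3 rational in x_2 and, otherwise, whether
   C(x_2, x_1) = C(x_2, x_3) and whether x_2 is in C(x_1, x_3), decides the case of W, except that
   cases 3 and 4 are separated by whether x_3 is rational in x_1.  The former conditions have the
   same answer on all components: two components on which x_1 and x_3 generate distinct quadratic
   extensions of C(x_2) have isomorphic function fields.  The bidegree of the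
   irreducible equation of x_1 and x_3 is (1, 1), (2, 2) or larger, according to the case.

   An irreducible factor of an eliminant R^(s) vanishes on some component of the s-th coupling,
   because its points lift.  A flexible mesh has infinitely many common zeros of R^(1) and R^(2),
   hence a common irreducible factor, and comparing its bidegree as seen from both couplings leaves
   the eleven classes. *)

From HB Require Import structures.
From mathcomp Require Import all_boot all_order all_algebra ring.
From mathcomp Require Import complex fraction ring_quotient.
From mathcomp Require Import boolp classical_sets cardinality reals trigo.
From mathcomp Require Import ssrcomplements mpoly.
Require Import Defs.

Set Implicit Arguments.
Unset Strict Implicit.
Unset Printing Implicit Defensive.

Import Order.TTheory GRing.Theory Num.Theory.
Local Open Scope classical_set_scope.
Local Open Scope ring_scope.

(** * Gauss's lemma *)

(** Degrees over C(x) have to be read off irreducible factors in C[x, y]; Gauss's lemma identifies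
    an irreducible relation between transcendental coordinates with a minimal polynomial. Components
    are defined by topology alone, and one of them could a priori be a single point, where no
    coordinate is transcendental. This is excluded by moving x_2 slightly: the equations have degree
    at most 2 in each coordinate, so the other coordinates follow by continuity of roots, and the
    nearby zeros avoid the irreducible pieces that miss the point. Non-singularity enters through
    one consequence: no curve of a coupling contains a horizontal or vertical line of CP^1 x CP^1,
    so that each coordinate takes a given value finitely often. When x_1 and x_3 generate distinct
    extensions of C(x_2), the tower C(x_2, x_1, x_3) has degree 4 over C(x_2) and its multiplication
    is prescribed by the equations. The isomorphism between two components thus carries each
    coordinate to the same coordinate, and both satisfy the same polynomials. *)

Definition irreducible_elt (A : idomainType) (f : A) : Prop :=
  f != 0 /\ forall p q, f = p * q -> p \is a GRing.unit \/ q \is a GRing.unit.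

Section Gauss.
Variable F : closedFieldType.
Local Notation B := {poly {poly F}}.
Implicit Types (a : F) (c w : {poly F}) (f g p q d : B).

Lemma XsubC_dvd_coefs a p :
  map_poly (horner_eval a) p = 0 -> exists p', p = ('X - a%:P) *: p'.
Proof.
move=> /polyP p0; exists (map_poly (fun c => c %/ ('X - a%:P)) p).
apply/polyP => i; rewrite coefZ coef_map_id0 ?div0p // mulrC divpK //.
rewrite dvdp_XsubCl; apply/rootP.
by have := p0 i; rewrite coef_map /= coef0.
Qed.

Lemma closed_root_size (c : {poly F}) : (size c > 1)%N -> exists a, root c a.
Proof.
move=> sc; apply/closed_rootP.
by apply: contraTneq sc => ->.
Qed.

Lemma scalerI_p c p q : c != 0 -> c *: p = c *: q -> p = q.
Proof.
by move=> c0 /eqP; rewrite -subr_eq0 -scalerBr scale_poly_eq0 (negPf c0) subr_eq0 => /eqP.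
Qed.

(* Gauss's lemma: 'X - a is prime in F['X]['Y]. *)
Lemma strip_content c f q d : c != 0 -> c *: f = q * d ->
  exists q' d' c1 c2, [/\ f = q' * d', c1 != 0, c2 != 0, q = c1 *: q' & d = c2 *: d'].
Proof.
have [n] := ubnP (size c); elim: n => // n IHn in c f q d *.
rewrite ltnS => szc c0 cf.
have [sc|sc] := leqP (size c) 1.
  have [k k0 ck] : exists2 k, k != 0 & c = k%:P.
    exists c`_0; last exact: size1_polyC.
    by apply: contraNneq c0 => c00; rewrite (size1_polyC sc) c00.
  exists (k^-1%:P *: q), d, k%:P, 1; rewrite oner_eq0 polyC_eq0 scale1r; split=> //.
    by rewrite -scalerAl -cf ck scalerA -polyCM mulVf // scale1r.
  by rewrite scalerA -polyCM mulfV // scale1r.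
have [a /factor_theorem [c' cE]] := closed_root_size sc.
have c'0 : c' != 0 by apply: contraNneq c0 => c'0; rewrite cE c'0 mul0r.
have sc' : (size c' < n)%N.
  apply: leq_trans szc; rewrite cE size_Mmonic ?monicXsubC // size_XsubC addn2.
  by rewrite ltnS leqnn.
have XA : ('X - a%:P) != 0 :> {poly F} by rewrite polyXsubC_eq0.
(* Reduction modulo ['X - a] has values in a domain, so it kills [q] or [d]; the linear factor is
   then taken out of that one. *)
have : map_poly (horner_eval a) (q * d) = 0.
  rewrite -cf; apply/polyP => i.
  by rewrite coef_map coefZ coef0 /= /horner_eval cE !hornerM !hornerE subrr mulr0 mul0r.
rewrite rmorphM => /eqP; rewrite mulf_eq0 => /orP [] /eqP /XsubC_dvd_coefs [e eE].
  have : c' *: f = e * d.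
    apply: (scalerI_p XA).
      by rewrite scalerA mulrC -cE cf eE scalerAl.
  move=> /(IHn _ _ _ _ sc' c'0) [q' [d' [c1 [c2 [-> c10 c20 eE' dE]]]]].
  exists q', d', (('X - a%:P) * c1), c2; split; rewrite // ?mulf_neq0 //.
  by rewrite eE eE' scalerA.
have : c' *: f = q * e.
  apply: (scalerI_p XA).
    by rewrite scalerA mulrC -cE cf eE scalerAr.
move=> /(IHn _ _ _ _ sc' c'0) [q' [d' [c1 [c2 [-> c10 c20 eE' dE]]]]].
exists q', d', c1, (('X - a%:P) * c2); split; rewrite // ?mulf_neq0 //.
by rewrite eE dE scalerA.
Qed.

Lemma unit_poly_size (A : idomainType) (p : {poly A}) :
  p \is a GRing.unit -> size p = 1%N.
Proof. by rewrite poly_unitE => /andP [/eqP]. Qed.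

(** Stripping [w] writes [f] as a constant [k2] times [f']. As [f'] keeps the positive degree of
    [f], irreducibility makes [k2] a unit, and no denominator remains. *)
Lemma irreducible_cancel f g h w : irreducible_elt f -> (1 < size f)%N -> w != 0 ->
  w *: g = h * f -> exists h', g = h' * f.
Proof.
move=> [f0 irrf] sf w0 wg.
have [g' [f' [k1 [k2 [gE k10 k20 _ f'E]]]]] := strip_content w0 wg.
have : f = k2%:P * f' by rewrite mul_polyC.
move=> /irrf [uk2|/unit_poly_size sf']; last first.
  by rewrite f'E size_scale // sf' in sf.
by exists (g' * k2%:P^-1); rewrite gE f'E -mul_polyC mulrA mulrVK.
Qed.

Import Pdiv.Idomain.

(** The gcd is computed by pseudo-division, that is, over the fraction field of the coefficients. If
    it is constant, its Bezout identity yields [w]; otherwise stripping contents turns it into an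
    associate of [f]. *)
Lemma irreducible_bezout f g : irreducible_elt f -> (1 < size f)%N ->
  (exists h, g = h * f) \/
  exists u v w, w != 0 /\ u * f + v * g = w%:P.
Proof.
move=> irr sf; have [f0 irrf] := irr; have [->|g0] := eqVneq g 0; first by left; exists 0; rewrite mul0r.
have [sd|sd] := leqP (size (gcdp f g)) 1.
  right; have [[u v] /= /eqpP [[c1 c2] /= /andP [c10 c20] E]] := Bezoutp f g.
  have d0 : gcdp f g != 0 by rewrite gcdp_eq0 negb_and f0.
  exists (c1 *: u), (c1 *: v), (c2 * (gcdp f g)`_0); split.
    rewrite mulf_neq0 //; apply: contraNneq d0 => d00.
    by rewrite (size1_polyC sd) d00.
  by rewrite -!scalerAl -scalerDr E {1}(size1_polyC sd) polyCM mul_polyC.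
left.
have /dvdpP [[c q] /= c0 cf] := dvdp_gcdl f g.
have [q' [d' [c1 [c2 [fE c10 c20 qE dE]]]]] := strip_content c0 cf.
have sd' : size d' = size (gcdp f g) by rewrite dE size_scale.
have uq' : q' \is a GRing.unit.
  have [//|/unit_poly_size sd1] := irrf _ _ fE.
  by rewrite sd' in sd1; rewrite sd1 in sd.
have /dvdpP [[k r] /= k0 kg] := dvdp_gcdr f g.
have {}kg : k *: g = (c2 *: r * q'^-1) * f.
  by rewrite kg dE fE -!scalerAl -scalerAr mulrA mulrVK.
exact: irreducible_cancel irr sf k0 kg.
Qed.

Lemma irreducible_prime f g h p : irreducible_elt f -> (1 < size f)%N ->
  g * h = p * f -> (exists k, g = k * f) \/ (exists k, h = k * f).
Proof.
move=> irr sf gh; have [|[u [v [w [w0 E]]]]] := irreducible_bezout g irr sf; first by left.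
right; apply: (irreducible_cancel (h := u * h + v * p) irr sf w0).
by rewrite -mul_polyC -E mulrDl -[v * g * h]mulrA gh mulrDl mulrA -[u * f * h]mulrA -[u * h * f]mulrA [h * f]mulrC.
Qed.

End Gauss.

(** * Bivariate polynomials *)

Lemma poly_rmorph_ext (A B : nzRingType) (phi psi : {rmorphism {poly A} -> B}) :
  (forall c, phi c%:P = psi c%:P) -> phi 'X = psi 'X -> phi =1 psi.
Proof.
move=> HC HX p; rewrite -[p]coefK poly_def !rmorph_sum; apply: eq_bigr => i _.
by rewrite -mul_polyC !rmorphM !rmorphXn HX HC.
Qed.

Lemma mpoly_rmorph_ext n (A B : nzRingType) (phi psi : {rmorphism {mpoly A[n]} -> B}) :
  (forall c, phi c%:MP = psi c%:MP) -> (forall i, phi 'X_i = psi 'X_i) -> phi =1 psi.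
Proof.
move=> HC HX p; rewrite [p]mpolyE !rmorph_sum; apply: eq_bigr => m _.
rewrite -mul_mpolyC !rmorphM HC mpolyXE_id !rmorph_prod; congr (_ * _).
by apply: eq_bigr => i _; rewrite !rmorphXn HX.
Qed.

Section Bivariate.
Variable R : realType.
Local Notation C := R[i].
Local Notation B := {poly {poly C}}.
Implicit Types (j : 'I_2) (f g : {mpoly C[2]}) (w : {poly C}).

Lemma rev_ord2 j : (rev_ord j == j) = false.
Proof. by case: j => [[|[|[]]]]. Qed.

Lemma ord2E j i : (i == j) || (i == rev_ord j).
Proof. by case: j i => [[|[|//]] ?] [[|[|//]] ?]. Qed.

(** The choice of the main variable is a parameter, so that a fact about one variable serves for
    both. *)
Definition curry j f : B :=
  mmap (polyC \o polyC) (fun i : 'I_2 => if i == j then 'X else 'X%:P) f.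

Lemma curry_is_additive j : additive (curry j).
Proof. exact: raddfB. Qed.
HB.instance Definition _ j := GRing.isAdditive.Build _ _ (curry j) (curry_is_additive j).
Lemma curry_is_multiplicative j : multiplicative (curry j).
Proof. by split=> [f g|]; [exact: rmorphM | exact: rmorph1]. Qed.
HB.instance Definition _ j :=
  GRing.isMultiplicative.Build _ _ (curry j) (curry_is_multiplicative j).

(** A polynomial in the variable other than [j]: these are the polynomials of degree 0 in [j]. *)
Definition univ j w : {mpoly C[2]} := (map_poly (@mpolyC 2 C) w).['X_(rev_ord j)].

Definition uncurry j (p : B) : {mpoly C[2]} :=
  (map_poly (horner_eval 'X_(rev_ord j) \o map_poly (@mpolyC 2 C)) p).['X_j].

Lemma uncurry_is_additive j : additive (uncurry j).
Proof. by move=> p q; rewrite /uncurry rmorphB hornerD hornerN. Qed.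
HB.instance Definition _ j :=
  GRing.isAdditive.Build _ _ (uncurry j) (uncurry_is_additive j).
Lemma uncurry_is_multiplicative j : multiplicative (uncurry j).
Proof. by split=> [p q|]; rewrite /uncurry ?rmorphM ?hornerM // rmorph1 hornerC. Qed.
HB.instance Definition _ j :=
  GRing.isMultiplicative.Build _ _ (uncurry j) (uncurry_is_multiplicative j).

Lemma curryC j c : curry j c%:MP = c%:P%:P.
Proof. by rewrite /curry /= mmapC. Qed.

Lemma curryX j i : curry j 'X_i = if i == j then 'X else 'X%:P.
Proof. by rewrite /curry /= mmapX mmap1U. Qed.

Lemma uncurryC j w : uncurry j w%:P = univ j w.
Proof. by rewrite /uncurry map_polyC hornerC. Qed.

Lemma uncurryX j : uncurry j 'X = 'X_j.
Proof. by rewrite /uncurry map_polyX hornerX. Qed.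

Lemma curryK j : cancel (curry j) (uncurry j).
Proof.
apply: (@mpoly_rmorph_ext _ _ _ (uncurry j \o curry j) idfun) => [c|i] /=.
  by rewrite curryC uncurryC /univ map_polyC hornerC.
rewrite curryX; have /orP [/eqP ->|/eqP ->] := ord2E j i.
  by rewrite eqxx uncurryX.
by rewrite rev_ord2 uncurryC /univ map_polyX hornerX.
Qed.

Lemma uncurryK j : cancel (uncurry j) (curry j).
Proof.
apply: (@poly_rmorph_ext _ _ (curry j \o uncurry j) idfun) => [w|] /=; last first.
  by rewrite uncurryX curryX eqxx.
rewrite uncurryC.
pose psi : {rmorphism {poly C} -> B} :=
  curry j \o (horner_eval 'X_(rev_ord j) \o map_poly (@mpolyC 2 C)).
apply: (@poly_rmorph_ext _ _ psi polyC) => [c|]; rewrite /psi /= !horner_evalE.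
  by rewrite map_polyC hornerC curryC.
by rewrite map_polyX hornerX curryX rev_ord2.
Qed.

Definition bimon j k l : 'X_{1..2} := [multinom if i == j then k else l | i < 2].

Lemma bimonE j (m : 'X_{1..2}) : m = bimon j (m j) (m (rev_ord j)).
Proof.
apply/mnmP => i; rewrite mnmE; case: eqP => [-> //|ne].
by have /orP [/eqP //|/eqP ->] := ord2E j i.
Qed.

Lemma coef_curry j f k l : (curry j f)`_k`_l = f@_(bimon j k l).
Proof.
rewrite [f in LHS]mpolyE rmorph_sum /= [f in RHS]mpolyE raddf_sum /= !coef_sum.
apply: eq_bigr => m _; rewrite -mul_mpolyC rmorphM /= curryC.
have -> : curry j 'X_[m] = ('X^(m (rev_ord j)))%:P * 'X^(m j).
  rewrite mpolyXE_id rmorph_prod (bigD1 j) //= (big_pred1 (rev_ord j)).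
    by rewrite !rmorphXn /= !curryX eqxx rev_ord2 mulrC.
  move=> i; apply/idP/eqP => [ij|->]; last by rewrite rev_ord2.
  by have := ord2E j i; rewrite (negPf ij) => /eqP.
rewrite mulrA -polyCM coefCM coefXn mcoeffCM mcoeffX.
rewrite [m in RHS](bimonE j).
have -> : (bimon j (m j) (m (rev_ord j)) == bimon j k l) =
          (k == m j) && (l == m (rev_ord j)).
  apply/eqP/andP => [/mnmP E|[/eqP-> /eqP->] //].
  by have := E j; have := E (rev_ord j); rewrite !mnmE eqxx rev_ord2 => -> ->.
case: eqP => _; last by rewrite mulr0 mulr0 coef0.
by rewrite -bimonE mulr1 coefCM coefXn.
Qed.

Lemma vardegE j f : vardeg j f = (size (curry j f)).-1.
Proof.
have [->|f0] := eqVneq f 0; first by rewrite rmorph0 size_poly0 /vardeg msupp0 big_nil.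
have s0 : (0 < size (curry j f))%N.
  rewrite size_poly_gt0; apply: contraNneq f0 => /(congr1 (uncurry j)).
  by rewrite curryK rmorph0 => ->.
apply/eqP; rewrite eqn_leq; apply/andP; split.
  apply/bigmax_leqP_seq => m mf _; rewrite -ltnS prednK //.
  rewrite ltnNge; apply/negP => /(nth_default 0) E.
  have := coef_curry j f (m j) (m (rev_ord j)).
  by rewrite E coef0 -bimonE => /esym/eqP; rewrite mcoeff_eq0 mf.
rewrite -ltnS prednK //.
have : lead_coef (curry j f) != 0 by rewrite lead_coef_eq0 -size_poly_gt0.
rewrite -lead_coef_eq0 /lead_coef coef_curry.
set k := (size (curry j f)).-1; set l := (size _).-1 => cf.
have mf : bimon j k l \in msupp f by rewrite mcoeff_msupp.
have := @leq_bigmax_seq _ (msupp f) predT (fun m : 'X_{1..2} => m j) _ mf isT.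
by rewrite /vardeg mnmE eqxx -(prednK s0) ltnS.
Qed.

Lemma vardegM j f g : f != 0 -> g != 0 -> vardeg j (f * g) = (vardeg j f + vardeg j g)%N.
Proof.
have H h : h != 0 -> curry j h != 0.
  by apply: contraNneq => /(congr1 (uncurry j)); rewrite curryK rmorph0 => ->.
move=> /H f0 /H g0; rewrite !vardegE rmorphM size_mul //=.
move: f0 g0; rewrite -!size_poly_gt0.
by case: (size _) => // a _; case: (size _) => // b _; rewrite addSn addnS.
Qed.

Lemma vardeg0 j f : vardeg j f = 0%N -> exists w, f = univ j w.
Proof.
rewrite vardegE => s0; exists (curry j f)`_0.
by rewrite -uncurryC -size1_polyC ?curryK //; case: (size _) s0 => [|[]].
Qed.

Lemma curry_unit j f : (curry j f \is a GRing.unit) = (f \is a GRing.unit).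
Proof.
apply/idP/idP => [|]; last exact: rmorph_unit.
by move=> /(rmorph_unit (uncurry j)); rewrite /= curryK.
Qed.

Lemma irreducible_curry j f : irreducible_mpoly f -> irreducible_elt (curry j f).
Proof.
move=> [f0 _ irrf]; split.
  by apply: contraNneq f0 => /(congr1 (uncurry j)); rewrite curryK rmorph0 => ->.
move=> p q /(congr1 (uncurry j)); rewrite curryK rmorphM => /irrf.
by rewrite -!(curry_unit j) /= !uncurryK.
Qed.

(** Used to eliminate variable [j]: a common zero of [f] and [g], in any extension, then annihilates
    the nonzero polynomial [w] in the other coordinate. *)
Lemma mpoly_bezout j f g : irreducible_mpoly f -> (0 < vardeg j f)%N ->
  mdvd f g \/ exists u v w, w != 0 /\ u * f + v * g = univ j w.
Proof.
move=> irrf; rewrite vardegE => sf.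
have sf1 : (1 < size (curry j f))%N by case: (size _) sf => [|[]].
have [[h E]|[u [v [w [w0 E]]]]] := irreducible_bezout (curry j g) (irreducible_curry j irrf) sf1.
  by left; exists (uncurry j h); rewrite -(curryK j g) E rmorphM /= curryK.
right; exists (uncurry j u), (uncurry j v), w; split => //.
by rewrite -uncurryC -E rmorphD !rmorphM /= !curryK.
Qed.

Lemma eval_curry (A : comNzRingType) (iota : {rmorphism C -> A}) (v : 'I_2 -> A) j f :
  mmap iota v f =
  (map_poly (horner_eval (v (rev_ord j)) \o map_poly iota) (curry j f)).[v j].
Proof.
pose psi : {rmorphism {mpoly C[2]} -> A} :=
  horner_eval (v j) \o map_poly (horner_eval (v (rev_ord j)) \o map_poly iota) \o curry j.
apply: (@mpoly_rmorph_ext _ _ _ (mmap iota v) psi) => [c|i]; rewrite /psi /= !horner_evalE.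
  by rewrite mmapC curryC !map_polyC hornerC /= horner_evalE map_polyC hornerC.
rewrite mmapX mmap1U curryX; have /orP [/eqP ->|/eqP ->] := ord2E j i.
  by rewrite eqxx map_polyX hornerX.
by rewrite rev_ord2 map_polyC hornerC /= horner_evalE map_polyX hornerX.
Qed.

Lemma eval_univ (A : comNzRingType) (iota : {rmorphism C -> A}) (v : 'I_2 -> A) j w :
  mmap iota v (univ j w) = (map_poly iota w).[v (rev_ord j)].
Proof.
rewrite (eval_curry _ _ j) -uncurryC uncurryK map_polyC hornerC.
by [].
Qed.

End Bivariate.

(** * Hilbert's basis theorem *)

Section Ideals.
Variable A : comNzRingType.
Implicit Types (S I J : set A).

Definition is_ideal J : Prop :=
  [/\ J 0, (forall x y, J x -> J y -> J (x + y)) & (forall a x, J x -> J (a * x))].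

Definition ideal_gen S : set A := [set x | forall J, is_ideal J -> S `<=` J -> J x].

Lemma ideal_gen_ideal S : is_ideal (ideal_gen S).
Proof.
split=> [J [] //|x y Hx Hy J HJ SJ|a x Hx J HJ SJ]; have [_ HD HM] := HJ.
  by apply: HD; [apply: Hx|apply: Hy].
by apply: HM; apply: Hx.
Qed.

Lemma sub_ideal_gen S : S `<=` ideal_gen S.
Proof. by move=> x Sx J _; apply. Qed.

Lemma ideal_gen_min S J : is_ideal J -> S `<=` J -> ideal_gen S `<=` J.
Proof. by move=> HJ SJ x; apply. Qed.

Lemma ideal_opp J x : is_ideal J -> J x -> J (- x).
Proof. by move=> [_ _ HM] Jx; rewrite -mulN1r; apply: HM. Qed.

Lemma ideal_sub J x y : is_ideal J -> J x -> J y -> J (x - y).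
Proof. by move=> HJ Jx Jy; have [_ HD _] := HJ; apply: HD => //; apply: ideal_opp. Qed.

End Ideals.

(** The chain condition on sequences of elements: a strictly descending chain of closed sets
    provides one separating polynomial per step. *)
Definition noetherian (A : comNzRingType) : Prop :=
  forall f : nat -> A, exists N, ideal_gen [set f i | i in `I_N] (f N).

Lemma noetherian_field (K : fieldType) : noetherian K.
Proof.
move=> f; have [f0|f0] := eqVneq (f 0) 0.
  by exists 0 => J [J0 _ _] _; rewrite f0.
exists 1 => J [_ _ HM] SJ.
by rewrite -[f 1](divfK f0); apply: HM; apply: SJ; exists 0.
Qed.

Lemma noetherian_surj (A B : comNzRingType) (psi : {rmorphism A -> B}) :
  (forall b, exists a, psi a = b) -> noetherian A -> noetherian B.
Proof.
move=> surj nA f; pose g i := sval (cid (surj (f i))).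
have gE i : psi (g i) = f i by exact: svalP (cid (surj (f i))).
have [N HN] := nA g; exists N => J [J0 JD JM] SJ.
rewrite -gE; apply: (HN [set x | J (psi x)]).
  split=> /=; first by rewrite rmorph0.
    by move=> x y Jx Jy; rewrite rmorphD; apply: JD.
  by move=> a x Jx; rewrite rmorphM; apply: JM.
by move=> _ [i iN <-] /=; rewrite gE; apply: SJ; exists i.
Qed.

Section HilbertBasis.
Variable A : comNzRingType.
Hypothesis nA : noetherian A.
Variable f : nat -> {poly A}.
Hypothesis bad : forall N, ~ ideal_gen [set f i | i in `I_N] (f N).

Let I := ideal_gen (range f).

(** The ideal [I] is the union of the ideals of the initial segments of [f], so a finite part of it
    lies in one of these, and the next term of [f] escapes. *)
Lemma not_fg (s : seq {poly A}) : (forall x, x \in s -> I x) ->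
  exists x, I x /\ ~ ideal_gen [set` s] x.
Proof.
move=> sI; pose U := \bigcup_N ideal_gen [set f i | i in `I_N].
have mono N N' : (N <= N')%N ->
    ideal_gen [set f i | i in `I_N] `<=` ideal_gen [set f i | i in `I_N'].
  move=> NN'; apply: ideal_gen_min; first exact: ideal_gen_ideal.
  by move=> _ [i iN <-]; apply: sub_ideal_gen; exists i => //=; apply: leq_trans NN'.
have IU : I `<=` U.
  apply: ideal_gen_min.
    split; first by exists 0 => //; have [] := ideal_gen_ideal [set f i | i in `I_0].
      move=> x y [N _ Nx] [N' _ N'y]; exists (maxn N N') => //.
      have [_ HD _] := ideal_gen_ideal [set f i | i in `I_(maxn N N')].
      by apply: HD; [apply: mono Nx; rewrite leq_maxl|apply: mono N'y; rewrite leq_maxr].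
    move=> a x [N _ Nx]; exists N => //.
    by have [_ _ HM] := ideal_gen_ideal [set f i | i in `I_N]; apply: HM.
  by move=> _ [i _ <-]; exists i.+1 => //; apply: sub_ideal_gen; exists i => /=.
have [N HN] : exists N, forall x, x \in s -> ideal_gen [set f i | i in `I_N] x.
  elim: s sI => [|x s IHs] sI; first by exists 0.
  have [|N HN] := IHs; first by move=> y ys; apply: sI; rewrite inE ys orbT.
  have [N' _ HN'] := IU x (sI x (mem_head _ _)).
  exists (maxn N N') => y; rewrite inE => /orP [/eqP ->|ys].
    by apply: mono HN'; rewrite leq_maxr.
  by apply: mono (HN y ys); rewrite leq_maxl.
exists (f N); split; first by apply: sub_ideal_gen; exists N.
move=> H; apply: (@bad N); apply: ideal_gen_min H; first exact: ideal_gen_ideal.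
exact: HN.
Qed.

(** The condition on [s] stands under the existential, so that [next] can be chosen for every [s]
    before its iterates are known to lie in [I]. *)
Lemma min_not_fg (s : seq {poly A}) : exists x, (forall y, y \in s -> I y) ->
  [/\ I x, ~ ideal_gen [set` s] x &
      forall y, I y -> ~ ideal_gen [set` s] y -> (size x <= size y)%N].
Proof.
have [sI|nsI] := pselect (forall y, y \in s -> I y); last by exists 0.
have exP : exists k, `[< exists x, [/\ I x, ~ ideal_gen [set` s] x & size x = k] >].
  by have [x [Ix nx]] := not_fg sI; exists (size x); apply/asboolP; exists x.
case: (ex_minnP exP) => k /asboolP [x [Ix nx sx]] kmin.
exists x => _; split => // y Iy ny; rewrite sx; apply: kmin.
by apply/asboolP; exists y.
Qed.

Let next (s : seq {poly A}) := sval (cid (min_not_fg s)).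
Let G n := iter n (fun s => rcons s (next s)) [::].
Let g n := next (G n).

Lemma G_sub n y : y \in G n -> I y.
Proof.
elim: n y => // n IHn y; rewrite /G iterS -/(G n) mem_rcons inE => /orP [/eqP ->|/IHn //].
by have [] := svalP (cid (min_not_fg (G n))) IHn.
Qed.

Lemma gP n : [/\ I (g n), ~ ideal_gen [set` G n] (g n) &
      forall y, I y -> ~ ideal_gen [set` G n] y -> (size (g n) <= size y)%N].
Proof. exact: svalP (cid (min_not_fg (G n))) (@G_sub n). Qed.

Lemma G_mono i n : (i <= n)%N -> {subset G i <= G n}.
Proof.
move=> /subnK <-; elim: (n - i)%N => // k IHk y /IHk yk.
by rewrite addSn /G iterS mem_rcons inE yk orbT.
Qed.

Lemma bad_contra : False.
Proof.
have gG i n : (i < n)%N -> g i \in G n.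
  by move=> ii; apply: (G_mono ii); rewrite /G iterS mem_rcons inE eqxx.
have [N HN] := nA (fun n => lead_coef (g n)).
have [Ig ng gmin] := gP N.
have IG : is_ideal (ideal_gen [set` G N]) by exact: ideal_gen_ideal.
have [G0 GD GM] := IG.
have gi_le i : (i < N)%N -> (size (g i) <= size (g N))%N.
  move=> iN; have [_ _ H] := gP i; apply: H => // H; apply: ng.
  apply: ideal_gen_min H => // y /= yi; apply: sub_ideal_gen => /=.
  exact: G_mono (ltnW iN) _ yi.
have g0 : g N != 0 by apply: contra_notN ng => /eqP ->.
set m := size (g N) in gi_le gmin; have m0 : (0 < m)%N by rewrite size_poly_gt0.
(* The coefficients in degree m - 1 of the elements of size at most m in the ideal. Sizes along [g]
   do not exceed m up to step [N], so every earlier leading coefficient belongs to [J] after a shift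
   by a power of ['X]. *)
pose J : set A := [set a | exists h, [/\ ideal_gen [set` G N] h, (size h <= m)%N & h`_m.-1 = a]].
have [h [Gh sh ch]] : J (lead_coef (g N)).
  apply: HN.
    split; first by exists 0; rewrite size_poly0 coef0.
      move=> x y [h [Gh sh <-]] [h' [Gh' sh' <-]]; exists (h + h'); split.
      - exact: GD.
      - by rewrite (leq_trans (size_polyD _ _)) // geq_max sh.
      - by rewrite coefD.
    move=> a x [h [Gh sh <-]]; exists (a%:P * h); split.
    - exact: GM.
    - by rewrite mul_polyC (leq_trans (size_scale_leq _ _)).
    - by rewrite coefCM.
  move=> _ [i iN <-]; exists ('X^(m - size (g i)) * g i); split.
  - by apply: GM; apply: sub_ideal_gen; apply: gG.
  - have [->|gi0] := eqVneq (g i) 0; first by rewrite mulr0 size_poly0.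
    by rewrite mulrC size_mulXn // subnK // gi_le.
  rewrite mulrC coefMXn lead_coefE.
  have [gi0|] := posnP (size (g i)).
    by move/eqP: gi0; rewrite size_poly_eq0 => /eqP ->; rewrite !coef0 if_same.
  move=> si; have := gi_le i iN => le; rewrite ifF.
    by congr _`_ _; rewrite -[m.-1]subn1 -subnDA addnC subnDA subKn // subn1.
  apply/negbTE; rewrite -leqNgt -ltnS prednK // ltn_subrL si m0 //.
have HI : is_ideal I by exact: ideal_gen_ideal.
(* Subtracting [h] cancels the leading term of [g N] without entering the ideal, against the
   minimality of its size. *)
suff : (size (g N - h)%R < m)%N.
  rewrite ltnNge gmin //; first apply: (ideal_sub HI Ig).
    by apply: (ideal_gen_min HI _ Gh); exact: G_sub.
  by move=> H; apply: ng; rewrite -[g N](subrK h); apply: GD.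
rewrite -(prednK m0) ltnS; apply/leq_sizeP => k mk.
rewrite coefB; have [km|km] := eqVneq k m.-1; first by rewrite km ch lead_coefE subrr.
have {}mk : (m <= k)%N by rewrite -(prednK m0) ltn_neqAle eq_sym km.
by rewrite !nth_default ?subr0 // (leq_trans sh).
Qed.

End HilbertBasis.

Lemma noetherian_poly (A : comNzRingType) : noetherian A -> noetherian {poly A}.
Proof.
move=> nA f; apply: contrapT => H; apply: (bad_contra nA (f := f)) => N HN.
by apply: H; exists N.
Qed.

Lemma noetherian_mpoly (K : fieldType) n : noetherian {mpoly K[n]}.
Proof.
elim: n => [|n IHn].
  apply: (@noetherian_surj K _ (@mpolyC 0 K)); last exact: noetherian_field.
  by move=> p; exists p@_0%MM; exact: esym (nvar0_mpolyC p).
pose psi : {rmorphism {poly {mpoly K[n]}} -> {mpoly K[n.+1]}} :=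
  horner_eval 'X_ord_max \o map_poly (@mwiden n K).
apply: (@noetherian_surj _ _ psi); last exact: noetherian_poly.
move=> p; exists (muni p); move: p.
apply: (@mpoly_rmorph_ext _ _ _ (psi \o @muni n K) idfun) => [c|i]; rewrite /psi /= horner_evalE.
  by rewrite muniC map_polyC hornerC /= mwidenC.
rewrite /muni mmapX mmap1U; case: splitP => [j|j] /= ij.
  rewrite map_polyC hornerC /= mwidenX mnmwiden1; congr 'X__.
  by apply: val_inj; rewrite /= ij.
rewrite map_polyX hornerX; congr 'X__.
by apply: val_inj; rewrite /= ij ord1 addn0.
Qed.

(** * Zariski topology of products of projective lines *)

Section Zariski.
Variables (R : realType) (n : nat).
Local Notation C := R[i].
Local Notation pt := ('I_n -> CP1 R).
Implicit Types (d : 'I_n -> nat) (f g : {mpoly C[n]}) (p q : pt) (A B V W : set pt).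

Definition hmon d p (m : 'X_{1..n}) : C :=
  \prod_(j < n) ((hcoord (p j)).1 ^+ m j * (hcoord (p j)).2 ^+ (d j - m j)).

Lemma hvalE d f p k : (msize f <= k)%N ->
  hval d f p = \sum_(m : 'X_{1..n < k}) f@_m * hmon d p m.
Proof.
move=> lt_pk; rewrite /hval (big_mksub 'X_{1..n < k}) ?msupp_uniq //=; first last.
  by move=> m /msize_mdeg_lt /leq_trans; apply.
rewrite big_rmcond //= => m /memN_msupp_eq0 ->; by rewrite mul0r.
Qed.

Definition hval_at d p f := hval d f p.

Lemma hval_is_linear d p : linear_for *%R (hval_at d p).
Proof.
move=> c f g; rewrite /hval_at; pose k := maxn (msize (c *: f + g)) (maxn (msize f) (msize g)).
rewrite !(@hvalE d _ p k) ?leq_max ?leqnn ?orbT //.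
rewrite mulr_sumr -big_split; apply: eq_bigr => m _ /=.
by rewrite linearP /= mulrDl mulrA.
Qed.

HB.instance Definition _ d p :=
  GRing.isLinear.Build C {mpoly C[n]} C *%R (hval_at d p) (hval_is_linear d p).

Lemma hvalX d p m : hval d 'X_[m] p = hmon d p m.
Proof. by rewrite /hval msuppX big_seq1 mcoeffX eqxx mul1r. Qed.

Lemma hval_sum d p (I : Type) (r : seq I) (F : I -> {mpoly C[n]}) :
  hval d (\sum_(i <- r) F i) p = \sum_(i <- r) hval d (F i) p.
Proof. exact: (raddf_sum (hval_at d p)). Qed.

Lemma hvalZ d p c f : hval d (c *: f) p = c * hval d f p.
Proof. by rewrite -!/(hval_at d p _) linearZ. Qed.

Definition admissible d f := forall j, (vardeg j f <= d j)%N.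

Lemma admissibleP d f m j : admissible d f -> m \in msupp f -> (m j <= d j)%N.
Proof.
move=> /(_ j) le mf; apply: leq_trans le.
exact: (@leq_bigmax_seq _ (msupp f) predT (fun m : 'X_{1..n} => m j) _ mf isT).
Qed.

(** Admissibility makes the truncated subtractions in the exponents exact, so that they add up in a
    product. *)
Lemma hvalM d d' f g p : admissible d f -> admissible d' g ->
  hval (fun j => (d j + d' j)%N) (f * g) p = hval d f p * hval d' g p.
Proof.
move=> df dg; rewrite mpolyME hval_sum /hval.
rewrite big_distrl /= big_allpairs_dep /=.
rewrite big_seq [RHS]big_seq; apply: eq_bigr => m mf; rewrite big_distrr /=.
rewrite big_seq [RHS]big_seq; apply: eq_bigr => m' mg.
rewrite -/(hval _ _ _) hvalZ hvalX mulrACA -big_split; congr (_ * _).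
apply: eq_bigr => j _ /=; rewrite mulrACA mnmDE -!exprD; congr (_ * _ ^+ _).
have := admissibleP j df mf; have := admissibleP j dg mg.
by move=> /subnK <- /subnK <-; rewrite addnACA !addnK.
Qed.

Lemma admissibleM d d' f g : admissible d f -> admissible d' g ->
  admissible (fun j => (d j + d' j)%N) (f * g).
Proof.
move=> df dg j; apply/bigmax_leqP_seq => m /msuppM_le /allpairsP [[m1 m2]] /= [m1f m2g ->] _.
by rewrite mnmDE leq_add // (admissibleP _ df, admissibleP _ dg).
Qed.

Lemma vardeg1 j : vardeg j (1 : {mpoly C[n]}) = 0%N.
Proof. by rewrite /vardeg msupp1 big_seq1 mnm0E. Qed.

Lemma hval1 d p : hval d 1 p = \prod_(j < n) (hcoord (p j)).2 ^+ d j.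
Proof.
rewrite -mpolyX0 hvalX; apply: eq_bigr => j _.
by rewrite mnm0E expr0 mul1r subn0.
Qed.

Lemma hval_affine d f (z : 'I_n -> C) : hval d f (fun j => Some (z j)) = f.@[z].
Proof.
rewrite mevalE; apply: eq_bigr => m _; congr (_ * _).
by apply: eq_bigr => j _; rewrite /= expr1n mulr1.
Qed.

Definition hpt p (k : 'I_(n + n)) : C :=
  match fintype.split k with inl j => (hcoord (p j)).1 | inr j => (hcoord (p j)).2 end.

(** The homogenization as an actual polynomial in 2n variables: whatever the multidegree, it lives
    in one noetherian ring. *)
Definition homogp d f : {mpoly C[n + n]} :=
  \sum_(m <- msupp f) f@_m *:
    \prod_(j < n) ('X_(lshift n j) ^+ m j * 'X_(rshift n j) ^+ (d j - m j)).

Lemma homogE d f p : (homogp d f).@[hpt p] = hval d f p.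
Proof.
rewrite raddf_sum; apply: eq_bigr => m _ /=; rewrite mevalZ rmorph_prod; congr (_ * _).
apply: eq_bigr => j _ /=; rewrite rmorphM !rmorphXn /= !mevalXU /hpt.
by rewrite -[lshift n j]/(unsplit (inl j)) -[rshift n j]/(unsplit (inr j)) !unsplitK.
Qed.

Lemma closed_hyp d f : admissible d f -> zariski_closed [set p | hval d f p = 0].
Proof.
move=> df; exists [set (d, f)]; split=> [_ _ [-> ->] //|].
by apply/seteqP; split=> p /= H; [move=> _ _ [-> ->]|apply: H].
Qed.

Lemma closed_sep A p : zariski_closed A -> ~ A p ->
  exists d f, [/\ admissible d f, A `<=` [set q | hval d f q = 0] & hval d f p != 0].
Proof.
move=> [T [admT ->]] /= nAp; apply: contrapT => H; apply: nAp => d f Tdf.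
apply: contrapT => nz; apply: H; exists d, f; split; first exact: admT.
  by move=> q /= /(_ d f Tdf).
exact/eqP.
Qed.

Lemma closed_zeros (G : seq {mpoly C[n]}) : zariski_closed (zeros G).
Proof.
exists [set df : ('I_n -> nat) * {mpoly C[n]} | df.2 \in G /\ df.1 = @vardeg R n ^~ df.2];
  split=> [d f [/= _ ->] //|].
apply/seteqP; split=> p /= H; first by move=> d f [/= fG ->]; apply: H.
by move=> f fG; exact: (H (@vardeg R n ^~ f) f (conj fG erefl)).
Qed.

Lemma closedI A B : zariski_closed A -> zariski_closed B -> zariski_closed (A `&` B).
Proof.
move=> [T [aT ->]] [T' [aT' ->]]; exists (T `|` T'); split.
  by move=> d f [/aT|/aT'].
apply/seteqP; split=> p /=; first by move=> [H H'] d f [/H|/H'].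
by move=> H; split=> d f Tdf; apply: H; [left|right].
Qed.

Lemma closedU A B : zariski_closed A -> zariski_closed B -> zariski_closed (A `|` B).
Proof.
move=> cA cB.
(* All equations valid on both sets are taken; the product of two separating polynomials shows that
   they define nothing larger than the union. *)
exists [set df | admissible df.1 df.2 /\ A `|` B `<=` [set p | hval df.1 df.2 p = 0]].
split; first by move=> d f [].
apply/seteqP; split=> p; first by move=> ABp d f /= [_]; apply.
move=> /= H; apply: contrapT => /not_orP [nA nB].
have [d [f [df Af fp]]] := closed_sep cA nA.
have [d' [g [dg Bg gp]]] := closed_sep cB nB.
have : hval (fun j => (d j + d' j)%N) (f * g) p = 0.
  apply: H; split; first exact: admissibleM.
  move=> q /= ABq; rewrite hvalM //.
  by case: ABq => [/Af|/Bg] /= ->; rewrite ?mul0r ?mulr0.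
by rewrite hvalM // => /eqP; rewrite mulf_eq0 (negPf fp) (negPf gp).
Qed.

Lemma closed0 : zariski_closed (set0 : set pt).
Proof.
suff -> : set0 = [set p : pt | hval (fun=> 0%N) 1 p = 0].
  by apply: closed_hyp => j; rewrite vardeg1.
apply/seteqP; split=> p //=; rewrite hval1 big1 // => /eqP.
by rewrite oner_eq0.
Qed.

Lemma hcoord2_eq0 (z : CP1 R) : (hcoord z).2 = 0 <-> z = None.
Proof.
by case: z => [z|] /=; split=> // /eqP; rewrite oner_eq0.
Qed.

Lemma closed_coord (j : 'I_n) (c : CP1 R) : zariski_closed [set p : pt | p j = c].
Proof.
pose d := fun i : 'I_n => (i == j : nat).
have hd p : \prod_(i < n) (hcoord (p i)).2 ^+ d i = (hcoord (p j)).2.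
  rewrite (bigD1 j) //= /d eqxx expr1 big1 ?mulr1 // => i /negPf ->.
  by rewrite expr0.
have adm1 : admissible d 1 by move=> i; rewrite vardeg1.
case: c => [c|].
  have admX : admissible d 'X_j.
    move=> i; rewrite /vardeg msuppX big_seq1 mnm1E /d eq_sym; by [].
  have E p : hval d ('X_j - c *: 1) p = (hcoord (p j)).1 - c * (hcoord (p j)).2.
    rewrite -/(hval_at d p _) raddfB /= /hval_at hvalZ hval1 hd; congr (_ - _).
    rewrite hvalX /hmon (bigD1 j) //= mnm1E /d eqxx subnn expr0 mulr1 expr1.
    rewrite big1 ?mulr1 // => i /negPf ij.
    by rewrite mnm1E eq_sym ij !expr0 mulr1.
  suff -> : [set p : pt | p j = Some c] = [set p | hval d ('X_j - c *: 1) p = 0].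
    apply: closed_hyp => i; apply/bigmax_leqP_seq => m /msuppB_le.
    rewrite mem_cat => /orP [|/msuppZ_le] mm _; first exact: admissibleP admX mm.
    exact: admissibleP adm1 mm.
  apply/seteqP; split=> p /=; rewrite E.
    by move=> -> /=; rewrite mulr1 subrr.
  case: (p j) => [z|] /=; first by rewrite mulr1 => /eqP; rewrite subr_eq0 => /eqP ->.
  by rewrite mulr0 subr0 => /eqP; rewrite oner_eq0.
suff -> : [set p : pt | p j = None] = [set p | hval d 1 p = 0] by exact: closed_hyp.
by apply/seteqP; split=> p /=; rewrite hval1 hd hcoord2_eq0.
Qed.

(** In multidegree (1, ..., 1) the constant 1 homogenizes to the product of the second
    coordinates. *)
Lemma closed_infty : zariski_closed [set p : pt | exists j, p j = None].
Proof.
suff -> : [set p : pt | exists j, p j = None] = [set p | hval (fun=> 1%N) 1 p = 0].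
  by apply: closed_hyp => j; rewrite vardeg1.
apply/seteqP; split=> p /=; rewrite hval1.
  by move=> [j pj]; rewrite (bigD1 j) //= pj /= mul0r.
by move=> /eqP/prodf_eq0 [j _]; rewrite expr1 => /eqP /hcoord2_eq0; exists j.
Qed.

Inductive fin_irr : set pt -> Prop :=
| fin_irr0 : fin_irr set0
| fin_irr1 W of irreducible_closed W : fin_irr W
| fin_irrU A B of fin_irr A & fin_irr B : fin_irr (A `|` B).

Let bad A := zariski_closed A /\ ~ fin_irr A.

Lemma bad_step A : bad A -> exists B, bad B /\ (B `<=` A /\ ~ A `<=` B).
Proof.
move=> [cA nA].
have [B [D [cB [cD [AB [nAB nAD]]]]]] : exists B D, zariski_closed B /\
    (zariski_closed D /\ (A `<=` B `|` D /\ (~ A `<=` B /\ ~ A `<=` D))).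
  apply: contrapT => H; apply: (nA); apply: fin_irr1; split=> //.
    by apply/set0P/eqP => A0; apply: nA; rewrite A0; exact: fin_irr0.
  move=> B D cB cD AB; apply: contrapT => /not_orP [? ?]; apply: H.
  by exists B, D.
have E : A = (A `&` B) `|` (A `&` D) by rewrite -setIUr; apply/esym/setIidPl.
have [finB|nB] := pselect (fin_irr (A `&` B)); last first.
  exists (A `&` B); split; first by split=> //; exact: closedI.
  by split=> [p []//|H]; apply: nAB => p /H [].
have [finD|nD] := pselect (fin_irr (A `&` D)); last first.
  exists (A `&` D); split; first by split=> //; exact: closedI.
  by split=> [p []//|H]; apply: nAD => p /H [].
by case: nA; rewrite E; exact: fin_irrU.
Qed.

(** A counterexample starts a strictly descending chain of counterexamples. The polynomial
    separating two consecutive sets vanishes on all later ones but not at its own point, so it is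
    never in the ideal of the preceding ones. *)
Lemma closed_fin_irr A : zariski_closed A -> fin_irr A.
Proof.
move=> cA; apply: contrapT => nA.
pose next (S : {A | bad A}) : {A | bad A} :=
  exist _ (sval (cid (bad_step (svalP S)))) (proj1 (svalP (cid (bad_step (svalP S))))).
pose S k := iter k next (exist _ A (conj cA nA)).
have Ssub k : sval (S k.+1) `<=` sval (S k).
  exact: (proj1 (proj2 (svalP (cid (bad_step (svalP (S k))))))).
have Smono k l : (k <= l)%N -> sval (S l) `<=` sval (S k).
  move=> /subnK <-; elim: (l - k)%N => // e IH; apply: subset_trans IH.
  by rewrite addSn; exact: Ssub.
have Sx k : exists p d f, [/\ sval (S k) p, admissible d f,
    sval (S k.+1) `<=` [set q | hval d f q = 0] & hval d f p != 0].
  have nS : ~ sval (S k) `<=` sval (S k.+1).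
    exact: (proj2 (proj2 (svalP (cid (bad_step (svalP (S k))))))).
  have [p [Sp nSp]] : exists p, sval (S k) p /\ ~ sval (S k.+1) p.
    apply: contrapT => H; apply: nS => p Sp; apply: contrapT => nSp.
    by apply: H; exists p.
  have [d [f [df Sf fp]]] := closed_sep (proj1 (svalP (S k.+1))) nSp.
  by exists p, d, f.
pose p k := sval (cid (Sx k)); pose d k := sval (cid (svalP (cid (Sx k)))).
pose f k := sval (cid (svalP (cid (svalP (cid (Sx k)))))).
have H k : [/\ sval (S k) (p k), admissible (d k) (f k),
    sval (S k.+1) `<=` [set q | hval (d k) (f k) q = 0] & hval (d k) (f k) (p k) != 0].
  exact: (svalP (cid (svalP (cid (svalP (cid (Sx k))))))).
have [N HN] := @noetherian_mpoly C (n + n) (fun k => homogp (d k) (f k)).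
have [SN _ _ /eqP] := H N; apply; rewrite -homogE.
apply: (HN [set G | G.@[hpt (p N)] = 0]).
  split=> /= [|x y xp yp|a x xp]; first by rewrite meval0.
    by rewrite mevalD xp yp addr0.
  by rewrite mevalM xp mulr0.
move=> _ [i iN <-] /=; rewrite homogE; have [_ _ Hi _] := H i.
by apply: Hi; apply: Smono SN.
Qed.

Lemma fin_irr_index A : fin_irr A ->
  exists k (V : 'I_k -> set pt), (forall i, irreducible_closed (V i)) /\
    A = \bigcup_i V i.
Proof.
elim=> [|W irrW|{}A B _ [k [V [irrV ->]]] _ [l [U [irrU ->]]]].
- by exists 0, (fun=> set0); split=> [[]//|]; apply/seteqP; split=> // p [[]].
- by exists 1, (fun=> W); split=> //; apply/seteqP; split=> p; [exists ord0|case].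
exists (k + l)%N, (fun i => match fintype.split i with inl i => V i | inr i => U i end); split.
  by move=> i; case: (fintype.split i).
apply/seteqP; split=> p.
  move=> [[i _ Vp]|[i _ Up]].
    by exists (unsplit (inl i)) => //; rewrite unsplitK.
  by exists (unsplit (inr i)) => //; rewrite unsplitK.
by move=> [i _]; case: (fintype.split i) => j; [left|right]; exists j.
Qed.

Lemma irreducible_bigcup k (V : 'I_k -> set pt) W :
  (forall i, zariski_closed (V i)) -> irreducible_closed W -> W `<=` \bigcup_i V i ->
  exists i, W `<=` V i.
Proof.
elim: k V => [|k IHk] V cV irrW WV; have [cW [p Wp] HW] := irrW.
  by have [[]] := WV p Wp.
have cU : zariski_closed (\bigcup_i V (lift ord0 i)).
  move: cV; clear; elim: k V => [|k IHk] V cV.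
    suff -> : \bigcup_i V (lift ord0 i) = set0 by exact: closed0.
    by apply/seteqP; split=> // p [[]].
  have -> : \bigcup_i V (lift ord0 i) =
     V (lift ord0 ord0) `|` \bigcup_i (fun j => V (lift ord0 j)) (lift ord0 i).
    apply/seteqP; split=> p.
      by move=> [i _]; case: (unliftP ord0 i) => [j ->|->]; [right; exists j|left].
    by move=> [|[i _]] Vp; [exists ord0|exists (lift ord0 i)].
  by apply: closedU => //; apply: (IHk (fun j => V (lift ord0 j))).
have WU : W `<=` V ord0 `|` \bigcup_i V (lift ord0 i).
  move=> q /WV [i _]; case: (unliftP ord0 i) => [j ->|->] Vq; last by left.
  by right; exists j.
have [W0|/IHk [] // i Wi] := HW _ _ (cV ord0) cU WU; first by exists ord0.
by exists (lift ord0 i).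
Qed.

Lemma component_ex A V : zariski_closed A -> irreducible_closed V -> V `<=` A ->
  exists W, irreducible_component A W /\ V `<=` W.
Proof.
move=> cA irrV VA; have [k [U [irrU AE]]] := fin_irr_index (closed_fin_irr cA).
have cU i : zariski_closed (U i) by have [] := irrU i.
have [i0 Vi0] : exists i, V `<=` U i by apply: irreducible_bigcup; rewrite // -AE.
(* Among the pieces containing [V], one that contains the largest number of pieces is maximal for
   inclusion. *)
pose num i := #|[set j | `[< U j `<=` U i >]]%SET|.
have Pi0 : `[< V `<=` U i0 >] by apply/asboolP.
case: (@arg_maxnP _ i0 (fun i => `[< V `<=` U i >]) num Pi0) => i /asboolP Vi imax.
exists (U i); split=> //; split=> //; first by rewrite AE; exact: bigcup_sup.
move=> V' irrV' V'A UV'.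
have [j V'j] : exists i, V' `<=` U i by apply: irreducible_bigcup; rewrite // -AE.
have Uij : U i `<=` U j by exact: subset_trans V'j.
have numij : (num j <= num i)%N.
  by apply: imax; apply/asboolP => q /Vi /Uij.
have sub : ([set l | `[< U l `<=` U i >]] \subset [set l | `[< U l `<=` U j >]])%SET.
  apply/fintype.subsetP => l; rewrite !inE => Ul.
  by move=> q /Ul /Uij.
have /eqP /setP /(_ j) : ([set l | `[< U l `<=` U i >]] == [set l | `[< U l `<=` U j >]])%SET.
  by rewrite eqEcard sub.
rewrite !inE => E; have Uji : U j `<=` U i by apply/asboolP; rewrite E; apply/asboolP.
by apply/seteqP; split=> //; move=> q /V'j /Uji.
Qed.

Lemma infinite_fin_irr A S : fin_irr A -> S `<=` A -> infinite_set S ->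
  exists V, [/\ irreducible_closed V, V `<=` A & infinite_set (S `&` V)].
Proof.
move=> finA; elim: finA S => [|W irrW|{}A B finA IHA finB IHB] S SA iS.
- by exfalso; apply: iS; move: SA; rewrite subset0 => ->; exact: finite_set0.
- by exists W; split=> //; rewrite setIidl.
have : infinite_set ((S `&` A) `|` (S `&` B)) by rewrite -setIUr setIidl.
rewrite finite_setU => /not_andP [iA|iB].
  have [|V [irrV VA iV]] := IHA _ _ iA; first by move=> p [].
  exists V; split=> //; first by move=> p /VA; left.
  by apply: contra_not iV; apply: sub_finite_set => p [[]].
have [|V [irrV VB iV]] := IHB _ _ iB; first by move=> p [].
exists V; split=> //; first by move=> p /VB; right.
by apply: contra_not iV; apply: sub_finite_set => p [[]].
Qed.

(** Multiply polynomials that vanish on the irreducible pieces missing [p]. Where the product is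
    nonzero, a point of [A] lies on a piece through [p]; this will exclude isolated points. *)
Lemma fin_irr_sep A p : fin_irr A -> exists d f, [/\ admissible d f, hval d f p != 0 &
  forall q, A q -> hval d f q != 0 ->
    exists V, [/\ irreducible_closed V, V `<=` A, V q & V p]].
Proof.
have adm1 : admissible (fun=> 0%N) 1 by move=> i; rewrite vardeg1.
have h1 q : hval (fun=> 0%N) 1 q != 0 by rewrite hval1 big1 ?oner_eq0.
elim=> [|W irrW|{}A B _ [d [f [df fp Hf]]] _ [d' [g [dg gp Hg]]]].
- by exists (fun=> 0%N), 1.
- have [Wp|nWp] := pselect (W p); first by exists (fun=> 0%N), 1; split=> // q Wq _; exists W; split=> // r.
  have [cW _ _] := irrW; have [d [f [df Wf fp]]] := closed_sep cW nWp.
  by exists d, f; split=> // q /Wf /= ->; rewrite eqxx.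
exists (fun j => (d j + d' j)%N), (f * g); split; first exact: admissibleM.
  by rewrite hvalM // mulf_neq0.
move=> q ABq; rewrite hvalM // mulf_eq0 negb_or => /andP [fq gq].
case: ABq => [/Hf /(_ fq)|/Hg /(_ gq)] [V [irrV VA Vq Vp]]; exists V; split=> // r /VA.
  by left.
by right.
Qed.

End Zariski.

(** * Function fields *)

Local Open Scope quotient_scope.

Section PrimeQuotient.
Variables (A : comNzRingType) (I : prime_idealr A).

(** A separate name for the quotient, to which the integral domain structure, with inverses picked
    classically, is attached. *)
Definition domq : Type := {ideal_quot I}.
HB.instance Definition _ := GRing.ComNzRing.on domq.

Let unitq : {pred domq} := fun x => `[< exists y, y * x = 1 >].
Let invq (x : domq) : domq :=
  if pselect (exists y, y * x = 1) is left e then sval (cid e) else x.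

Let mulVq : {in unitq, left_inverse 1 invq *%R}.
Proof.
move=> x /asboolP ex; rewrite /invq; case: pselect => // e.
exact: svalP (cid e).
Qed.
Let unitqP x y : y * x = 1 -> unitq x.
Proof. by move=> e; apply/asboolP; exists y. Qed.
Let invq_out : {in [predC unitq], invq =1 id}.
Proof. by move=> x /asboolP nx; rewrite /invq; case: pselect. Qed.

HB.instance Definition _ :=
  GRing.ComNzRing_hasMulInverse.Build domq mulVq unitqP invq_out.
HB.instance Definition _ :=
  GRing.ComUnitRing_isIntegral.Build domq (@Quotient.rquot_IdomainAxiom A I).

End PrimeQuotient.

Lemma fractionE (A : idomainType) (u : {fraction A}) :
  exists x y : A, [/\ y != 0 & u = FracField.tofrac x / FracField.tofrac y].
Proof.
exists \n_(repr u), \d_(repr u); split; first exact: denom_ratioP.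
apply/eqP; rewrite -[_ == _](inj_eq (mulIf (_ : FracField.tofrac \d_(repr u) != 0))); last first.
  by rewrite tofrac_eq0 denom_ratioP.
rewrite divfK ?tofrac_eq0 ?denom_ratioP //; move: (repr u) (reprK u) => x <-.
apply/eqP; transitivity (\pi_(FracField.type A) (FracField.mulf x (Ratio \d_x 1))).
  by unlock FracField.tofrac; exact: esym (FracField.pi_mul x _).
unlock FracField.tofrac; apply/eqmodP; rewrite /= FracField.equivfE.
by rewrite /FracField.mulf !numden_Ratio ?mulr1 ?mulf_neq0 ?oner_neq0 ?denom_ratioP // mulrC.
Qed.

Section PrimeIdealField.
Variables (A : comNzRingType) (P : set A).
Hypotheses (P0 : P 0) (PB : forall x y, P x -> P y -> P (x - y))
  (PM : forall a x, P x -> P (a * x)) (P1 : ~ P 1)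
  (Ppr : forall x y, P (x * y) -> P x \/ P y).

Let S (x : A) : bool := `[< P x >].

Let S_zmod : @zmod_closed A S.
Proof.
split; first exact/asboolP.
by move=> x y /asboolP Px /asboolP Py; apply/asboolP; exact: PB.
Qed.

Let S_proper : 1 \notin S /\ forall a, {in S, forall u, a * u \in S}.
Proof.
split; first by apply/asboolP.
by move=> a x /asboolP Px; apply/asboolP; exact: PM.
Qed.

Let S_prime : forall u v, u * v \in S -> (u \in S) || (v \in S).
Proof.
by move=> x y /asboolP /Ppr [] H; apply/orP; [left|right]; apply/asboolP.
Qed.

HB.instance Definition _ := GRing.isZmodClosed.Build A S S_zmod.
HB.instance Definition _ := isProperIdeal.Build A S S_proper.
HB.instance Definition _ := isPrimeIdealrClosed.Build A S S_prime.

Lemma prime_ideal_field : exists (L : fieldType) (phi : {rmorphism A -> L}),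
    (forall x, phi x = 0 <-> P x) /\
    forall u, exists x y, phi y != 0 /\ u = phi x / phi y.
Proof.
pose SI : prime_idealr A := S.
pose Q : idomainType := domq SI.
pose piQ : {rmorphism A -> Q} := \pi_{ideal_quot SI}.
have piQ0 x : piQ x = 0 <-> P x.
  have E := Quotient.idealrBE SI x 0; rewrite subr0 in E.
  have E0 : \pi_{ideal_quot SI} 0 = 0 :> {ideal_quot SI} by exact: (rmorph0 piQ).
  split=> [H|Px].
    by apply/asboolP; rewrite -/(S x) -[S x]/(x \in SI) E E0; apply/eqP.
  have : x \in SI by apply/asboolP.
  by rewrite E E0 => /eqP.
exists {fraction Q}, (@FracField.tofrac Q \o piQ); split=> [x|u] /=.
  rewrite -piQ0; split=> [/eqP|->]; last by rewrite rmorph0.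
  by rewrite tofrac_eq0 => /eqP.
have [a [b [b0 ->]]] := fractionE u.
exists (repr (a : {ideal_quot SI})), (repr (b : {ideal_quot SI})).
have E (c : Q) : piQ (repr (c : {ideal_quot SI})) = c by exact: reprK.
by rewrite !E tofrac_eq0.
Qed.

End PrimeIdealField.

Section FunctionField.
Variables (R : realType) (n : nat).
Local Notation C := R[i].

Lemma affine_pointP (p : 'I_n -> CP1 R) :
  (exists z : 'I_n -> C, p = fun j => Some (z j)) \/ exists j, p j = None.
Proof.
have [[j pj]|H] := pselect (exists j, p j = None); first by right; exists j.
left; exists (fun j => odflt 0 (p j)); apply: functional_extensionality_dep => j.
by case E : (p j) => [z|] //; case: H; exists j.
Qed.

(** The ideal of the affine part is prime: if [f * g] belongs to it, [W] is covered by the zeros of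
    [f], the zeros of [g] and the points at infinity, and the affine point rules out the last. *)
Lemma function_field_ex (W : set ('I_n -> CP1 R)) :
  irreducible_closed W -> (exists z : 'I_n -> C, W (fun j => Some (z j))) ->
  exists (L : fieldType) (phi : {rmorphism {mpoly C[n]} -> L}), is_function_field W phi.
Proof.
move=> [cW _ irrW] [z0 Wz0].
pose P : set {mpoly C[n]} := [set f | forall z : 'I_n -> C, W (fun j => Some (z j)) -> f.@[z] = 0].
apply: (@prime_ideal_field _ P) => /=.
- by move=> z _; rewrite meval0.
- by move=> x y Px Py z Wz; rewrite mevalB Px // Py // subrr.
- by move=> a x Px z Wz; rewrite mevalM Px // mulr0.
- by move=> /(_ z0 Wz0) /eqP; rewrite meval1 oner_eq0.
move=> f g fg.
pose Z h := [set p : 'I_n -> CP1 R | hval (@vardeg R n ^~ h) h p = 0].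
have cZ h : zariski_closed (Z h) by apply: closed_hyp => j.
have ZP h : W `<=` Z h -> P h.
  by move=> WZ z /WZ /=; rewrite -(hval_affine (@vardeg R n ^~ h)).
pose Inf := [set p : 'I_n -> CP1 R | exists j, p j = None].
have WU : W `<=` Z f `|` (Z g `|` Inf).
  move=> p Wp; have [[z E]|H] := affine_pointP p; last by right; right.
  have := fg z; rewrite -E mevalM => /(_ Wp) /eqP; rewrite mulf_eq0.
  rewrite E => /orP [] /eqP H; [left|right; left]; by rewrite /Z /= hval_affine.
have cI : zariski_closed Inf := @closed_infty R n.
have [/ZP|H] := irrW _ _ (cZ f) (closedU (cZ g) cI) WU; first by left.
have [/ZP|H'] := irrW _ _ (cZ g) cI H; first by right.
by have [] := H' _ Wz0.
Qed.

End FunctionField.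

(** * Quadratic extensions *)

(** Reduces an identity to a multiple [k] of a known one, the rest being left to [ring]. *)
Lemma eq_lin (A : comNzRingType) (k a b c d : A) :
  c = d -> a - b = k * (c - d) -> a = b.
Proof. by move=> -> /eqP; rewrite subrr mulr0 subr_eq0 => /eqP. Qed.

Lemma sqr_quadratic (A : comNzRingType) (u b c : A) :
  u ^+ 2 + b * u + c = 0 -> u ^+ 2 = - b * u - c.
Proof. by move=> E; apply: (eq_lin (k := 1) E); ring. Qed.

Lemma frac_sub (K : fieldType) (a b c d : K) : b != 0 -> d != 0 ->
  a / b - c / d = (a * d - c * b) / (b * d).
Proof. by move=> b0 d0; rewrite -mulNr addf_div // mulNr. Qed.

Lemma frac_div (K : fieldType) (a b c d : K) : (a / b) / (c / d) = (a * d) / (b * c).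
Proof. by rewrite invf_div mulf_div. Qed.

Section Subfields.
Variable L : fieldType.
Implicit Types (K E A B : set L) (u v w x y : L).

Section SubfieldOps.
Variable K : set L.
Hypothesis sK : is_subfield K.

Lemma sf1 : K 1. Proof. by have [] := sK. Qed.
Lemma sfB u v : K u -> K v -> K (u - v). Proof. have [_ H _] := sK; exact: H. Qed.
Lemma sf_div u v : K u -> K v -> K (u / v). Proof. have [_ _ H] := sK; exact: H. Qed.
Lemma sf0 : K 0. Proof. by rewrite -(subrr 1); apply: sfB; exact: sf1. Qed.
Lemma sfN u : K u -> K (- u). Proof. by move=> Ku; rewrite -sub0r; apply: sfB => //; exact: sf0. Qed.
Lemma sfD u v : K u -> K v -> K (u + v).
Proof. by move=> Ku Kv; rewrite -[v]opprK; apply: sfB => //; exact: sfN. Qed.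
Lemma sfV u : K u -> K u^-1. Proof. by move=> Ku; rewrite -[u^-1]mul1r; apply: sf_div => //; exact: sf1. Qed.
Lemma sfM u v : K u -> K v -> K (u * v).
Proof. by move=> Ku Kv; rewrite -[v]invrK; apply: sf_div => //; exact: sfV. Qed.
Lemma sfX u n : K u -> K (u ^+ n).
Proof.
by move=> Ku; elim: n => [|n IHn]; rewrite ?expr0 ?exprS; [exact: sf1|exact: sfM].
Qed.
Lemma sf_prod (I : Type) (r : seq I) (P : pred I) (F : I -> L) :
  (forall i, K (F i)) -> K (\prod_(i <- r | P i) F i).
Proof. by move=> KF; apply: big_ind => //; [exact: sf1|exact: sfM]. Qed.

Lemma sf_sum (I : Type) (r : seq I) (P : pred I) (F : I -> L) :
  (forall i, K (F i)) -> K (\sum_(i <- r | P i) F i).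
Proof. by move=> KF; apply: big_ind => //; [exact: sf0|exact: sfD]. Qed.
End SubfieldOps.

Lemma adjoin_subfield K A : is_subfield (adjoin K A).
Proof.
split=> [E [[? ? ?] _]//|u v Hu Hv E HE|u v Hu Hv E HE]; have [sE _] := HE.
  by apply: sfB; [|exact: Hu|exact: Hv].
by apply: sf_div; [|exact: Hu|exact: Hv].
Qed.

Lemma adjoin_base K A : K `<=` adjoin K A.
Proof. by move=> u Ku E [_]; apply; left. Qed.

Lemma adjoin_gen K A : A `<=` adjoin K A.
Proof. by move=> u Au E [_]; apply; right. Qed.

Lemma adjoin_gen1 K u : adjoin K [set u] u.
Proof. exact: adjoin_gen. Qed.

Lemma adjoin_min K A E : is_subfield E -> K `<=` E -> A `<=` E -> adjoin K A `<=` E.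
Proof. by move=> sE KE AE u; apply; split=> // v [/KE|/AE]. Qed.

Lemma adjoin_id K A : is_subfield K -> A `<=` K -> adjoin K A = K.
Proof.
by move=> sK AK; apply/seteqP; split; [exact: adjoin_min|exact: adjoin_base].
Qed.

Lemma adjoin_adjoin K A B : adjoin (adjoin K A) B = adjoin K (A `|` B).
Proof.
apply/seteqP; split; apply: adjoin_min; try exact: adjoin_subfield.
- apply: adjoin_min; [exact: adjoin_subfield|exact: adjoin_base|].
  by move=> u Au; apply: adjoin_gen; left.
- by move=> u Bu; apply: adjoin_gen; right.
- by move=> u Ku; do 2!apply: adjoin_base.
- by move=> u [Au|Bu]; [apply: adjoin_base; apply: adjoin_gen|apply: adjoin_gen].
Qed.

Lemma adjoin_swap K u v :
  adjoin (adjoin K [set u]) [set v] = adjoin (adjoin K [set v]) [set u].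
Proof. by rewrite !adjoin_adjoin setUC. Qed.

Lemma eq_adjoin1 K u v : adjoin K [set u] v -> adjoin K [set v] u ->
  adjoin K [set u] = adjoin K [set v].
Proof.
by move=> uv vu; apply/seteqP; split; apply: adjoin_min;
  try exact: adjoin_subfield; try exact: adjoin_base; move=> _ ->.
Qed.

(** Degree at most 2: the elements of [K] are included. *)
Definition quadratic_over K u : Prop :=
  exists b c, [/\ K b, K c & u ^+ 2 + b * u + c = 0].

Lemma quadratic_sub K K' u : K `<=` K' -> quadratic_over K u -> quadratic_over K' u.
Proof. by move=> KK' [b [c [Kb Kc E]]]; exists b, c; split=> //; apply: KK'. Qed.

Lemma quadratic_in K u : is_subfield K -> K u -> quadratic_over K u.
Proof.
move=> sK Ku; exists (- u), 0; split; [exact: sfN|exact: sf0|].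
by rewrite addr0 mulNr -expr2 subrr.
Qed.

Definition qext K u : set L := [set z | exists x y, [/\ K x, K y & z = x + y * u]].

Lemma qext_indep K u x y x' y' : is_subfield K -> ~ K u ->
  K x -> K y -> K x' -> K y' -> x + y * u = x' + y' * u -> x = x' /\ y = y'.
Proof.
move=> sK nu Kx Ky Kx' Ky' E.
have E' : (y - y') * u = x' - x by apply: (eq_lin (k := 1) E); ring.
have yy' : y = y'.
  apply/eqP; rewrite -subr_eq0; apply: contra_notT nu => yy'.
  have -> : u = (x' - x) / (y - y') by rewrite -E' mulrC mulKf.
  by apply: sf_div => //; exact: sfB.
split=> //; move: E'; rewrite yy' subrr mul0r => /esym/eqP.
by rewrite subr_eq0 => /eqP.
Qed.

Lemma qext_subfield K u : is_subfield K -> quadratic_over K u -> ~ K u ->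
  is_subfield (qext K u).
Proof.
move=> sK [b [c [Kb Kc /sqr_quadratic E]]] nu.
have mulq z z' : qext K u z -> qext K u z' -> qext K u (z * z').
  move=> [x [y [Kx Ky ->]]] [x' [y' [Kx' Ky' ->]]].
  exists (x * x' - y * y' * c), (x * y' + x' * y - y * y' * b); split.
  - by apply: sfB => //; repeat apply: sfM => //.
  - by apply: sfB => //; [apply: sfD => //|]; repeat apply: sfM => //.
  by ring: E.
split.
- by exists 1, 0; rewrite mul0r addr0; split=> //; [exact: sf1|exact: sf0].
- move=> _ _ [x [y [Kx Ky ->]]] [x' [y' [Kx' Ky' ->]]].
  exists (x - x'), (y - y'); split; [exact: sfB|exact: sfB|ring].
move=> z z' Hz [x [y [Kx Ky ->]]]; apply: mulq => //.
(* The norm of x + y u; its conjugate is x - y b - y u, since - b - u is the other root. *)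
pose N := x ^+ 2 - x * y * b + y ^+ 2 * c.
have NE : (x + y * u) * (x - y * b - y * u) = N by rewrite /N; ring: E.
have [->|z0] := eqVneq (x + y * u) 0.
  by exists 0, 0; rewrite invr0 mul0r addr0; split=> //; exact: sf0.
have N0 : N != 0.
  rewrite -NE mulf_neq0 //; apply: contraNneq z0 => E0.
  have E1 : x - y * b + (- y) * u = 0 + 0 * u by apply: (eq_lin (k := 1) E0); ring.
  have [] := qext_indep sK nu _ _ (sf0 sK) (sf0 sK) E1.
  - by apply: sfB => //; apply: sfM.
  - exact: sfN.
  by move=> x0 /eqP; rewrite oppr_eq0 => /eqP y0; move: x0; rewrite y0 mul0r subr0 mul0r addr0 => ->.
have KN : K N.
  by apply: sfD => //; [apply: sfB => //|]; repeat apply: sfM => //; exact: sfX.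
exists ((x - y * b) / N), (- y / N); split.
- by apply: sf_div => //; apply: sfB => //; apply: sfM.
- by apply: sf_div => //; apply: sfN.
apply: (mulfI z0); rewrite mulfV //.
rewrite (_ : _ * (_ + _) = (x + y * u) * (x - y * b - y * u) / N); last by ring.
by rewrite NE mulfV.
Qed.

Lemma adjoin_qext K u : is_subfield K -> quadratic_over K u -> ~ K u ->
  adjoin K [set u] = qext K u.
Proof.
move=> sK qu nu; apply/seteqP; split.
  apply: adjoin_min; first exact: qext_subfield.
    by move=> x Kx; exists x, 0; rewrite mul0r addr0; split=> //; exact: sf0.
  by move=> _ ->; exists 0, 1; rewrite add0r mul1r; split=> //; [exact: sf0|exact: sf1].
have sE := adjoin_subfield K [set u].
move=> _ [x [y [Kx Ky ->]]]; apply: (sfD sE); first exact: adjoin_base.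
by apply: (sfM sE); [exact: adjoin_base|exact: adjoin_gen].
Qed.

Lemma degree_adjoin_in K u : is_subfield K -> K u -> degree_adjoin K [set u] 1.
Proof.
move=> sK Ku; rewrite /degree_adjoin adjoin_id //; last by move=> _ ->.
exists (fun=> 1); split=> [_|v Kv]; first exact: sf1.
exists [ffun=> v]; split.
  by split=> [i|]; rewrite ?big_ord1 ffunE ?mulr1.
move=> c [_]; rewrite big_ord1 mulr1 => ->; apply/ffunP => i.
by rewrite ffunE; congr (c _); apply: esym; exact: ord1.
Qed.

Lemma degree_adjoin_quad K u : is_subfield K -> quadratic_over K u -> ~ K u ->
  degree_adjoin K [set u] 2.
Proof.
move=> sK qu nu; rewrite /degree_adjoin adjoin_qext //.
exists (fun i => if i == ord0 then 1 else u); split=> [i|_ [x [y [Kx Ky ->]]]].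
  case: ifP => _.
    by exists 1, 0; rewrite mul0r addr0; split=> //; [exact: sf1|exact: sf0].
  by exists 0, 1; rewrite add0r mul1r; split=> //; [exact: sf0|exact: sf1].
exists [ffun i => if i == ord0 then x else y]; split.
  split=> [i|]; first by rewrite ffunE; case: ifP.
  by rewrite !big_ord_recl big_ord0 !ffunE /= mulr1 addr0.
move=> c [Kc]; rewrite !big_ord_recl big_ord0 /= mulr1 addr0 => E.
have [E0 E1] := qext_indep sK nu Kx Ky (Kc _) (Kc _) E.
apply/ffunP => i; rewrite ffunE; case: eqP => [->//|].
case: i => [[|[|//]] ?] ne; first by case: ne; exact: val_inj.
by rewrite E1; congr (c _); exact: val_inj.
Qed.

Lemma degree_adjoin_quad2 K u v : is_subfield K -> quadratic_over K u -> ~ K u ->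
  quadratic_over (adjoin K [set u]) v -> ~ adjoin K [set u] v ->
  degree_adjoin K [set u; v] 4.
Proof.
move=> sK qu nu qv nv; rewrite /degree_adjoin -adjoin_adjoin.
have sE := adjoin_subfield K [set u].
rewrite adjoin_qext //; set E := adjoin K [set u] in sE qv nv *.
have EE : E = qext K u by exact: adjoin_qext.
have KE : K `<=` E by exact: adjoin_base.
have Eu : E u by exact: adjoin_gen.
pose b := [:: 1; u; v; u * v].
exists (fun i : 'I_4 => b`_i); split=> [i|z [s [t [Es Et ->]]]].
  case: i => [[|[|[|[|//]]]] ?] /=.
  - by exists 1, 0; rewrite mul0r addr0; split=> //; [exact: sf1|exact: sf0].
  - by exists u, 0; rewrite mul0r addr0; split=> //; exact: sf0.
  - by exists 0, 1; rewrite add0r mul1r; split=> //; [exact: sf0|exact: sf1].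
  - by exists 0, u; rewrite add0r; split=> //; exact: sf0.
move: (Es) (Et); rewrite EE => -[x [y [Kx Ky sx]]] [x' [y' [Kx' Ky' tx]]].
pose c := [:: x; y; x'; y'].
exists [ffun i : 'I_4 => c`_i]; split.
  split=> [i|]; first by rewrite ffunE; case: i => [[|[|[|[|//]]]] ?].
  by rewrite !big_ord_recl big_ord0 !ffunE /= sx tx; ring.
move=> d [Kd]; rewrite !big_ord_recl big_ord0 /= => H.
pose i0 : 'I_4 := ord0; pose i1 := lift ord0 (ord0 : 'I_3).
pose i2 := lift ord0 (lift ord0 (ord0 : 'I_2)).
pose i3 := lift ord0 (lift ord0 (lift ord0 (ord0 : 'I_1))).
have H' : s + t * v = (d i0 + d i1 * u) + (d i2 + d i3 * u) * v.
  by rewrite H /i0 /i1 /i2 /i3; ring.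
have Ed i j : E (d i + d j * u).
  by apply: (sfD sE); [exact: KE|apply: (sfM sE) => //; exact: KE].
have [E1 E2] := qext_indep sE nv Es Et (Ed _ _) (Ed _ _) H'.
move: E1 E2; rewrite sx tx.
move=> /(qext_indep sK nu Kx Ky (Kd _) (Kd _)) [D0 D1].
move=> /(qext_indep sK nu Kx' Ky' (Kd _) (Kd _)) [D2 D3].
apply/ffunP => i; rewrite ffunE.
case: i => [[|[|[|[|//]]]] ?] /=; rewrite ?D0 ?D1 ?D2 ?D3; congr (d _); exact: val_inj.
Qed.

Lemma quadratic_in_qext K w u : is_subfield K -> quadratic_over K w -> ~ K w ->
  adjoin K [set w] u -> quadratic_over K u.
Proof.
move=> sK qw nw; rewrite adjoin_qext // => -[x [y [Kx Ky ->]]].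
have [b [c [Kb Kc /sqr_quadratic E]]] := qw.
(* Minus the trace of x + y w, then its norm. *)
exists (y * b - x - x), (x ^+ 2 - x * y * b + y ^+ 2 * c); split.
- by do 2!apply: sfB => //; apply: sfM.
- by apply: sfD => //; [apply: sfB => //|]; repeat apply: sfM => //; exact: sfX.
by ring: E.
Qed.

Lemma qext_exchange K w u : is_subfield K -> quadratic_over K w -> ~ K w ->
  adjoin K [set w] u -> ~ K u -> adjoin K [set u] w.
Proof.
move=> sK qw nw; rewrite adjoin_qext // => -[x [y [Kx Ky uE]]] nu.
have y0 : y != 0.
  by apply: contra_notN nu => /eqP y0; rewrite uE y0 mul0r addr0.
have -> : w = (u - x) / y by rewrite uE addrC addKr mulrC mulKf.
have sE := adjoin_subfield K [set u].
by apply: (sf_div sE); [apply: (sfB sE); [exact: adjoin_gen|]|]; exact: adjoin_base.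
Qed.

(* Writing the coefficients of the equation of v over K(u) in the basis 1, u
   gives P(v) + u Q(v) = 0 with P monic quadratic over K, and Q(v) = 0 as u is not in K(v). *)
Lemma quadratic_descent K u v : is_subfield K -> quadratic_over K u ->
  quadratic_over (adjoin K [set u]) v -> ~ adjoin K [set v] u -> quadratic_over K v.
Proof.
move=> sK qu qv nu.
have nKu : ~ K u by move=> Ku; apply: nu; exact: adjoin_base.
move: qv; rewrite adjoin_qext // => -[_ [_ [[b0 [b1 [Kb0 Kb1 ->]]] [c0 [c1 [Kc0 Kc1 ->]]] E]]].
have [Q0|Q0] := eqVneq (b1 * v + c1) 0.
  by exists b0, c0; split=> //; apply: (eq_lin (k := 1) E); rewrite -[LHS]addr0 -[X in _ + X](mulr0 u) -Q0; ring.
case: nu; have sE := adjoin_subfield K [set v].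
have -> : u = - (v ^+ 2 + b0 * v + c0) / (b1 * v + c1).
  by apply: (mulIf Q0); rewrite divfK //; apply: (eq_lin (k := 1) E); ring.
have Ev : adjoin K [set v] v by exact: adjoin_gen.
have KE := @adjoin_base K [set v].
apply: (sf_div sE).
  apply: (sfN sE); apply: (sfD sE); last exact: KE.
  by apply: (sfD sE); [exact: (sfX sE)|apply: (sfM sE) => //; exact: KE].
by apply: (sfD sE); [apply: (sfM sE) => //|]; exact: KE.
Qed.

End Subfields.

(** * Isomorphisms between subfields and their quadratic extensions *)

Section IsoGraph.
Variables L L' : fieldType.
Implicit Types (sigma : L -> L' -> Prop).

(* sigma is the graph of an isomorphism between a subfield of L and one of L'. *)
Definition iso_graph sigma : Prop :=
  [/\ sigma 1 1,
      (forall u u' v v', sigma u u' -> sigma v v' -> sigma (u - v) (u' - v')),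
      (forall u u' v v', sigma u u' -> sigma v v' -> sigma (u / v) (u' / v')) &
      (forall u u', sigma u u' -> (u = 0 <-> u' = 0))].

Definition gdom sigma : set L := [set u | exists u', sigma u u'].
Definition gran sigma : set L' := [set u' | exists u, sigma u u'].

Section IsoOps.
Variable sigma : L -> L' -> Prop.
Hypothesis gs : iso_graph sigma.

Lemma ig1 : sigma 1 1. Proof. by have [] := gs. Qed.
Lemma igB u u' v v' : sigma u u' -> sigma v v' -> sigma (u - v) (u' - v').
Proof. have [_ H _ _] := gs; exact: H. Qed.
Lemma ig_div u u' v v' : sigma u u' -> sigma v v' -> sigma (u / v) (u' / v').
Proof. have [_ _ H _] := gs; exact: H. Qed.
Lemma ig_eq0 u u' : sigma u u' -> (u = 0 <-> u' = 0).
Proof. have [_ _ _ H] := gs; exact: H. Qed.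
Lemma ig0 : sigma 0 0. Proof. by rewrite -(subrr 1) -[X in sigma _ X](subrr 1); apply: igB; exact: ig1. Qed.
Lemma igN u u' : sigma u u' -> sigma (- u) (- u').
Proof. by move=> s; rewrite -sub0r -[- u']sub0r; apply: igB => //; exact: ig0. Qed.
Lemma igD u u' v v' : sigma u u' -> sigma v v' -> sigma (u + v) (u' + v').
Proof. by move=> s t; rewrite -[v]opprK -[v']opprK; apply: igB => //; exact: igN. Qed.
Lemma igV u u' : sigma u u' -> sigma u^-1 u'^-1.
Proof. by move=> s; rewrite -[u^-1]mul1r -[u'^-1]mul1r; apply: ig_div => //; exact: ig1. Qed.
Lemma igM u u' v v' : sigma u u' -> sigma v v' -> sigma (u * v) (u' * v').
Proof. by move=> s t; rewrite -[v]invrK -[v']invrK; apply: ig_div => //; exact: igV. Qed.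
Lemma igX u u' n : sigma u u' -> sigma (u ^+ n) (u' ^+ n).
Proof.
by move=> s; elim: n => [|n IHn]; rewrite ?expr0 ?exprS; [exact: ig1|exact: igM].
Qed.

Lemma gdom_subfield : is_subfield (gdom sigma).
Proof.
split; first by exists 1; exact: ig1.
  by move=> u v [u' s] [v' t]; exists (u' - v'); exact: igB.
by move=> u v [u' s] [v' t]; exists (u' / v'); exact: ig_div.
Qed.

Lemma gran_subfield : is_subfield (gran sigma).
Proof.
split; first by exists 1; exact: ig1.
  by move=> u v [u' s] [v' t]; exists (u' - v'); exact: igB.
by move=> u v [u' s] [v' t]; exists (u' / v'); exact: ig_div.
Qed.

Definition gext (w : L) (w' : L') : L -> L' -> Prop := fun z z' =>
  exists x x' y y', [/\ sigma x x', sigma y y', z = x + y * w & z' = x' + y' * w'].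

(** Irrationality gives the bases 1, w and 1, w' over the two base fields, and the corresponding
    equations give corresponding multiplication rules. Preservation of zero in both directions
    stands for functionality and injectivity of the graph. *)
Lemma iso_graph_ext w w' b b' c c' : sigma b b' -> sigma c c' ->
  w ^+ 2 + b * w + c = 0 -> w' ^+ 2 + b' * w' + c' = 0 ->
  ~ gdom sigma w -> ~ gran sigma w' -> iso_graph (gext w w').
Proof.
move=> sb sc /sqr_quadratic E /sqr_quadratic E' nw nw'.
have z0 x x' y y' : sigma x x' -> sigma y y' -> x + y * w = 0 -> x' + y' * w' = 0.
  move=> sx sy H.
  have [] := qext_indep gdom_subfield nw (_ : gdom sigma x) (_ : gdom sigma y)
    (sf0 gdom_subfield) (sf0 gdom_subfield) (_ : x + y * w = 0 + 0 * w).
  - by exists x'.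
  - by exists y'.
  - by rewrite H mul0r addr0.
  by move=> /(ig_eq0 sx) -> /(ig_eq0 sy) ->; rewrite mul0r addr0.
have z0' x x' y y' : sigma x x' -> sigma y y' -> x' + y' * w' = 0 -> x + y * w = 0.
  move=> sx sy H.
  have [] := qext_indep gran_subfield nw' (_ : gran sigma x') (_ : gran sigma y')
    (sf0 gran_subfield) (sf0 gran_subfield) (_ : x' + y' * w' = 0 + 0 * w').
  - by exists x.
  - by exists y.
  - by rewrite H mul0r addr0.
  by move=> /(ig_eq0 sx) -> /(ig_eq0 sy) ->; rewrite mul0r addr0.
have mulg z z' t t' : gext w w' z z' -> gext w w' t t' -> gext w w' (z * t) (z' * t').
  move=> [x1 [x1' [y1 [y1' [sx1 sy1 -> ->]]]]] [x2 [x2' [y2 [y2' [sx2 sy2 -> ->]]]]].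
  exists (x1 * x2 - y1 * y2 * c), (x1' * x2' - y1' * y2' * c'),
    (x1 * y2 + x2 * y1 - y1 * y2 * b), (x1' * y2' + x2' * y1' - y1' * y2' * b'); split.
  - by apply: igB; repeat apply: igM => //.
  - by apply: igB; [apply: igD|]; repeat apply: igM => //.
  - by ring: E.
  - by ring: E'.
split.
- exists 1, 1, 0, 0; rewrite !mul0r !addr0; split=> //; [exact: ig1|exact: ig0].
- move=> _ _ _ _ [x1 [x1' [y1 [y1' [sx1 sy1 -> ->]]]]] [x2 [x2' [y2 [y2' [sx2 sy2 -> ->]]]]].
  by exists (x1 - x2), (x1' - x2'), (y1 - y2), (y1' - y2'); split; try exact: igB; ring.
- move=> z z' _ _ Hz [x [x' [y [y' [sx sy -> ->]]]]]; apply: mulg => //.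
  pose N := x ^+ 2 - x * y * b + y ^+ 2 * c.
  pose N' := x' ^+ 2 - x' * y' * b' + y' ^+ 2 * c'.
  have NE : (x + y * w) * (x - y * b - y * w) = N by rewrite /N; ring: E.
  have NE' : (x' + y' * w') * (x' - y' * b' - y' * w') = N' by rewrite /N'; ring: E'.
  have sN : sigma N N'.
    by apply: igD; [apply: igB|]; repeat apply: igM => //; exact: igX.
  have [H|H] := eqVneq (x + y * w) 0.
    rewrite H (z0 _ _ _ _ sx sy H) !invr0.
    by exists 0, 0, 0, 0; rewrite !mul0r !addr0; split=> //; exact: ig0.
  have H' : x' + y' * w' != 0 by apply: contra_neq H => /(z0' _ _ _ _ sx sy).
  have sc1 : sigma (x - y * b) (x' - y' * b') by apply: igB => //; exact: igM.
  have N0 : N != 0.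
    rewrite -NE mulf_neq0 //; apply: contraNneq H => H0.
    have H1 : x - y * b + (- y) * w = 0 + 0 * w by apply: (eq_lin (k := 1) H0); ring.
    have [] := qext_indep gdom_subfield nw _ _ (sf0 gdom_subfield) (sf0 gdom_subfield) H1.
    - by exists (x' - y' * b').
    - by exists (- y'); exact: igN.
    by move=> x0 /eqP; rewrite oppr_eq0 => /eqP y0; move: x0; rewrite y0 mul0r subr0 mul0r addr0 => ->.
  have N0' : N' != 0 by apply: contra_neq N0 => /(ig_eq0 sN).
  exists ((x - y * b) / N), ((x' - y' * b') / N'), (- y / N), (- y' / N'); split.
  - exact: ig_div.
  - by apply: ig_div => //; exact: igN.
  - apply: (mulfI H); rewrite mulfV //.
    rewrite (_ : _ * (_ + _) = (x + y * w) * (x - y * b - y * w) / N); last by ring.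
    by rewrite NE mulfV.
  - apply: (mulfI H'); rewrite mulfV //.
    rewrite (_ : _ * (_ + _) = (x' + y' * w') * (x' - y' * b' - y' * w') / N'); last by ring.
    by rewrite NE' mulfV.
move=> _ _ [x [x' [y [y' [sx sy -> ->]]]]]; split; [exact: z0|exact: z0'].
Qed.

Lemma gext_base w w' u u' : sigma u u' -> gext w w' u u'.
Proof.
by move=> s; exists u, u', 0, 0; rewrite !mul0r !addr0; split=> //; exact: ig0.
Qed.

Lemma gext_gen w w' : gext w w' w w'.
Proof.
by exists 0, 0, 1, 1; rewrite !mul1r !add0r; split=> //; [exact: ig0|exact: ig1].
Qed.

End IsoOps.
End IsoGraph.

(** * Algebraic relations between two functions *)

Section IrreducibleFactor.
Variable R : realType.
Local Notation C := R[i].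
Implicit Types f g : {mpoly C[2]}.

Lemma mpoly_unit_msize f : f != 0 -> (f \is a GRing.unit) = (msize f <= 1)%N.
Proof.
move=> f0; rewrite unfold_in /=; apply/idP/idP.
  by case/andP => /eqP -> _; rewrite msizeC; case: eqP.
move=> /msize1_polyC fE; apply/andP; split; first by rewrite -fE.
rewrite -[_ \in _]/(f@_0 \is a GRing.unit) unitfE; apply: contraNneq f0 => H; by rewrite fE H mpolyC0.
Qed.

(** [Q] is any property that a product hands down to one of its factors: vanishing under a morphism,
    not being a unit, having infinitely many zeros in a given set. *)
Lemma irreducible_factor_ex (Q : {mpoly C[2]} -> Prop) g :
  (forall u, u \is a GRing.unit -> ~ Q u) -> (forall p q, Q (p * q) -> Q p \/ Q q) ->
  g != 0 -> Q g -> exists f, irreducible_factor f g /\ Q f.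
Proof.
move=> Qu QM; have [n] := ubnP (msize g); elim: n => // n IHn in g *.
rewrite ltnS => szg g0 Qg.
have ug : g \isn't a GRing.unit by apply/negP => /Qu.
have [irr|nirr] := pselect (irreducible_mpoly g).
  by exists g; split=> //; split=> //; exists 1; rewrite mul1r.
have [p [q [gE np nq]]] : exists p q, [/\ g = p * q, p \isn't a GRing.unit & q \isn't a GRing.unit].
  apply: contrapT => H; apply: nirr; split=> // p q gE.
  apply: contrapT => /not_orP [/negP np /negP nq]; apply: H.
  by exists p, q.
have p0 : p != 0 by apply: contraNneq g0 => p0; rewrite gE p0 mul0r.
have q0 : q != 0 by apply: contraNneq g0 => q0; rewrite gE q0 mulr0.
move: np nq; rewrite !mpoly_unit_msize // -!ltnNge => sp sq.
have sz : msize g = (msize p + msize q).-1 by rewrite gE msizeM.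
have [sp' sq'] : (msize p < n)%N /\ (msize q < n)%N.
  move: szg; rewrite sz; move: sp sq.
  case: (msize p) => [|[|a]] //; case: (msize q) => [|[|b]] // _ _ /=.
  by rewrite !addSn !addnS /= => H; split; apply: leq_trans H; rewrite !ltnS ?leq_addl ?leq_addr.
move: Qg; rewrite gE => /QM [Qp|Qq].
  have [f [[irrf [h pE]] Qf]] := IHn p sp' p0 Qp.
  by exists f; split=> //; split=> //; exists (q * h); rewrite pE mulrC mulrA.
have [f [[irrf [h qE]] Qf]] := IHn q sq' q0 Qq.
by exists f; split=> //; split=> //; exists (p * h); rewrite qE mulrA.
Qed.

Lemma root_factor (A : idomainType) (psi : {rmorphism {mpoly C[2]} -> A}) g :
  g != 0 -> psi g = 0 -> exists f, irreducible_factor f g /\ psi f = 0.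
Proof.
apply: (irreducible_factor_ex (Q := fun g => psi g = 0)) => [u uu pu|p q /eqP].
  by have := rmorph_unit psi uu; rewrite pu unitr0.
by rewrite rmorphM mulf_eq0 => /orP [] /eqP; [left|right].
Qed.

End IrreducibleFactor.

Section Relations.
Variables (R : realType) (L : fieldType).
Local Notation C := R[i].
Variable iota : {rmorphism C -> L}.
Implicit Types (x y u : L) (p q : {poly C}) (f g : {mpoly C[2]}) (v : 'I_2 -> L).

Definition evp x p : L := (map_poly iota p).[x].

Lemma evp_is_additive x : additive (evp x).
Proof. by move=> p q; rewrite /evp rmorphB hornerD hornerN. Qed.
HB.instance Definition _ x := GRing.isAdditive.Build _ _ (evp x) (evp_is_additive x).
Lemma evp_is_multiplicative x : multiplicative (evp x).
Proof. by split=> [p q|]; rewrite /evp ?rmorphM ?hornerM // rmorph1 hornerC. Qed.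
HB.instance Definition _ x :=
  GRing.isMultiplicative.Build _ _ (evp x) (evp_is_multiplicative x).

Lemma evpB x p q : evp x (p - q) = evp x p - evp x q. Proof. exact: rmorphB. Qed.
Lemma evpM x p q : evp x (p * q) = evp x p * evp x q. Proof. exact: rmorphM. Qed.
Lemma evp0 x : evp x 0 = 0. Proof. exact: rmorph0. Qed.
Lemma evp1 x : evp x 1 = 1. Proof. exact: rmorph1. Qed.

Lemma evpC x c : evp x c%:P = iota c.
Proof. by rewrite /evp map_polyC hornerC. Qed.

Lemma evpX x : evp x 'X = x.
Proof. by rewrite /evp map_polyX hornerX. Qed.

Definition ratf x : set L := adjoin (range iota) [set x].

Lemma ratf_subfield x : is_subfield (ratf x).
Proof. exact: adjoin_subfield. Qed.

Lemma ratf_const x c : ratf x (iota c).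
Proof. by apply: adjoin_base; exists c. Qed.

Lemma ratf_gen x : ratf x x.
Proof. exact: adjoin_gen1. Qed.

Lemma ratfP x u : ratf x u <-> exists p q, evp x q != 0 /\ u = evp x p / evp x q.
Proof.
split=> [|[p [q [_ ->]]]]; last first.
  have H r : ratf x (evp x r).
    rewrite /evp horner_coef; apply: (sf_sum (ratf_subfield x)) => i.
    apply: (sfM (ratf_subfield x)); last by apply: (sfX (ratf_subfield x)); exact: ratf_gen.
    by rewrite coef_map; exact: ratf_const.
  exact: (sf_div (ratf_subfield x)).
move: u; apply: adjoin_min.
- split.
  + by exists 1, 1; rewrite rmorph1 oner_eq0 divr1.
  + move=> _ _ [p [q [q0 ->]]] [p' [q' [q0' ->]]].
    exists (p * q' - p' * q), (q * q'); rewrite rmorphB !rmorphM mulf_neq0 //; split=> //.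
    exact: frac_sub.
  + move=> _ _ [p [q [q0 ->]]] [p' [q' [q0' ->]]].
    (* Division by 0 yields 0 and has to be put in the form of a fraction as well. *)
    have [p0|p0] := eqVneq (evp x p') 0.
      by exists 0, 1; rewrite rmorph0 rmorph1 oner_eq0 p0 mul0r invr0 mulr0 mul0r.
    exists (p * q'), (q * p'); rewrite !rmorphM mulf_neq0 //; split=> //.
    exact: frac_div.
- move=> _ [c _ <-]; exists c%:P, 1.
  by rewrite rmorph1 evpC oner_eq0 divr1.
- by move=> _ ->; exists 'X, 1; rewrite evpX rmorph1 oner_eq0 divr1.
Qed.

Lemma ratf_evp x p : ratf x (evp x p).
Proof. by apply/ratfP; exists p, 1; rewrite rmorph1 oner_eq0 divr1. Qed.

Definition transc x : Prop := forall p, p != 0 -> evp x p != 0.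

Lemma mmap_curry v j f :
  mmap iota v f = (map_poly (evp (v (rev_ord j))) (curry j f)).[v j].
Proof. exact: eval_curry. Qed.

Lemma size_map_evp x (P : {poly {poly C}}) : transc x ->
  size (map_poly (evp x) P) = size P.
Proof.
move=> tx; have [->|P0] := eqVneq P 0; first by rewrite rmorph0 !size_poly0.
by apply: size_poly_eq; apply: tx; rewrite lead_coef_eq0.
Qed.

Lemma relation_degree_gt0 v j f : transc (v (rev_ord j)) -> f != 0 ->
  mmap iota v f = 0 -> (0 < vardeg j f)%N.
Proof.
move=> tv f0 fv; rewrite lt0n; apply: contra_neqN f0 => /eqP /vardeg0 [w fE].
move: fv; rewrite fE eval_univ -/(evp _ _) => w0.
have [->|/tv] := eqVneq w 0; first by rewrite /univ rmorph0 horner0.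
by rewrite w0 eqxx.
Qed.

Lemma relation_linear v j f : transc (v (rev_ord j)) -> mmap iota v f = 0 ->
  vardeg j f = 1%N -> ratf (v (rev_ord j)) (v j).
Proof.
move=> tv fv; rewrite vardegE => sf.
have {}sf : size (curry j f) = 2%N by case: (size _) sf => [|[|[]]].
have sP := size_map_evp (curry j f) tv; move: fv; rewrite (mmap_curry v j).
rewrite horner_coef sP sf !big_ord_recl big_ord0 /= !coef_map expr0 expr1 mulr1 addr0.
set a := (curry j f)`_0; set b := (curry j f)`_1 => E.
have b0 : evp (v (rev_ord j)) b != 0.
  by apply: tv; rewrite /b -[1%N]/(2.-1) -sf -lead_coefE lead_coef_eq0 -size_poly_gt0 sf.
apply/ratfP; exists (- a), b; split=> //.
by apply: (mulIf b0); rewrite divfK // rmorphN; apply: (eq_lin (k := 1) E); ring.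
Qed.

Lemma relation_quadratic_eq v j f : transc (v (rev_ord j)) -> mmap iota v f = 0 ->
  vardeg j f = 2%N -> (curry j f)`_2 != 0 /\
  v j ^+ 2 + evp (v (rev_ord j)) (curry j f)`_1 / evp (v (rev_ord j)) (curry j f)`_2 * v j
    + evp (v (rev_ord j)) (curry j f)`_0 / evp (v (rev_ord j)) (curry j f)`_2 = 0.
Proof.
move=> tv fv; rewrite vardegE => sf.
have {}sf : size (curry j f) = 3%N by case: (size _) sf => [|[|[|[]]]].
have sP := size_map_evp (curry j f) tv; move: fv; rewrite (mmap_curry v j).
rewrite horner_coef sP sf !big_ord_recl big_ord0 /= !coef_map expr0 expr1 mulr1 addr0 => E.
have c0 : (curry j f)`_2 != 0.
  by rewrite -[2%N]/(3.-1) -sf -lead_coefE lead_coef_eq0 -size_poly_gt0 sf.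
split=> //; have {}c0 := tv _ c0.
apply: (mulfI c0); rewrite mulr0; apply: (eq_lin (k := 1) E).
by rewrite /bump /=; field.
Qed.

Lemma relation_quadratic v j f : transc (v (rev_ord j)) -> mmap iota v f = 0 -> f != 0 ->
  (vardeg j f <= 2)%N -> quadratic_over (ratf (v (rev_ord j))) (v j).
Proof.
move=> tv fv f0; rewrite leq_eqVlt ltnS => /orP [/eqP|le1]; last first.
  apply: quadratic_in; first exact: ratf_subfield.
  apply: (relation_linear tv fv); apply/eqP; rewrite eqn_leq le1 /=.
  exact: relation_degree_gt0 fv.
move=> /(relation_quadratic_eq tv fv) [c0 E]; have {}c0 := tv _ c0.
exists (evp (v (rev_ord j)) (curry j f)`_1 / evp (v (rev_ord j)) (curry j f)`_2),
       (evp (v (rev_ord j)) (curry j f)`_0 / evp (v (rev_ord j)) (curry j f)`_2).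
by split=> //; apply/ratfP; [exists (curry j f)`_1|exists (curry j f)`_0]; exists (curry j f)`_2.
Qed.

(** If [f] did not divide the relation given by [P], eliminating variable [j] would produce an
    algebraic equation for the transcendental coordinate. So [f] has the degree of the minimal
    polynomial. *)
Lemma irreducible_degree_le v j f (P : {poly {poly C}}) : transc (v (rev_ord j)) ->
  irreducible_mpoly f -> mmap iota v f = 0 -> P != 0 ->
  (map_poly (evp (v (rev_ord j))) P).[v j] = 0 -> (vardeg j f <= (size P).-1)%N.
Proof.
move=> tv irrf fv P0 Pv.
have f0 : f != 0 by case: irrf.
pose g := uncurry j P.
have g0 : g != 0 by apply: contraNneq P0 => /(congr1 (curry j)); rewrite uncurryK rmorph0 => ->.
have gv : mmap iota v g = 0 by rewrite (mmap_curry v j) uncurryK.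
have -> : (size P).-1 = vardeg j g by rewrite vardegE uncurryK.
have [[h gE]|[a [b [w [w0 E]]]]] :=
  mpoly_bezout g irrf (relation_degree_gt0 tv f0 fv).
  rewrite gE vardegM ?leq_addl //; by apply: contraNneq g0 => h0; rewrite gE h0 mul0r.
have := tv _ w0; rewrite /evp -eval_univ -E rmorphD !rmorphM /= fv gv.
by rewrite !mulr0 addr0 eqxx.
Qed.

Lemma irreducible_degree1 v j f : transc (v (rev_ord j)) ->
  irreducible_mpoly f -> mmap iota v f = 0 -> ratf (v (rev_ord j)) (v j) ->
  vardeg j f = 1%N.
Proof.
move=> tv irrf fv /ratfP [p [q [q0 E]]].
have f0 : f != 0 by case: irrf.
have {}q0' : q != 0 by apply: contraNneq q0 => ->; rewrite rmorph0.
have := @irreducible_degree_le v j f (Poly [:: - p; q]) tv irrf fv.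
have -> : Poly [:: - p; q] = q%:P * 'X - p%:P.
  by rewrite /= cons_poly_def cons_poly_def mul0r add0r polyCN.
have sz : size (q%:P * 'X - p%:P) = 2%N.
  by rewrite -polyCN size_MXaddC polyC_eq0 (negPf q0') size_polyC q0'.
rewrite sz => H; apply/eqP; rewrite eqn_leq (relation_degree_gt0 tv f0 fv) andbT H //.
  by rewrite -size_poly_gt0 sz.
rewrite rmorphB rmorphM /= map_polyX !map_polyC hornerD hornerN hornerM hornerX !hornerC.
by rewrite E mulrC divfK // subrr.
Qed.

Lemma irreducible_degree2 v j f : transc (v (rev_ord j)) ->
  irreducible_mpoly f -> mmap iota v f = 0 -> quadratic_over (ratf (v (rev_ord j))) (v j) ->
  (vardeg j f <= 2)%N.
Proof.
move=> tv irrf fv [b [c [/ratfP [p [q [q0 bE]]] /ratfP [p' [q' [q0' cE]]] E]]].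
have q1 : q != 0 by apply: contraNneq q0 => ->; rewrite rmorph0.
have q1' : q' != 0 by apply: contraNneq q0' => ->; rewrite rmorph0.
pose P := (q * q')%:P * 'X^2 + ((p * q')%:P * 'X + (p' * q)%:P).
have sP : size P = 3%N.
  rewrite size_polyDl; first by rewrite size_Cmul ?mulf_neq0 // size_polyXn.
  rewrite size_Cmul ?mulf_neq0 // size_polyXn ltnS.
  rewrite size_MXaddC; case: ifP => // _; rewrite ltnS; exact: size_polyC_leq1.
have := @irreducible_degree_le v j f P tv irrf fv; rewrite sP; apply.
  by rewrite -size_poly_gt0 sP.
rewrite !rmorphD !rmorphM /= map_polyX !map_polyC /=.
rewrite !(hornerD, hornerM, hornerX, hornerC).
set x := evp _; apply: (eq_lin (k := x q * x q') E); rewrite bE cE -/x.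
by field; rewrite q0 q0'.
Qed.

End Relations.

(** * Degrees in the tower of a coupling *)

Definition opair (A : Type) (x y : A) (j : 'I_2) : A := if j == 0 then x else y.

Section FieldClassification.
Variables (R : realType) (L : fieldType).
Local Notation C := R[i].
Variable iota : {rmorphism C -> L}.
Local Notation ratf := (ratf iota).
Local Notation transc := (transc iota).
Implicit Types x y z u : L.

(* What is needed of two generators of the function field of an
   irreducible plane curve of bidegree (1, 1) or (2, 2). *)
Definition linked x y : Prop :=
  [/\ quadratic_over (ratf x) y, quadratic_over (ratf y) x & (ratf x y <-> ratf y x)].

Lemma linkedC x y : linked x y -> linked y x.
Proof. by case=> qy qx E; split=> //; split=> /E. Qed.

Lemma ratf_sub x y : ratf x y -> ratf y `<=` ratf x.
Proof.
move=> xy; apply: adjoin_min; [exact: ratf_subfield|exact: adjoin_base|].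
by move=> _ ->.
Qed.

Lemma ratf_swap x y : adjoin (ratf x) [set y] = adjoin (ratf y) [set x].
Proof. exact: adjoin_swap. Qed.

Lemma ratf_sub_adjoin x y : ratf y `<=` adjoin (ratf x) [set y].
Proof. by rewrite ratf_swap; exact: adjoin_base. Qed.

Definition outer_rational x z := ratf x z /\ ratf z x.
Definition outer_quadratic x z :=
  [/\ quadratic_over (ratf x) z, ~ ratf x z, quadratic_over (ratf z) x & ~ ratf z x].
Definition outer_quartic x z :=
  ~ quadratic_over (ratf x) z /\ ~ quadratic_over (ratf z) x.

Section Triple.
Variables x y z : L.
Hypotheses (lxy : linked x y) (lyz : linked y z).
Let sK u : is_subfield (ratf u) := ratf_subfield iota u.

Lemma outer_rational_ratf : ratf x y -> ratf y z -> ratf x z.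
Proof. by move=> xy; exact: ratf_sub. Qed.

(** Here C(x) = C(y), so z has the same degree over both, and x lies in the quadratic extension C(z,
    y) of C(z). *)
Lemma outer_half : ratf x y -> ~ ratf y z -> outer_quadratic x z.
Proof.
move=> xy nyz; have [_ _ Exy] := lxy; have [qz qy Eyz] := lyz.
have E : ratf x = ratf y.
  by apply/seteqP; split; apply: ratf_sub => //; exact/Exy.
split.
- by rewrite E.
- by rewrite E.
- apply: (quadratic_in_qext (sK z) qy); first by move=> /Eyz.
  by rewrite ratf_swap; apply: adjoin_base; rewrite -E; exact: ratf_gen.
- move=> zx; apply: nyz; apply/Eyz; apply: (ratf_sub zx); rewrite E; exact: ratf_gen.
Qed.

Hypotheses (nxy : ~ ratf x y) (nyz : ~ ratf y z).

Let nyx : ~ ratf y x. Proof. by have [_ _ E] := lxy; move=> /E. Qed.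
Let nzy : ~ ratf z y. Proof. by have [_ _ E] := lyz; move=> /E. Qed.

Lemma same_ext_sym : adjoin (ratf y) [set x] z -> adjoin (ratf y) [set z] x.
Proof. by have [_ qx _] := lxy => H; apply: (qext_exchange (sK y) qx). Qed.

(** If x were not in C(z), both x and y would generate the quadratic extension C(z, y) of C(z); then
    y would be in C(z, x), which is C(x) once z is in C(x). *)
Lemma same_ext_rational : adjoin (ratf y) [set x] z -> ratf x z -> ratf z x.
Proof.
move=> /same_ext_sym; rewrite ratf_swap => zyx xz; apply: contrapT => nzx.
have [_ qy _] := lyz; apply: nxy.
have := qext_exchange (sK z) qy nzy zyx nzx.
by rewrite ratf_swap (adjoin_id (sK x)) // => _ ->.
Qed.

Lemma same_ext_quadratic : adjoin (ratf y) [set x] z -> quadratic_over (ratf x) z.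
Proof.
rewrite ratf_swap => H; have [qy _ _] := lxy.
exact: (quadratic_in_qext (sK x) qy).
Qed.

(** z is quadratic over C(x, y), and as y is not in C(x, z) the coefficients of its equation descend
    to C(x). *)
Lemma diff_ext_quadratic : ~ adjoin (ratf x) [set z] y -> quadratic_over (ratf x) z.
Proof.
have [qy _ _] := lxy; have [qz _ _] := lyz => H.
apply: (quadratic_descent (sK x) qy _ H).
by apply: quadratic_sub qz; exact: ratf_sub_adjoin.
Qed.

Lemma diff_ext_irrational : ~ adjoin (ratf y) [set x] z -> ~ ratf x z.
Proof. by move=> H xz; apply: H; exact: ratf_sub_adjoin xz. Qed.

(** If z were quadratic over C(x), then y, being an irrational element of C(x, z), would generate
    that extension, and z would be in C(x, y). *)
Lemma diff_ext_quartic : ~ adjoin (ratf y) [set x] z ->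
  adjoin (ratf x) [set z] y -> ~ quadratic_over (ratf x) z.
Proof.
move=> H Hy qz; apply: (H); rewrite ratf_swap.
by apply: (qext_exchange (sK x) qz) => //; exact: diff_ext_irrational.
Qed.

End Triple.

Section Classification.
Variables x y z : L.
Hypotheses (lxy : linked x y) (lyz : linked y z).

Let lzy := linkedC lyz.
Let lyx := linkedC lxy.
Let sK u : is_subfield (ratf u) := ratf_subfield iota u.

(** In the names, A stands for two rational links, B for exactly one, C for none; C2 is the case
    C(y, x) = C(y, z), and C1 that of distinct extensions. *)
Lemma outer_A : ratf x y -> ratf y z -> outer_rational x z.
Proof.
move=> xy yz; have [_ _ Exy] := lxy; have [_ _ Eyz] := lyz.
by split; [exact: outer_rational_ratf yz|apply: outer_rational_ratf; [apply/Eyz|apply/Exy]].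
Qed.

Lemma outer_B1 : ratf x y -> ~ ratf y z -> outer_quadratic x z.
Proof. exact: outer_half. Qed.

Lemma outer_B2 : ~ ratf x y -> ratf y z -> outer_quadratic x z.
Proof.
move=> nxy yz; have [_ _ Exy] := lxy; have [_ _ Eyz] := lyz.
by have [] := outer_half lzy lyx (proj1 Eyz yz) (fun H => nxy (proj2 Exy H)).
Qed.

Hypotheses (nxy : ~ ratf x y) (nyz : ~ ratf y z).
Let nyx : ~ ratf y x. Proof. by have [_ _ E] := lxy; move=> /E. Qed.
Let nzy : ~ ratf z y. Proof. by have [_ _ E] := lyz; move=> /E. Qed.

Lemma outer_C2_rat : adjoin (ratf y) [set x] z -> ratf x z -> outer_rational x z.
Proof. by move=> H xz; split=> //; exact: same_ext_rational lyz _ _ H xz. Qed.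

Lemma outer_C2_quad : adjoin (ratf y) [set x] z -> ~ ratf x z -> outer_quadratic x z.
Proof.
move=> H nxz; have H' := same_ext_sym lxy nxy nyz H.
split=> //; first exact: same_ext_quadratic H.
  exact: same_ext_quadratic H'.
by move=> zx; apply: nxz; exact: same_ext_rational lyx _ _ H' zx.
Qed.

Let diff_sym : ~ adjoin (ratf y) [set x] z -> ~ adjoin (ratf y) [set z] x.
Proof. by move=> H H'; apply: H; exact: same_ext_sym lzy _ _ H'. Qed.

Lemma outer_C1_quad : ~ adjoin (ratf y) [set x] z -> ~ adjoin (ratf x) [set z] y ->
  outer_quadratic x z.
Proof.
move=> H Hy; have H' := diff_sym H.
split; first exact: diff_ext_quadratic Hy.
- exact: diff_ext_irrational H.
- by apply: diff_ext_quadratic lzy lyx _; rewrite ratf_swap.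
- exact: diff_ext_irrational H'.
Qed.

Lemma outer_C1_quartic : ~ adjoin (ratf y) [set x] z -> adjoin (ratf x) [set z] y ->
  outer_quartic x z.
Proof.
move=> H Hy; have H' := diff_sym H.
split; first exact: diff_ext_quartic Hy.
have Hy2 : adjoin (ratf z) [set x] y by rewrite ratf_swap.
exact: diff_ext_quartic H' Hy2.
Qed.

End Classification.

Section Degrees.
Variables x y z e : L.
Hypotheses (lxy : linked x y) (lyz : linked y z) (ze : ratf z e) (ez : ratf e z).
Let sK u : is_subfield (ratf u) := ratf_subfield iota u.

Lemma degree_adjoin_eq (K A B : set L) r : adjoin K A = adjoin K B ->
  degree_adjoin K A r -> degree_adjoin K B r.
Proof. by rewrite /degree_adjoin => ->. Qed.

(** [e] is the coordinate y_2. It generates the same field as [z] and can replace it in every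
    degree. *)
Lemma adjoin_e u : adjoin (ratf u) [set z] = adjoin (ratf u) [set e].
Proof. by apply: eq_adjoin1; apply: ratf_sub_adjoin. Qed.

Lemma adjoin_ye u : adjoin (ratf u) [set y; z] = adjoin (ratf u) [set y; e].
Proof.
rewrite -!adjoin_adjoin; apply: eq_adjoin1.
  by rewrite adjoin_swap; apply: adjoin_base; rewrite -/ratf; exact: ratf_sub_adjoin ze.
by rewrite adjoin_swap; apply: adjoin_base; exact: ratf_sub_adjoin ez.
Qed.

Lemma ratf_e u : ratf u z -> ratf u e.
Proof. by move=> uz; exact: ratf_sub uz _ ze. Qed.

Lemma degrees1 : ratf x y -> ratf y z ->
  degree_adjoin (ratf x) [set y] 1 /\ degree_adjoin (ratf x) [set e] 1.
Proof.
move=> xy yz; split; apply: degree_adjoin_in => //.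
by apply: ratf_e; exact: outer_rational_ratf yz.
Qed.

Lemma degrees2 : ratf x y -> ~ ratf y z ->
  degree_adjoin (ratf x) [set y] 1 /\ degree_adjoin (ratf x) [set e] 2.
Proof.
move=> xy nyz; split; first exact: degree_adjoin_in.
have [q n _ _] := outer_B1 lxy lyz xy nyz.
apply: degree_adjoin_eq (adjoin_e x) _; exact: degree_adjoin_quad.
Qed.

Lemma degrees2' : ~ ratf x y -> ratf y z ->
  degree_adjoin (ratf z) [set y] 1 /\ degree_adjoin (ratf z) [set x] 2.
Proof.
move=> nxy yz; have [_ _ Eyz] := lyz.
split; first by apply: degree_adjoin_in => //; exact/Eyz.
by have [_ _ q n] := outer_B2 lxy lyz nxy yz; exact: degree_adjoin_quad.
Qed.

Hypotheses (nxy : ~ ratf x y) (nyz : ~ ratf y z).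

Lemma degrees_xy : degree_adjoin (ratf x) [set y] 2.
Proof. by have [q _ _] := lxy; exact: degree_adjoin_quad. Qed.

Lemma degrees3 : ratf x z ->
  degree_adjoin (ratf x) [set e] 1 /\ degree_adjoin (ratf x) [set y] 2.
Proof.
move=> xz; split; last exact: degrees_xy.
by apply: degree_adjoin_in => //; exact: ratf_e.
Qed.

Lemma degrees4 : adjoin (ratf y) [set x] z -> ~ ratf x z ->
  [/\ degree_adjoin (ratf x) [set y; e] 2, degree_adjoin (ratf x) [set e] 2,
      degree_adjoin (ratf y) [set e] 2 & degree_adjoin (ratf x) [set y] 2].
Proof.
move=> H nxz; have [q n _ _] := outer_C2_quad lxy lyz nxy nyz H nxz.
have [qz _ _] := lyz; split; last exact: degrees_xy.
- apply: degree_adjoin_eq (adjoin_ye x) _; apply: degree_adjoin_eq _ degrees_xy.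
  rewrite -adjoin_adjoin (adjoin_id (adjoin_subfield _ _)) //.
  by move=> _ ->; rewrite ratf_swap.
- apply: degree_adjoin_eq (adjoin_e x) _; exact: degree_adjoin_quad.
- apply: degree_adjoin_eq (adjoin_e y) _; exact: degree_adjoin_quad.
Qed.

Lemma degree_xyz : ~ adjoin (ratf y) [set x] z -> degree_adjoin (ratf x) [set y; z] 4.
Proof.
move=> H; have [qy _ _] := lxy; have [qz _ _] := lyz.
apply: degree_adjoin_quad2 => //; last by rewrite ratf_swap.
by apply: quadratic_sub qz; exact: ratf_sub_adjoin.
Qed.

Lemma degrees5 : ~ adjoin (ratf y) [set x] z -> ~ adjoin (ratf x) [set z] y ->
  [/\ degree_adjoin (ratf x) [set e] 2, degree_adjoin (ratf x) [set y] 2 &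
      degree_adjoin (ratf x) [set y; e] 4].
Proof.
move=> H Hy; have [q n _ _] := outer_C1_quad lxy lyz nxy nyz H Hy.
split; last by apply: degree_adjoin_eq (adjoin_ye x) (degree_xyz H).
- apply: degree_adjoin_eq (adjoin_e x) _; exact: degree_adjoin_quad.
- exact: degrees_xy.
Qed.

(** As y is in C(x, z), the extension C(x, y, z) of degree 4 is generated by z alone. *)
Lemma degrees6 : ~ adjoin (ratf y) [set x] z -> adjoin (ratf x) [set z] y ->
  degree_adjoin (ratf x) [set e] 4.
Proof.
move=> H Hy; apply: degree_adjoin_eq (adjoin_e x) _; apply: degree_adjoin_eq (degree_xyz H).
rewrite setUC -adjoin_adjoin (adjoin_id (adjoin_subfield _ _)) //.
by move=> _ ->.
Qed.

End Degrees.

(* A plane curve of bidegree (2, 2) without vertical or horizontal lines. *)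
Definition biquadratic (g : {mpoly C[2]}) : Prop :=
  [/\ g != 0, (forall j, vardeg j g = 2%N) &
      forall j w h, g = univ j w * h -> (size w <= 1)%N].

Lemma opair0 (A : Type) (x y : A) : opair x y 0 = x. Proof. by []. Qed.
Lemma opair1 (A : Type) (x y : A) : opair x y 1 = y. Proof. by []. Qed.

Lemma rev_ord20 : rev_ord 0 = 1 :> 'I_2. Proof. exact: val_inj. Qed.
Lemma rev_ord21 : rev_ord 1 = 0 :> 'I_2. Proof. exact: val_inj. Qed.

Lemma biquadratic_linked g x y : biquadratic g -> transc x -> transc y ->
  mmap iota (opair x y) g = 0 -> linked x y.
Proof.
move=> [g0 dg vg] tx ty gxy.
have tv j : transc (opair x y (rev_ord j)) by rewrite /opair; case: ifP.
have H j : quadratic_over (ratf (opair x y (rev_ord j))) (opair x y j).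
  by apply: (relation_quadratic (tv j) gxy) => //; rewrite dg.
have [f [[irrf [h gE]] fxy]] := root_factor (psi := mmap iota (opair x y)) g0 gxy.
have f0 : f != 0 by case: irrf.
have h0 : h != 0 by apply: contraNneq g0 => h0; rewrite gE h0 mul0r.
have D j : (vardeg j h + vardeg j f = 2)%N by rewrite -vardegM // -gE dg.
have pos j : (0 < vardeg j f)%N by exact: relation_degree_gt0 fxy.
(* A factor of degree 1 in one variable and 2 in the other would leave a cofactor depending on the
   first variable alone, that is, a line in the curve. *)
have S j : vardeg j f = 1%N -> vardeg (rev_ord j) f = 1%N.
  move=> fj; have hj : vardeg j h = 1%N by have := D j; rewrite fj addn1 => -[].
  have := D (rev_ord j); have := pos (rev_ord j).
  case: (vardeg (rev_ord j) f) => [|[|[|m]]] // _; last by rewrite !addnS.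
  rewrite addn2 => -[] /vardeg0 [w hE].
  have sw : (size w <= 1)%N by apply: (vg (rev_ord j) w f); rewrite -hE.
  by move: hj; rewrite hE (size1_polyC sw) /univ map_polyC hornerC /vardeg msuppC;
    case: ifP; rewrite ?big_nil ?big_seq1 ?mnm0E.
have T j : ratf (opair x y (rev_ord j)) (opair x y j) ->
    ratf (opair x y j) (opair x y (rev_ord j)).
  move=> /(irreducible_degree1 (tv j) irrf fxy) /S => fj.
  by have := relation_linear (tv (rev_ord j)) fxy fj; rewrite rev_ordK.
split.
- by have := H 1; rewrite rev_ord21.
- by have := H 0; rewrite rev_ord20.
by split; [have := T 1; rewrite rev_ord21|have := T 0; rewrite rev_ord20].
Qed.

Section OuterDegree.
Variables (x z : L) (f : {mpoly C[2]}).
Hypotheses (tx : transc x) (tz : transc z) (irrf : irreducible_mpoly f)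
  (fxz : mmap iota (opair x z) f = 0).

Let tv j : transc (opair x z (rev_ord j)).
Proof. by rewrite /opair; case: ifP. Qed.

Lemma outer_rational_factor : outer_rational x z -> linear_factor f.
Proof.
move=> [xz zx]; split; apply: (irreducible_degree1 (tv _) irrf fxz).
  by rewrite rev_ord20.
by rewrite rev_ord21.
Qed.

Lemma outer_quadratic_factor : outer_quadratic x z -> quadratic_factor f.
Proof.
move=> [qz nz qx nx].
have f0 : f != 0 by case: irrf.
have pos j : (0 < vardeg j f)%N by exact: relation_degree_gt0 fxz.
suff H j : quadratic_over (ratf (opair x z (rev_ord j))) (opair x z j) ->
    ~ ratf (opair x z (rev_ord j)) (opair x z j) -> vardeg j f = 2%N.
  by split; apply: H; rewrite ?rev_ord20 ?rev_ord21.
move=> /(irreducible_degree2 (tv j) irrf fxz) le nr.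
apply/eqP; rewrite eqn_leq le /= ltn_neqAle pos andbT.
by apply/eqP => /esym /(relation_linear (tv j) fxz).
Qed.

Lemma outer_quartic_factor : outer_quartic x z -> ~ linear_factor f /\ ~ quadratic_factor f.
Proof.
move=> [nz _]; have f0 : f != 0 by case: irrf.
have H : (2 < vardeg (1%R : 'I_2) f)%N.
  rewrite ltnNge; apply/negP => /(relation_quadratic (tv 1) fxz f0).
  by rewrite rev_ord21.
by split=> -[_ E]; rewrite E in H.
Qed.

End OuterDegree.

End FieldClassification.

(** * Independence of the component *)

Section Uniformity.
Variables (R : realType) (L L' : fieldType).
Local Notation C := R[i].
Variables (iota : {rmorphism C -> L}) (iota' : {rmorphism C -> L'}).
Local Notation evp' := (evp iota').
Local Notation evp := (evp iota).

(** If y is rational in x, then [g] splits into two factors of degree 1 in the second variable, and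
    every other pair of coordinates satisfies one of them. *)
Lemma linear_uniform (g : {mpoly C[2]}) x y x' y' : biquadratic g ->
  transc iota x -> transc iota y -> transc iota' x' -> transc iota' y' ->
  mmap iota (opair x y) g = 0 -> mmap iota' (opair x' y') g = 0 ->
  ratf iota x y -> ratf iota' x' y'.
Proof.
move=> bg tx ty tx' ty' gxy gxy' xy.
have [_ _ E] := biquadratic_linked bg tx ty gxy.
have [g0 dg _] := bg.
have [f [[irrf [h gE]] fxy]] := root_factor (psi := mmap iota (opair x y)) g0 gxy.
have fj : vardeg 1 f = 1%N.
  by apply: irreducible_degree1 irrf fxy _; rewrite rev_ord21.
have f0 : f != 0 by case: irrf.
have h0 : h != 0 by apply: contraNneq g0 => h0; rewrite gE h0 mul0r.
have hj : vardeg 1 h = 1%N.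
  by have := dg 1; rewrite gE vardegM // fj addn1 => -[].
have t' : transc iota' (opair x' y' (rev_ord 1)) by rewrite rev_ord21.
move: gxy'; rewrite gE rmorphM => /eqP; rewrite mulf_eq0 => /orP [] /eqP H.
  by have := relation_linear t' H hj; rewrite rev_ord21.
by have := relation_linear t' H fj; rewrite rev_ord21.
Qed.

Section Sigma.
Variables (y : L) (y' : L').
Hypotheses (ty : transc iota y) (ty' : transc iota' y').

(** The isomorphism from C(y) to C(y') that sends y to y', seen as a graph. *)
Definition ratg (u : L) (u' : L') : Prop :=
  exists p q, [/\ q != 0, u = evp y p / evp y q & u' = evp' y' p / evp' y' q].

Lemma ratg_iso : iso_graph ratg.
Proof.
split.
- by exists 1, 1; rewrite oner_eq0 !evp1 !divr1.
- move=> _ _ _ _ [p [q [q0 -> ->]]] [p1 [q1 [q10 -> ->]]].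
  exists (p * q1 - p1 * q), (q * q1); split; rewrite ?mulf_neq0 ?evpB ?evpM //.
    by rewrite frac_sub ?ty.
  by rewrite frac_sub ?ty'.
- move=> _ _ _ _ [p [q [q0 -> ->]]] [p1 [q1 [q10 -> ->]]].
  have [p10|p10] := eqVneq p1 0.
    exists 0, 1; rewrite oner_eq0 p10; split=> //.
      by rewrite !evp0 !mul0r invr0 mulr0.
    by rewrite !evp0 !mul0r invr0 mulr0.
  exists (p * q1), (q * p1); split; rewrite ?mulf_neq0 ?evpM //; exact: frac_div.
move=> _ _ [p [q [q0 -> ->]]]; have [->|p0] := eqVneq p 0; first by rewrite !evp0 !mul0r.
split=> /eqP; rewrite mulf_eq0 invr_eq0 (negPf (ty q0), negPf (ty' q0)) orbF.
  by rewrite (negPf (ty p0)).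
by rewrite (negPf (ty' p0)).
Qed.

Lemma ratg_dom u : gdom ratg u <-> ratf iota y u.
Proof.
split=> [[u' [p [q [q0 -> _]]]]|/ratfP [p [q [q0 ->]]]].
  by apply: (sf_div (ratf_subfield _ _)); exact: ratf_evp.
exists (evp' y' p / evp' y' q), p, q; split=> //.
by apply: contraNneq q0 => ->; rewrite evp0.
Qed.

Lemma ratg_ran u : gran ratg u <-> ratf iota' y' u.
Proof.
split=> [[u' [p [q [q0 _ ->]]]]|/ratfP [p [q [q0 ->]]]].
  by apply: (sf_div (ratf_subfield _ _)); exact: ratf_evp.
exists (evp y p / evp y q), p, q; split=> //.
by apply: contraNneq q0 => ->; rewrite evp0.
Qed.

Lemma ratg_evp p : ratg (evp y p) (evp' y' p).
Proof. by exists p, 1; rewrite oner_eq0 !evp1 !divr1. Qed.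

Lemma ratg_const c : ratg (iota c) (iota' c).
Proof. by have := ratg_evp c%:P; rewrite !evpC. Qed.

End Sigma.

Section Triples.
Variables (g1 g2 : {mpoly C[2]}) (x y z : L) (x' y' z' : L').
Hypotheses (bg1 : biquadratic g1) (bg2 : biquadratic g2)
  (ty : transc iota y) (ty' : transc iota' y')
  (r1 : mmap iota (opair x y) g1 = 0) (r1' : mmap iota' (opair x' y') g1 = 0)
  (r2 : mmap iota (opair y z) g2 = 0) (r2' : mmap iota' (opair y' z') g2 = 0)
  (nyx : ~ ratf iota y x) (nyx' : ~ ratf iota' y' x').

Let s0 := ratg y y'.
Let is0 : iso_graph s0 := ratg_iso ty ty'.
Let s1 := gext s0 x x'.

Let is1 : iso_graph s1.
Proof.
have [_ d1 _] := bg1.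
have [|c0 E] := @relation_quadratic_eq _ _ iota (opair x y) 0 g1 _ r1 (d1 0).
  by rewrite rev_ord20.
have [|_ E'] := @relation_quadratic_eq _ _ iota' (opair x' y') 0 g1 _ r1' (d1 0).
  by rewrite rev_ord20.
rewrite rev_ord20 opair0 opair1 in E; rewrite rev_ord20 opair0 opair1 in E'.
apply: (iso_graph_ext is0 _ _ E E').
- by apply: (ig_div is0); exact: ratg_evp.
- by apply: (ig_div is0); exact: ratg_evp.
- by move=> /ratg_dom.
- by move=> /ratg_ran.
Qed.

Lemma gdom_ext u : gdom s1 u <-> adjoin (ratf iota y) [set x] u.
Proof.
have sE := adjoin_subfield (ratf iota y) [set x].
split=> [[u' [a [a' [b [b' [sa sb -> _]]]]]]|].
  apply: (sfD sE); first by apply: adjoin_base; apply: (proj1 (ratg_dom _ y' _)); exists a'; exact: sa.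
  apply: (sfM sE); last exact: adjoin_gen1.
  by apply: adjoin_base; apply: (proj1 (ratg_dom _ y' _)); exists b'; exact: sb.
move: u; apply: adjoin_min; first exact: gdom_subfield.
  by move=> u /(ratg_dom _ y' _) [u' su]; exists u'; exact: gext_base.
by move=> _ ->; exists x'; exact: gext_gen.
Qed.

Lemma gran_ext u : gran s1 u <-> adjoin (ratf iota' y') [set x'] u.
Proof.
have sE := adjoin_subfield (ratf iota' y') [set x'].
split=> [[u' [a [a' [b [b' [sa sb _ ->]]]]]]|].
  apply: (sfD sE); first by apply: adjoin_base; apply: (proj1 (ratg_ran y _ _)); exists a; exact: sa.
  apply: (sfM sE); last exact: adjoin_gen1.
  by apply: adjoin_base; apply: (proj1 (ratg_ran y _ _)); exists b; exact: sb.
move: u; apply: adjoin_min; first exact: gran_subfield.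
  by move=> u /(ratg_ran y _ _) [u' su]; exists u'; exact: gext_base.
by move=> _ ->; exists x; exact: gext_gen.
Qed.

Let zquad : exists b b' c c', [/\ s0 b b', s0 c c', z ^+ 2 + b * z + c = 0 &
  z' ^+ 2 + b' * z' + c' = 0].
Proof.
have [_ d2 _] := bg2.
have [|c0 E] := @relation_quadratic_eq _ _ iota (opair y z) 1 g2 _ r2 (d2 1).
  by rewrite rev_ord21.
have [|_ E'] := @relation_quadratic_eq _ _ iota' (opair y' z') 1 g2 _ r2' (d2 1).
  by rewrite rev_ord21.
rewrite rev_ord21 opair0 opair1 in E; rewrite rev_ord21 opair0 opair1 in E'.
do 4!eexists; split; [| |exact: E|exact: E'];
  by apply: (ig_div is0); exact: ratg_evp.
Qed.

(** The isomorphism sends z to a root [w] of the equation of z'. So z' is [w] or the conjugate root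
    - w - b', and both lie in the extension. *)
Lemma same_ext_uniform : adjoin (ratf iota y) [set x] z ->
  adjoin (ratf iota' y') [set x'] z'.
Proof.
move=> /gdom_ext [w s1w]; have [b [b' [c [c' [sb sc E E']]]]] := zquad.
have wE : w ^+ 2 + b' * w + c' = 0.
  apply/(ig_eq0 is1 (u := z ^+ 2 + b * z + c)) => //.
  apply: (igD is1); last exact: gext_base.
  apply: (igD is1); first exact: igX.
  by apply: (igM is1) => //; exact: gext_base.
have H : (z' - w) * (z' + w + b') = 0.
  have -> : (z' - w) * (z' + w + b') =
      (z' ^+ 2 + b' * z' + c') - (w ^+ 2 + b' * w + c') by ring.
  by rewrite E' wE subrr.
have Hw : gran s1 w by exists z.
have sR := gran_subfield is1.
apply/gran_ext; move: H => /eqP; rewrite mulf_eq0 => /orP [].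
  by rewrite subr_eq0 => /eqP ->.
rewrite -addrA addr_eq0 => /eqP ->; apply: (sfN sR); apply: (sfD sR) => //.
by exists b; exact: gext_base.
Qed.

Hypotheses (nz : ~ adjoin (ratf iota y) [set x] z)
  (nz' : ~ adjoin (ratf iota' y') [set x'] z').

Let s2 := gext s1 z z'.

Let is2 : iso_graph s2.
Proof.
have [b [b' [c [c' [sb sc E E']]]]] := zquad.
apply: (iso_graph_ext is1 _ _ E E'); try exact: gext_base.
  by move=> /gdom_ext.
by move=> /gran_ext.
Qed.

(** The isomorphism of the two towers of degree 4 matches coordinates with coordinates, so it
    matches the values of every polynomial. The fractions in the last hypothesis accommodate y_1 and
    y_2. *)
Lemma kernel_uniform n (phi : {rmorphism {mpoly C[n]} -> L})
    (phi' : {rmorphism {mpoly C[n]} -> L'}) :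
  (forall c, phi c%:MP = iota c) -> (forall c, phi' c%:MP = iota' c) ->
  (forall i, exists a a' p q, [/\ [\/ a = x /\ a' = x', a = y /\ a' = y' | a = z /\ a' = z'],
     evp a q != 0, phi 'X_i = evp a p / evp a q & phi' 'X_i = evp' a' p / evp' a' q]) ->
  forall F, phi F = 0 <-> phi' F = 0.
Proof.
move=> phiC phiC' phiX F.
have b2 u u' : s0 u u' -> s2 u u' by move=> su; apply: (gext_base is1); exact: (gext_base is0).
have sev a a' p : s2 a a' -> s2 (evp a p) (evp' a' p).
  move=> sa; rewrite -[evp a p]/(map_poly iota p).[a] -[evp' a' p]/(map_poly iota' p).[a'].
  rewrite !horner_coef.
  rewrite !size_map_poly; elim: (size p) => [|k IHk].
    by rewrite !big_ord0; exact: (ig0 is2).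
  rewrite !big_ord_recr /=; apply: (igD is2) => //; apply: (igM is2).
    by rewrite !coef_map; apply: b2; exact: ratg_const.
  exact: (igX is2).
apply: (ig_eq0 is2); rewrite [F]mpolyE !rmorph_sum /=.
apply: (big_rec2 s2); first exact: (ig0 is2).
move=> m u u' _ su; apply: (igD is2) => //.
rewrite -mul_mpolyC !rmorphM /= phiC phiC'; apply: (igM is2).
  by apply: b2; exact: ratg_const.
rewrite mpolyXE_id !rmorph_prod /=; apply: (big_rec2 s2); first exact: (ig1 is2).
move=> i v v' _ sv; apply: (igM is2) => //.
rewrite !rmorphXn /=; apply: (igX is2).
have [a [a' [p [q [ca _ -> ->]]]]] := phiX i.
have sa : s2 a a'.
  case: ca => -[-> ->].
  - by apply: (gext_base is1); exact: (gext_gen is0).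
  - by apply: b2; have := ratg_evp y y' 'X; rewrite !evpX.
  - exact: (gext_gen is1).
by apply: (ig_div is2); exact: sev.
Qed.

End Triples.

End Uniformity.

(** * Continuity of roots *)

Section Sequences.
Variable K : numClosedFieldType.
Implicit Types (u v : nat -> K) (l m c : K).

Definition tendsto u l : Prop :=
  forall e : K, 0 < e -> exists N, forall n, (N <= n)%N -> `|u n - l| < e.

Lemma tendsto_ext u v l : (exists N, forall n, (N <= n)%N -> u n = v n) ->
  tendsto u l -> tendsto v l.
Proof.
move=> [N0 uv] ul e e0; have [N HN] := ul e e0; exists (maxn N0 N) => n.
by rewrite geq_max => /andP [n0 n1]; rewrite -uv // HN.
Qed.

Lemma tendsto_cst c : tendsto (fun=> c) c.
Proof. by move=> e e0; exists 0 => n _; rewrite subrr normr0. Qed.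

Lemma tendstoD u v l m : tendsto u l -> tendsto v m -> tendsto (fun n => u n + v n) (l + m).
Proof.
move=> ul vm e e0; have e2 : 0 < e / 2 by rewrite divr_gt0.
have [N HN] := ul _ e2; have [N' HN'] := vm _ e2; exists (maxn N N') => n.
rewrite geq_max => /andP [/HN n0 /HN' n1].
rewrite opprD addrACA [e]splitr; apply: le_lt_trans (ler_normD _ _) _.
exact: ltrD.
Qed.

Lemma tendsto_null u l : tendsto u l <-> tendsto (fun n => u n - l) 0.
Proof.
by split=> H e e0; have [N HN] := H e e0; exists N => n /HN; rewrite subr0.
Qed.

Lemma tendsto_scale0 c u : tendsto u 0 -> tendsto (fun n => c * u n) 0.
Proof.
move=> ul e e0; have c0 : 0 < `|c| + 1 by rewrite ltr_wpDl.
have [N HN] := ul _ (divr_gt0 e0 c0); exists N => n /HN.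
rewrite !subr0 ltr_pdivlMr // normrM => H; apply: le_lt_trans H.
by rewrite mulrC ler_wpM2l // lerDl.
Qed.

Lemma tendsto_mul0 u v : tendsto u 0 -> tendsto v 0 -> tendsto (fun n => u n * v n) 0.
Proof.
move=> ul vm e e0; have [N HN] := ul _ e0; have [N' HN'] := vm _ (ltr01 : 0 < 1 :> K).
exists (maxn N N') => n; rewrite geq_max => /andP [/HN n0 /HN' n1].
move: n0 n1; rewrite !subr0 normrM => n0 n1.
apply: le_lt_trans n0; rewrite -[leRHS]mulr1; apply: ler_wpM2l => //; exact: ltW.
Qed.

Lemma tendstoM u v l m : tendsto u l -> tendsto v m -> tendsto (fun n => u n * v n) (l * m).
Proof.
move=> /tendsto_null ul /tendsto_null vm; apply/tendsto_null.
have := tendstoD (tendstoD (tendsto_mul0 ul vm) (tendsto_scale0 m ul)) (tendsto_scale0 l vm).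
rewrite !addr0; apply: tendsto_ext; exists 0 => n _; ring.
Qed.

Lemma tendstoX u l k : tendsto u l -> tendsto (fun n => u n ^+ k) (l ^+ k).
Proof.
move=> ul; elim: k => [|k IHk]; first exact: tendsto_cst.
rewrite exprS; apply: tendsto_ext (tendstoM ul IHk); exists 0 => n _; exact: esym (exprS _ _).
Qed.

Lemma tendsto_sum (I : Type) (r : seq I) (F : I -> nat -> K) (l : I -> K) :
  (forall i, tendsto (F i) (l i)) -> tendsto (fun n => \sum_(i <- r) F i n) (\sum_(i <- r) l i).
Proof.
move=> H; elim: r => [|i r IHr].
  by rewrite big_nil; apply: tendsto_ext (tendsto_cst 0); exists 0 => n _; rewrite big_nil.
rewrite big_cons; apply: tendsto_ext (tendstoD (H i) IHr).
by exists 0 => n _; rewrite big_cons.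
Qed.

Lemma tendsto_prod (I : Type) (r : seq I) (F : I -> nat -> K) (l : I -> K) :
  (forall i, tendsto (F i) (l i)) -> tendsto (fun n => \prod_(i <- r) F i n) (\prod_(i <- r) l i).
Proof.
move=> H; elim: r => [|i r IHr].
  by rewrite big_nil; apply: tendsto_ext (tendsto_cst 1); exists 0 => n _; rewrite big_nil.
rewrite big_cons; apply: tendsto_ext (tendstoM (H i) IHr).
by exists 0 => n _; rewrite big_cons.
Qed.

Lemma tendsto_far u l : tendsto u l -> l != 0 ->
  exists N, forall n, (N <= n)%N -> `|l| / 2 < `|u n|.
Proof.
move=> ul l0; have l2 : 0 < `|l| / 2 by rewrite divr_gt0 // normr_gt0.
have [N HN] := ul _ l2; exists N => n /HN H.
rewrite -(ltrD2r (`|l| / 2)) -splitr.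
apply: le_lt_trans (_ : `|u n| + `|u n - l| < _); last by rewrite ltrD2l.
by rewrite -{1}(subKr (u n) l) (le_trans (ler_normB _ _)).
Qed.

Lemma tendsto_neq0 u l : tendsto u l -> l != 0 -> exists N, forall n, (N <= n)%N -> u n != 0.
Proof.
move=> ul l0; have [N HN] := tendsto_far ul l0; exists N => n /HN H.
by rewrite -normr_gt0; apply: lt_trans H; rewrite divr_gt0 // normr_gt0.
Qed.

(** For a nonzero leading coefficient take the root of smaller modulus: the product of the roots
    gives the first bound, their sum the second. *)
Lemma small_root (a b c : K) : (a != 0) || (b != 0) -> exists t,
  [/\ a * t ^+ 2 + b * t + c = 0, `|a| * `|t| ^+ 2 <= `|c| & `|b| * `|t| <= 2 * `|c|].
Proof.
have [->|a0] /= := eqVneq a 0.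
  move=> b0; exists (- c / b); rewrite mul0r add0r normr0 mul0r normrM normrN normfV.
  rewrite mulrC divfK // addNr; split=> //.
  by rewrite mulrC divfK ?normr_eq0 // ler_peMl // ler1n.
have core t t' : b = - (a * (t + t')) -> c = a * (t * t') -> `|t| <= `|t'| -> exists t,
    [/\ a * t ^+ 2 + b * t + c = 0, `|a| * `|t| ^+ 2 <= `|c| & `|b| * `|t| <= 2 * `|c|].
  move=> -> -> tt'; exists t; rewrite normrN !normrM; split; first by ring.
    by rewrite ler_wpM2l // expr2 ler_wpM2l.
  have -> : `|a| * `|t + t'| * `|t| = `|a| * `|t| * `|t + t'| by ring.
  have -> : 2 * (`|a| * (`|t| * `|t'|)) = `|a| * `|t| * (`|t'| + `|t'|) by ring.
  apply: ler_wpM2l; first by rewrite mulr_ge0.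
  by apply: le_trans (ler_normD _ _) _; rewrite lerD2r.
move=> _; pose P := Poly [:: c; b; a].
have PE t : P.[t] = a * t ^+ 2 + b * t + c by rewrite horner_Poly /=; ring.
have sP : size P = 3%N by rewrite (PolyK (c := 0)).
have [t1 /factor_theorem [Q QE]] : exists t, root P t.
  by apply/closed_rootP; rewrite sP.
have sQ : size Q = 2%N.
  have Q0 : Q != 0 by apply/eqP => Q0; move: sP; rewrite QE Q0 mul0r size_poly0.
  by move: sP; rewrite QE size_Mmonic ?monicXsubC // size_XsubC addn2 => -[].
have [t2 /factor_theorem [S SE]] : exists t, root Q t by apply/closed_rootP; rewrite sQ.
have SC : S = (lead_coef P)%:P.
  have sS : (size S <= 1)%N.
    have [->|S0] := eqVneq S 0; first by rewrite size_poly0.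
    by move: sQ; rewrite SE size_Mmonic ?monicXsubC // size_XsubC addn2 => -[] ->.
  rewrite QE SE !lead_coef_Mmonic ?monicXsubC //.
  by rewrite (size1_polyC sS) lead_coefC.
have lP : lead_coef P = a by rewrite lead_coefE sP coef_Poly.
have PE2 : P = a%:P * ('X - t2%:P) * ('X - t1%:P) by rewrite {1}QE SE SC lP.
have E x : a * x ^+ 2 + b * x + c = a * (x - t2) * (x - t1).
  by rewrite -PE PE2 !hornerE.
have cE : c = a * (t2 * t1).
  by have := E 0; rewrite expr0n /= !mulr0 !add0r => ->; ring.
have bE : b = - (a * (t2 + t1)).
  have := E 1; rewrite expr1n !mulr1 cE => H.
  have -> : b = (a + b + a * (t2 * t1)) - a - a * (t2 * t1) by ring.
  by rewrite H; ring.
have [le|le] := real_leP (normr_real t2) (normr_real t1).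
  exact: (core t2 t1).
by apply: (core t1 t2); [rewrite bE; ring|rewrite cE; ring|exact: ltW].
Qed.

Lemma null_root (a b c : nat -> K) (a0 b0 : K) : tendsto a a0 -> tendsto b b0 ->
  tendsto c 0 -> (a0 != 0) || (b0 != 0) ->
  exists t : nat -> K, tendsto t 0 /\
    exists N, forall n, (N <= n)%N -> a n * t n ^+ 2 + b n * t n + c n = 0.
Proof.
move=> ta tb tc ab0.
(* Made conditional so that a value can be chosen for every n; the condition holds from some rank
   on. *)
pose P n t := (a n != 0) || (b n != 0) ->
  [/\ a n * t ^+ 2 + b n * t + c n = 0, `|a n| * `|t| ^+ 2 <= `|c n| & `|b n| * `|t| <= 2 * `|c n|].
have exP n : exists t, P n t.
  have [H|H] := boolP ((a n != 0) || (b n != 0)); last by exists 0; rewrite /P (negPf H).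
  by have [t Ht] := small_root (c n) H; exists t => _.
pose t n := sval (cid (exP n)).
have tP n : P n (t n) := svalP (cid (exP n)).
(* If [a0] is nonzero the bound on a t^2 drives t to 0. Otherwise [b0] is nonzero, and the bound on
   b t does so even though the leading coefficient tends to 0. *)
exists t; have [a00|a00] := boolP (a0 == 0); last first.
  have [N HN] := tendsto_far ta a00.
  have an0 n : (N <= n)%N -> a n != 0.
    by move=> /HN H; rewrite -normr_gt0; apply: lt_trans H; rewrite divr_gt0 // normr_gt0.
  split; last by exists N => n /an0 H; have [|E _ _] := tP n; first by rewrite H.
  have g0 : 0 < `|a0| / 2 by rewrite divr_gt0 // normr_gt0.
  move=> e e0; have [N' HN'] := tc _ (mulr_gt0 g0 (exprn_gt0 2 e0)).
  exists (maxn N N') => n; rewrite geq_max => /andP [n0 n1].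
  have [|_ H _] := tP n; first by rewrite an0.
  rewrite subr0 -(ltr_pXn2r (n := 2)) ?nnegrE ?(ltW e0) //.
  rewrite -(ltr_pM2l g0); apply: le_lt_trans (_ : `|a n| * `|t n| ^+ 2 < _).
    by apply: ler_wpM2r; [exact: exprn_ge0|exact: ltW (HN _ n0)].
  by apply: le_lt_trans H _; have := HN' _ n1; rewrite subr0.
have b00 : b0 != 0 by move: ab0; rewrite a00.
have [N HN] := tendsto_far tb b00.
have bn0 n : (N <= n)%N -> b n != 0.
  by move=> /HN H; rewrite -normr_gt0; apply: lt_trans H; rewrite divr_gt0 // normr_gt0.
split; last by exists N => n /bn0 H; have [|E _ _] := tP n; first by rewrite H orbT.
have g0 : 0 < `|b0| / 2 by rewrite divr_gt0 // normr_gt0.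
move=> e e0; have [|N' HN'] := tc (`|b0| / 2 * e / 2); first by rewrite divr_gt0 // mulr_gt0.
exists (maxn N N') => n; rewrite geq_max => /andP [n0 n1].
have [|_ _ H] := tP n; first by rewrite bn0 ?orbT.
rewrite subr0 -(ltr_pM2l g0); apply: le_lt_trans (_ : `|b n| * `|t n| < _).
  by apply: ler_wpM2r => //; exact: ltW (HN _ n0).
apply: le_lt_trans H _; have := HN' _ n1; rewrite subr0 ltr_pdivlMr //.
by rewrite mulrC.
Qed.

End Sequences.

(** * Bihomogeneous forms *)

Lemma finite_by (T U : Type) (S : set T) (f : T -> U) :
  finite_set (f @` S) -> (forall u, finite_set (S `&` [set x | f x = u])) -> finite_set S.
Proof.
move=> fS H; apply: sub_finite_set (bigcup_finite fS (fun u _ => H u)) => x Sx.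
by exists (f x); [exists x|split].
Qed.

Lemma finite_roots (F : closedFieldType) (P : {poly F}) :
  P != 0 -> finite_set [set x | root P x].
Proof.
move=> P0; have [s PE] := closed_field_poly_normal P.
apply: (sub_finite_set _ (finite_seq s)) => x /=.
by rewrite PE rootZ ?lead_coef_eq0 // root_prod_XsubC.
Qed.

Section Biforms.
Variable R : realType.
Local Notation C := R[i].
Implicit Types (D : nat) (G : nat -> nat -> C) (h : C * C) (p q : CP1 R).

Lemma tendsto_inv : tendsto (fun n => n.+1%:R^-1 : C) 0.
Proof.
move=> e e0; have eE : (complex.Re e)%:C%C = e :> C by exact: RRe_real (ger0_real (ltW e0)).
have re0 : 0 < complex.Re e by move: e0; rewrite -[in X in X -> _]eE ltcR.
exists (Num.bound (complex.Re e)^-1) => n Hn; rewrite subr0 ger0_norm ?invr_ge0 ?ler0n //.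
rewrite -eE invf_plt ?posrE ?ltcR ?ltr0n // -fmorphV /=.
have -> : n.+1%:R = (n.+1%:R : R)%:C%C by rewrite rmorph_nat.
rewrite ltcR; apply: lt_le_trans (archi_boundP _) _; first by rewrite invr_ge0 ltW.
by rewrite ler_nat (leq_trans Hn).
Qed.

Definition bco D G (k : nat) h : C := \sum_(l < D.+1) G k l * (h.1 ^+ l * h.2 ^+ (D - l)).

Definition bform D G h h' : C := \sum_(k < D.+1) bco D G k h' * (h.1 ^+ k * h.2 ^+ (D - k)).

Definition gtr G k l := G l k.

Lemma bform_tr D G h h' : bform D (gtr G) h h' = bform D G h' h.
Proof.
rewrite /bform /bco; under eq_bigr do rewrite mulr_suml.
under [RHS]eq_bigr do rewrite mulr_suml.
rewrite exchange_big; apply: eq_bigr => k _; apply: eq_bigr => l _.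
by rewrite /gtr mulrAC.
Qed.

(* The curve of bidegree (D, D) contains no horizontal or vertical line of CP^1 x CP^1. *)
Definition nonvertical D G : Prop :=
  (forall q, exists2 k, (k <= D)%N & bco D G k (hcoord q) != 0) /\
  (forall q, exists2 k, (k <= D)%N & bco D (gtr G) k (hcoord q) != 0).

Lemma nonvertical_tr D G : nonvertical D G -> nonvertical D (gtr G).
Proof. by case. Qed.

Lemma bform_affine D G (w : C) h : bform D G (w, 1) h = (\poly_(k < D.+1) bco D G k h).[w].
Proof. by rewrite horner_poly; apply: eq_bigr => k _; rewrite /= expr1n mulr1. Qed.

Lemma bform_infty D G h : bform D G (1, 0) h = bco D G D h.
Proof.
rewrite /bform big_ord_recr /= subnn expr1n mul1r expr0 mulr1 big1 ?add0r // => k _.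
by rewrite expr0n subn_eq0 leqNgt ltn_ord mulr0 mulr0.
Qed.

(** A polynomial without root is a nonzero constant; its coefficient in degree D > 0 is then 0,
    which makes infinity a root. *)
Lemma bform_root D G h : (0 < D)%N -> exists p, bform D G (hcoord p) h = 0.
Proof.
move=> D0; pose P := \poly_(k < D.+1) bco D G k h.
have [/closed_rootP [w /rootP Pw]|/negbNE/eqP sP] := boolP (size P != 1).
  by exists (Some w); rewrite bform_affine.
exists None; rewrite bform_infty.
have : P`_D = 0 by apply: nth_default; rewrite sP.
by rewrite coef_poly ltnSn.
Qed.

Lemma bform_finite D G h : (exists2 k, (k <= D)%N & bco D G k h != 0) ->
  finite_set [set p | bform D G (hcoord p) h = 0].
Proof.
move=> [k kD ck]; pose P := \poly_(k < D.+1) bco D G k h.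
have P0 : P != 0.
  by apply: contraNneq ck => /(congr1 (fun p : {poly C} => p`_k)); rewrite coef_poly ltnS kD coef0 => ->.
apply: (sub_finite_set (B := [set None] `|` Some @` [set x | root P x])).
  move=> [w|] /= H; last by left.
  by right; exists w => //=; apply/rootP; rewrite -bform_affine.
by rewrite finite_setU; split; [exact: finite_set1|apply: finite_image; exact: finite_roots].
Qed.

(** Limits are taken on pairs of homogeneous coordinates; [topt] returns to points of CP^1, and
    [tsc] is the factor of proportionality with [hcoord]. *)
Definition topt h : CP1 R := if h.2 == 0 then None else Some (h.1 / h.2).
Definition tsc h : C := if h.2 == 0 then h.1 else h.2.

Lemma toptE h : h = (tsc h * (hcoord (topt h)).1, tsc h * (hcoord (topt h)).2).
Proof.
rewrite /tsc /topt; case: h => u v /=; case: eqP => [->|/eqP v0] /=.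
  by rewrite mulr1 mulr0.
by rewrite mulr1 mulrC divfK.
Qed.

Lemma tsc_neq0 h : (h.1 != 0) || (h.2 != 0) -> tsc h != 0.
Proof. by rewrite /tsc; have [_|//] := eqVneq h.2 0; rewrite orbF. Qed.

Lemma bform_scale D G t h h' : bform D G (t * h.1, t * h.2) h' = t ^+ D * bform D G h h'.
Proof.
rewrite /bform mulr_sumr; apply: eq_bigr => k _ /=.
rewrite !exprMn [RHS]mulrCA; congr (_ * _).
have -> : t ^+ D = t ^+ k * t ^+ (D - k) by rewrite -exprD subnKC // -ltnS.
by rewrite mulrACA.
Qed.

Lemma bform_topt D G h h' : (h.1 != 0) || (h.2 != 0) -> (h'.1 != 0) || (h'.2 != 0) ->
  bform D G h h' = 0 -> bform D G (hcoord (topt h)) (hcoord (topt h')) = 0.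
Proof.
move=> h0 h0' E; apply/eqP; move/eqP: E.
rewrite {1}[h]toptE bform_scale mulf_eq0 expf_eq0 (negPf (tsc_neq0 h0)) andbF /=.
rewrite -bform_tr {1}[h']toptE bform_scale mulf_eq0 expf_eq0 (negPf (tsc_neq0 h0')) andbF /=.
by rewrite bform_tr.
Qed.

Lemma bco_tendsto D G k (X : nat -> C * C) h : tendsto (fun n => (X n).1) h.1 ->
  tendsto (fun n => (X n).2) h.2 -> tendsto (fun n => bco D G k (X n)) (bco D G k h).
Proof.
move=> X1 X2; apply: tendsto_sum => l; apply: tendstoM; first exact: tendsto_cst.
by apply: tendstoM; exact: tendstoX.
Qed.

Definition tendsto2 (X : nat -> C * C) h :=
  tendsto (fun n => (X n).1) h.1 /\ tendsto (fun n => (X n).2) h.2.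

Definition nonzero2 h := (h.1 != 0) || (h.2 != 0).

Lemma bform1E G h h' : bform 1 G h h' = bco 1 G 1 h' * h.1 + bco 1 G 0 h' * h.2.
Proof. by rewrite /bform !big_ord_recl big_ord0 /bump /=; ring. Qed.

Lemma bform2E G h h' : bform 2 G h h' =
  bco 2 G 2 h' * h.1 ^+ 2 + bco 2 G 1 h' * (h.1 * h.2) + bco 2 G 0 h' * h.2 ^+ 2.
Proof. by rewrite /bform !big_ord_recl big_ord0 /bump /=; ring. Qed.

(** With the moving root written as w + t, or as [1 : t] near infinity, the constant term of the
    equation in t tends to 0. The coefficient that is nonzero at [q] keeps the limit equation from
    being trivial. *)
Lemma bform_root_tendsto D G (X : nat -> C * C) q p : (D = 1 \/ D = 2) ->
  tendsto2 X (hcoord q) -> (exists2 k, (k <= D)%N & bco D G k (hcoord q) != 0) ->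
  bform D G (hcoord p) (hcoord q) = 0 ->
  exists Y : nat -> C * C, [/\ tendsto2 Y (hcoord p), (forall n, nonzero2 (Y n)) &
    exists N, forall n, (N <= n)%N -> bform D G (Y n) (X n) = 0].
Proof.
move=> D12 [X1 X2] nz Bp.
have tc k : tendsto (fun n => bco D G k (X n)) (bco D G k (hcoord q)) by exact: bco_tendsto.
pose c k n := bco D G k (X n); pose c0 k := bco D G k (hcoord q).
have [[w pE]|pE] : (exists w, p = Some w) \/ p = None.
  by case: (p) => [w|]; [left; exists w|right].
  pose Y (t : nat -> C) n : C * C := (w + t n, 1).
  have tY t : tendsto t 0 -> tendsto2 (Y t) (hcoord (Some w)).
    move=> t0; split=> /=; last exact: tendsto_cst.
    have := tendstoD (tendsto_cst w) t0; by rewrite addr0.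
  have nY t n : nonzero2 (Y t n) by rewrite /nonzero2 /= oner_eq0 orbT.
  case: D12 nz Bp => D12; subst D; rewrite pE.
    move=> [k k1 ck]; rewrite bform1E /= -/(c0 1%N) -/(c0 0%N) mulr1 => E.
    have c1 : c0 1%N != 0.
      apply: contraTneq ck => c10; move: E; rewrite c10 mul0r add0r => c00.
      by case: k k1 => [|[|//]] _; rewrite negbK; apply/eqP.
    have tz : tendsto (fun n => c 1%N n * w + c 0%N n) 0.
      by rewrite -E; apply: tendstoD (tc 0%N); apply: tendstoM; [exact: tc|exact: tendsto_cst].
    have [|t [t0 [N HN]]] := null_root (tendsto_cst 0) (tc 1%N) tz.
      by rewrite c1 orbT.
    exists (Y t); split; [exact: tY|exact: nY|exists N => n /HN H].
    by rewrite bform1E /= -H /c; ring.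
  move=> [k k1 ck]; rewrite bform2E /= -/(c0 2%N) -/(c0 1%N) -/(c0 0%N) => E.
  have tb : tendsto (fun n => c 2%N n * w *+ 2 + c 1%N n) (c0 2%N * w *+ 2 + c0 1%N).
    apply: tendstoD (tc 1%N); rewrite mulr2n; apply: tendstoD.
      by apply: tendstoM; [exact: tc|exact: tendsto_cst].
    by apply: tendstoM; [exact: tc|exact: tendsto_cst].
  have tz : tendsto (fun n => c 2%N n * w ^+ 2 + c 1%N n * (w * 1) + c 0%N n * 1 ^+ 2) 0.
    rewrite -E; apply: tendstoD; [apply: tendstoD|]; apply: tendstoM;
      try exact: tc; exact: tendsto_cst.
  have [|t [t0 [N HN]]] := null_root (tc 2%N) tb tz.
    apply: contraTT ck; rewrite negb_or !negbK => /andP [/eqP c2]; rewrite -/(c0 2%N) in c2.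
    rewrite c2 mul0r mul0rn add0r => /eqP c1; move: E; rewrite c2 c1 !mul0r !add0r expr1n mulr1 => c00.
    by case: k k1 => [|[|[|//]]] _; apply/eqP.
  exists (Y t); split; [exact: tY|exact: nY|exists N => n /HN H].
  by rewrite bform2E /= -H /c; ring.
pose Y (t : nat -> C) n : C * C := (1, t n).
have tY t : tendsto t 0 -> tendsto2 (Y t) (hcoord (None : CP1 R)).
  by move=> t0; split=> //=; exact: tendsto_cst.
have nY t n : nonzero2 (Y t n) by rewrite /nonzero2 /= oner_eq0.
case: D12 nz Bp => D12; subst D; rewrite pE.
  move=> [k k1 ck]; rewrite bform1E /= -/(c0 1%N) mulr1 mulr0 addr0 => E.
  have c00 : c0 0%N != 0.
    by apply: contraTneq ck => c00; case: k k1 => [|[|//]] _; rewrite negbK; apply/eqP.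
  have tz : tendsto (c 1%N) 0 by rewrite -E; exact: tc.
  have [|t [t0 [N HN]]] := null_root (tendsto_cst 0) (tc 0%N) tz.
    by rewrite c00 orbT.
  exists (Y t); split; [exact: tY|exact: nY|exists N => n /HN H].
  by rewrite bform1E /= -H /c; ring.
move=> [k k1 ck]; rewrite bform2E /= -/(c0 2%N) -/(c0 1%N) -/(c0 0%N) => E.
have c2 : c0 2%N = 0 by move: E; rewrite expr1n mulr1 expr0n /= !mulr0 !addr0.
have tz : tendsto (c 2%N) 0 by rewrite -c2; exact: tc.
have [|t [t0 [N HN]]] := null_root (tc 0%N) (tc 1%N) tz.
  apply: contraTT ck; rewrite negb_or !negbK => /andP [/eqP ? /eqP ?].
  by case: k k1 => [|[|[|//]]] _; apply/eqP.
exists (Y t); split; [exact: tY|exact: nY|exists N => n /HN H].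
by rewrite bform2E /= -H /c; ring.
Qed.

End Biforms.

(** * The zero set of a coupling *)

Section Bipoly.
Variables (R : realType) (n : nat) (a b : 'I_n).
Hypothesis ab : a != b.
Local Notation C := R[i].
Implicit Types (D k l : nat) (G : nat -> nat -> C).

Definition bimn k l : 'X_{1..n} := (U_(a) *+ k + U_(b) *+ l)%MM.

Definition bipoly D G : {mpoly C[n]} :=
  \sum_(k < D.+1) \sum_(l < D.+1) G k l *: 'X_[bimn k l].

Lemma bimna k l : bimn k l a = k.
Proof. by rewrite /bimn mnmDE !mulmnE !mnm1E eqxx eq_sym (negPf ab) mul1n mul0n addn0. Qed.

Lemma bimnb k l : bimn k l b = l.
Proof. by rewrite /bimn mnmDE !mulmnE !mnm1E eqxx (negPf ab) mul1n mul0n. Qed.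

Lemma bimn_other k l j : j != a -> j != b -> bimn k l j = 0%N.
Proof.
by move=> ja jb; rewrite /bimn mnmDE !mulmnE !mnm1E ![_ == j]eq_sym (negPf ja) (negPf jb).
Qed.

Lemma coef_bipoly D G k l : (k <= D)%N -> (l <= D)%N -> (bipoly D G)@_(bimn k l) = G k l.
Proof.
move=> kD lD; pose k' : 'I_D.+1 := Ordinal (kD : (k < D.+1)%N).
pose l' : 'I_D.+1 := Ordinal (lD : (l < D.+1)%N).
rewrite raddf_sum /= (bigD1 k') //= raddf_sum /= (bigD1 l') //= mcoeffZ mcoeffX eqxx mulr1.
rewrite big1 => [|j jl]; last first.
  rewrite mcoeffZ mcoeffX; case: eqP => [E|]; last by rewrite mulr0.
  by case/eqP: jl; apply: val_inj => /=; rewrite -(bimnb k j) E bimnb.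
rewrite addr0 big1 ?addr0 // => i ik; rewrite raddf_sum big1 //= => j _.
rewrite mcoeffZ mcoeffX; case: eqP => [E|]; last by rewrite mulr0.
by case/eqP: ik; apply: val_inj => /=; rewrite -(bimna i j) E bimna.
Qed.

Lemma msupp_bipoly D G m : m \in msupp (bipoly D G) ->
  exists k l, [/\ (k <= D)%N, (l <= D)%N & m = bimn k l].
Proof.
rewrite mcoeff_msupp => /eqP nz; apply: contrapT => H; apply: nz.
rewrite raddf_sum big1 //= => k _; rewrite raddf_sum big1 //= => l _.
rewrite mcoeffZ mcoeffX; case: eqP => [E|]; last by rewrite mulr0.
by case: H; exists k, l; split=> //; rewrite -ltnS.
Qed.

Lemma bco_infty D G k : bco D G k (hcoord (None : CP1 R)) = G k D.
Proof.
rewrite /bco big_ord_recr /= subnn expr1n mul1r expr0 mulr1 big1 ?add0r // => l _.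
by rewrite expr0n subn_eq0 leqNgt ltn_ord !mulr0.
Qed.

(** The absence of lines at infinity says that the degrees are exactly D, so that [vanishes] and
    [bform] homogenize in the same degree. *)
Lemma vardeg_bipoly D G j : nonvertical D G ->
  vardeg j (bipoly D G) = if (j == a) || (j == b) then D else 0%N.
Proof.
move=> [nv1 nv2]; apply/eqP; rewrite eqn_leq; apply/andP; split.
  apply/bigmax_leqP_seq => m /msupp_bipoly [k [l [kD lD ->]]] _.
  have [->|ja] := eqVneq j a; first by rewrite bimna.
  have [->|jb] := eqVneq j b; first by rewrite bimnb.
  by rewrite bimn_other.
have big i m : m \in msupp (bipoly D G) -> (m i <= vardeg i (bipoly D G))%N.
  by move=> mm; exact: (@leq_bigmax_seq _ _ predT (fun m : 'X_{1..n} => m i) _ mm isT).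
have [->|ja] /= := eqVneq j a.
  have [k kD] := nv2 None; rewrite bco_infty => nz.
  have := big a (bimn D k); rewrite bimna; apply.
  by rewrite mcoeff_msupp coef_bipoly.
have [->|jb] //= := eqVneq j b.
have [k kD] := nv1 None; rewrite bco_infty => nz.
have := big b (bimn k D); rewrite bimnb; apply.
by rewrite mcoeff_msupp coef_bipoly.
Qed.

Lemma bipoly_neq0 D G : nonvertical D G -> bipoly D G != 0.
Proof.
move=> [nv1 nv2]; have [k kD] := nv1 None; rewrite bco_infty.
by apply: contra_neq => E; rewrite -(coef_bipoly G kD (leqnn D)) E mcoeff0.
Qed.

Lemma vanishes_bipoly D G p : nonvertical D G ->
  vanishes (bipoly D G) p <-> bform D G (hcoord (p a)) (hcoord (p b)) = 0.
Proof.
move=> nv; suff -> : vanishes (bipoly D G) p =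
    (bform D G (hcoord (p a)) (hcoord (p b)) = 0) by [].
rewrite /vanishes {2}/bipoly hval_sum; congr (_ = 0); apply: eq_bigr => k _.
rewrite hval_sum /bco mulr_suml; apply: eq_bigr => l _.
rewrite hvalZ hvalX -mulrA; congr (_ * _).
rewrite /hmon (bigD1 a) //= (bigD1 b) 1?eq_sym //= big1 => [|j /andP [ja jb]].
  by rewrite !vardeg_bipoly // !eqxx orbT bimna bimnb mulr1 mulrC.
by rewrite vardeg_bipoly // (negPf ja) (negPf jb) bimn_other // subnn !expr0 mulr1.
Qed.

End Bipoly.

Section CouplingSet.
Variable R : realType.
Local Notation C := R[i].
Local Notation pt := ('I_5 -> CP1 R).
Variables G1 G2 H1 H2 : nat -> nat -> C.
Hypotheses (nG1 : nonvertical 2 G1) (nG2 : nonvertical 2 G2)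
  (nH1 : nonvertical 1 H1) (nH2 : nonvertical 1 H2).

Notation o0 := (@Ordinal 5 0 isT).
Notation o1 := (@Ordinal 5 1 isT).
Notation o2 := (@Ordinal 5 2 isT).
Notation o3 := (@Ordinal 5 3 isT).
Notation o4 := (@Ordinal 5 4 isT).
Local Notation hc := hcoord.

Definition cgens : seq {mpoly C[5]} :=
  [:: bipoly o0 o1 2 G1; bipoly o1 o2 2 G2; bipoly o3 o1 1 H1; bipoly o4 o2 1 H2].

Let Z := zeros cgens.

Lemma ZP p : Z p <-> [/\ bform 2 G1 (hc (p o0)) (hc (p o1)) = 0,
  bform 2 G2 (hc (p o1)) (hc (p o2)) = 0, bform 1 H1 (hc (p o3)) (hc (p o1)) = 0 &
  bform 1 H2 (hc (p o4)) (hc (p o2)) = 0].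
Proof.
split=> [Zp|[E1 E2 E3 E4] f].
  by split; apply/vanishes_bipoly => //; apply: Zp; rewrite !inE eqxx ?orbT.
by rewrite !inE => /or4P [] /eqP ->; apply/vanishes_bipoly.
Qed.

Lemma ord5P (j : 'I_5) : [\/ j = o0, j = o1 | j = o2] \/ (j = o3 \/ j = o4).
Proof.
case: j => [[|[|[|[|[|//]]]]] ?].
- by left; constructor 1; apply: val_inj.
- by left; constructor 2; apply: val_inj.
- by left; constructor 3; apply: val_inj.
- by right; left; apply: val_inj.
- by right; right; apply: val_inj.
Qed.

(** Once x_2 is fixed, each remaining coordinate is a root of a nontrivial equation, in the order
    x_1, x_3, y_1, y_2. *)
Lemma fibre1 c : finite_set (Z `&` [set p | p o1 = c]).
Proof.
apply: (finite_by (f := fun p : pt => p o0)).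
  apply: (sub_finite_set (B := [set x | bform 2 G1 (hc x) (hc c) = 0])).
    by move=> _ [p [/ZP [E _ _ _] <-] <-].
  by apply: bform_finite; have [H _] := nG1; exact: H.
move=> c0; apply: (finite_by (f := fun p : pt => p o2)).
  apply: (sub_finite_set (B := [set x | bform 2 (gtr G2) (hc x) (hc c) = 0])).
    by move=> _ [p [[/ZP [_ E _ _] <-] _] <-]; rewrite /= bform_tr.
  by apply: bform_finite; have [_ H] := nG2; exact: H.
move=> c2; apply: (finite_by (f := fun p : pt => p o3)).
  apply: (sub_finite_set (B := [set x | bform 1 H1 (hc x) (hc c) = 0])).
    by move=> _ [p [[[/ZP [_ _ E _] <-] _] _] <-].
  by apply: bform_finite; have [H _] := nH1; exact: H.
move=> c3; apply: (finite_by (f := fun p : pt => p o4)).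
  apply: (sub_finite_set (B := [set x | bform 1 H2 (hc x) (hc c2) = 0])).
    by move=> _ [p [[[[/ZP [_ _ _ E] _] _] <-] _] <-].
  by apply: bform_finite; have [H _] := nH2; exact: H.
move=> c4; pose q : pt := fun j => nth None [:: c0; c; c2; c3; c4] j.
apply: (sub_finite_set _ (finite_set1 q)) => p [[[[[_ /= E1] /= E0] /= E2] /= E3] /= E4].
apply: functional_extensionality_dep => j.
by case: (ord5P j) => [[]|[]] ->; rewrite ?E0 ?E1 ?E2 ?E3 ?E4.
Qed.

Lemma fibre0 c : finite_set (Z `&` [set p | p o0 = c]).
Proof.
apply: (finite_by (f := fun p : pt => p o1)).
  apply: (sub_finite_set (B := [set x | bform 2 (gtr G1) (hc x) (hc c) = 0])).
    by move=> _ [p [/ZP [E _ _ _] <-] <-]; rewrite /= bform_tr.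
  by apply: bform_finite; have [_ H] := nG1; exact: H.
by move=> u; apply: sub_finite_set (fibre1 u) => p [[]].
Qed.

Lemma fibre2 c : finite_set (Z `&` [set p | p o2 = c]).
Proof.
apply: (finite_by (f := fun p : pt => p o1)).
  apply: (sub_finite_set (B := [set x | bform 2 G2 (hc x) (hc c) = 0])).
    by move=> _ [p [/ZP [_ E _ _] <-] <-].
  by apply: bform_finite; have [H _] := nG2; exact: H.
by move=> u; apply: sub_finite_set (fibre1 u) => p [[]].
Qed.

Lemma fibre3 c : finite_set (Z `&` [set p | p o3 = c]).
Proof.
apply: (finite_by (f := fun p : pt => p o1)).
  apply: (sub_finite_set (B := [set x | bform 1 (gtr H1) (hc x) (hc c) = 0])).
    by move=> _ [p [/ZP [_ _ E _] <-] <-]; rewrite /= bform_tr.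
  by apply: bform_finite; have [_ H] := nH1; exact: H.
by move=> u; apply: sub_finite_set (fibre1 u) => p [[]].
Qed.

Lemma fibre4 c : finite_set (Z `&` [set p | p o4 = c]).
Proof.
apply: (finite_by (f := fun p : pt => p o2)).
  apply: (sub_finite_set (B := [set x | bform 1 (gtr H2) (hc x) (hc c) = 0])).
    by move=> _ [p [/ZP [_ _ _ E] <-] <-]; rewrite /= bform_tr.
  by apply: bform_finite; have [_ H] := nH2; exact: H.
by move=> u; apply: sub_finite_set (fibre2 u) => p [[]].
Qed.

Lemma fibre j c : finite_set (Z `&` [set p | p j = c]).
Proof.
case: (ord5P j) => [[]|[]] ->;
  [exact: fibre0|exact: fibre1|exact: fibre2|exact: fibre3|exact: fibre4].
Qed.

Lemma infinite_at_infty : finite_set (Z `&` [set p | exists j, p j = None]).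
Proof.
have : finite_set (\bigcup_(j in [set: 'I_5]) (Z `&` [set p | p j = None])).
  by apply: bigcup_finite => [|j _]; [exact: finite_finset|exact: fibre].
by apply: sub_finite_set => p [Zp [j pj]]; exists j.
Qed.

(** [hval] on arbitrary homogeneous coordinates, where continuity makes sense. *)
Definition hvalh d (f : {mpoly C[5]}) (h : 'I_5 -> C * C) : C :=
  \sum_(m <- msupp f) f@_m * \prod_(j < 5) ((h j).1 ^+ m j * (h j).2 ^+ (d j - m j)).

Lemma hvalh_scale d f (t : 'I_5 -> C) h : admissible d f ->
  hvalh d f (fun j => (t j * (h j).1, t j * (h j).2)) = (\prod_j t j ^+ d j) * hvalh d f h.
Proof.
move=> df; rewrite /hvalh mulr_sumr big_seq [RHS]big_seq; apply: eq_bigr => m mf.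
rewrite mulrCA; congr (_ * _); rewrite -big_split; apply: eq_bigr => j _ /=.
by rewrite !exprMn mulrACA -exprD subnKC // (admissibleP j df mf).
Qed.

Lemma hvalh_topt d f h : admissible d f -> hvalh d f h != 0 ->
  hval d f (fun j => topt (h j)) != 0.
Proof.
move=> df; apply: contra_neq => E.
have -> : h = fun j => (tsc (h j) * (hc (topt (h j))).1, tsc (h j) * (hc (topt (h j))).2).
  by apply: functional_extensionality_dep => j; exact: toptE.
by rewrite (hvalh_scale _ (fun j => hc (topt (h j)))) // -[hvalh _ _ _]/(hval d f _) E mulr0.
Qed.

Lemma hvalh_tendsto d f (h : nat -> 'I_5 -> C * C) h0 :
  (forall j, tendsto2 (fun n => h n j) (h0 j)) ->
  tendsto (fun n => hvalh d f (h n)) (hvalh d f h0).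
Proof.
move=> H; apply: tendsto_sum => m; apply: tendstoM; first exact: tendsto_cst.
by apply: tendsto_prod => j; have [? ?] := H j; apply: tendstoM; exact: tendstoX.
Qed.

Lemma move_point (q : CP1 R) : exists X : nat -> C * C, [/\ tendsto2 X (hc q),
  (forall n, nonzero2 (X n)) & forall n, topt (X n) <> q].
Proof.
case: q => [w|].
  exists (fun n => (w + n.+1%:R^-1, 1)); split.
  - split=> /=; last exact: tendsto_cst.
    by have := tendstoD (tendsto_cst w) (@tendsto_inv R); rewrite addr0.
  - by move=> n; rewrite /nonzero2 /= oner_eq0 orbT.
  move=> n; rewrite /topt /= oner_eq0 divr1 => -[] /eqP.
  by rewrite -subr_eq0 addrAC subrr add0r invr_eq0 pnatr_eq0.
exists (fun n => (1, n.+1%:R^-1)); split.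
- by split=> /=; [exact: tendsto_cst|exact: tendsto_inv].
- by move=> n; rewrite /nonzero2 /= oner_eq0.
by move=> n; rewrite /topt /= invr_eq0 pnatr_eq0.
Qed.

(* Z has no isolated point: move x_2, the other coordinates follow by continuity of roots. *)
Lemma lift_point p d f : Z p -> admissible d f -> hval d f p != 0 ->
  exists q, [/\ Z q, q <> p & hval d f q != 0].
Proof.
move=> /ZP [E1 E2 E3 E4] df fp.
have [X [tX nX neX]] := move_point (p o1).
have [Y0 [tY0 nY0 [N0 HY0]]] :=
  bform_root_tendsto (or_intror erefl) tX (proj1 nG1 (p o1)) E1.
have [Y2 [tY2 nY2 [N2 HY2]]] :=
  bform_root_tendsto (or_intror erefl) tX (proj2 nG2 (p o1)) (etrans (bform_tr _ _ _ _) E2).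
have [Y3 [tY3 nY3 [N3 HY3]]] :=
  bform_root_tendsto (or_introl erefl) tX (proj1 nH1 (p o1)) E3.
have [Y4 [tY4 nY4 [N4 HY4]]] :=
  bform_root_tendsto (or_introl erefl) tY2 (proj1 nH2 (p o2)) E4.
pose h n (j : 'I_5) := nth (0, 0) [:: Y0 n; X n; Y2 n; Y3 n; Y4 n] j.
have th j : tendsto2 (fun n => h n j) (hc (p j)).
  by case: (ord5P j) => [[]|[]] ->.
have [N HN] := tendsto_neq0 (hvalh_tendsto d f th) fp.
pose n := maxn (maxn N0 N2) (maxn (maxn N3 N4) N).
have [n0 n2 n3 n4 nN] : [/\ (N0 <= n)%N, (N2 <= n)%N, (N3 <= n)%N, (N4 <= n)%N & (N <= n)%N].
  by rewrite /n; split; rewrite !leq_max leqnn ?orbT.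
exists (fun j => topt (h n j)); split.
- apply/ZP; split; rewrite /h /=.
  + exact: (bform_topt (nY0 n) (nX n) (HY0 n n0)).
  + by apply: (bform_topt (nX n) (nY2 n)); rewrite -bform_tr; exact: HY2.
  + exact: (bform_topt (nY3 n) (nX n) (HY3 n n3)).
  + exact: (bform_topt (nY4 n) (nY2 n) (HY4 n n4)).
- by move=> /(congr1 (fun g => g o1)); rewrite /h /=; exact: neX.
by apply: hvalh_topt => //; exact: HN.
Qed.

Lemma closedZ : zariski_closed Z. Proof. exact: closed_zeros. Qed.

Lemma closed_point n (p : 'I_n -> CP1 R) : zariski_closed [set p].
Proof.
have -> : [set p] = \bigcap_(j in [set: 'I_n]) [set q : 'I_n -> CP1 R | q j = p j].
  apply/seteqP; split=> q; first by move=> -> j.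
  by move=> /= H; apply: functional_extensionality_dep => j; exact: H.
exists [set df | exists j, admissible df.1 df.2 /\
  [set q : 'I_n -> CP1 R | q j = p j] `<=` [set q | hval df.1 df.2 q = 0]].
split; first by move=> d f [j []].
apply/seteqP; split=> q /=; first by move=> Hq d f [j [_]]; apply; exact: Hq.
move=> H j _ /=; apply: contrapT => nq.
have [d [f [df Hf /eqP fq]]] := closed_sep (closed_coord j (p j)) nq.
by apply: fq; apply: H; exists j.
Qed.

Lemma closed_finite n (S : set ('I_n -> CP1 R)) : finite_set S -> zariski_closed S.
Proof.
move=> /finite_seqP [s ->]; elim: s => [|p s IHs].
  have -> : [set` ([::] : seq ('I_n -> CP1 R))] = set0 by apply/seteqP; split.
  exact: closed0.
have -> : [set` p :: s] = [set p] `|` [set` s].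
  apply/seteqP; split=> q /=; rewrite inE; first by move=> /orP [/eqP|]; [left|right].
  by move=> [->|->]; rewrite ?eqxx ?orbT.
by apply: closedU => //; exact: closed_point.
Qed.

Lemma irreducible_finite n (W : set ('I_n -> CP1 R)) :
  irreducible_closed W -> finite_set W -> exists p, W = [set p].
Proof.
move=> [cW [p Wp] irrW] fW; exists p.
have fW' : finite_set (W `&` [set q | q <> p]) by apply: sub_finite_set fW => q [].
have [|H|H] := irrW [set p] (W `&` [set q | q <> p]) (closed_point p) (closed_finite fW').
- by move=> q Wq; have [->|qp] := pselect (q = p); [left|right].
- by apply/seteqP; split=> // q ->.
by have [] := H p Wp.
Qed.

(** A finite component is a point p. Choose f nonzero at p so that any zero where f is nonzero
    shares an irreducible piece with p; moving p along the coupling gives such a zero, and the piece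
    contradicts maximality. *)
Lemma component_infinite W : irreducible_component Z W -> infinite_set W.
Proof.
move=> [irrW WZ maxW] finW; have [p WE] := irreducible_finite irrW finW.
have Zp : Z p by apply: WZ; rewrite WE.
have [d [f [df fp Hf]]] := fin_irr_sep p (closed_fin_irr closedZ).
have [q [Zq qp fq]] := lift_point Zp df fp.
have [V [irrV VZ Vq Vp]] := Hf q Zq fq.
have VW : V = W by apply: maxW => //; rewrite WE => _ ->.
by apply: qp; move: Vq; rewrite VW WE.
Qed.

Lemma component_affine W (S : set pt) : W `<=` Z -> infinite_set (W `&` S) ->
  infinite_set (W `&` S `&` [set p | exists z : 'I_5 -> C, p = fun j => Some (z j)]).
Proof.
move=> WZ iWS fin; apply: iWS.
apply: (sub_finite_set _ (_ : finite_set ((W `&` S `&`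
   [set p | exists z : 'I_5 -> C, p = fun j => Some (z j)]) `|`
   (Z `&` [set p | exists j, p j = None])))).
  move=> p [Wp Sp]; have [[z E]|H] := affine_pointP p; [left|right].
    by split=> //; exists z.
  by split=> //; exact: WZ.
by rewrite finite_setU; split=> //; exact: infinite_at_infty.
Qed.

Lemma component_generic W : irreducible_component Z W ->
  exists (L : fieldType) (phi : {rmorphism {mpoly C[5]} -> L}), is_function_field W phi.
Proof.
move=> cW; have [irrW WZ _] := cW; apply: function_field_ex => //.
have := @component_affine W setT WZ; rewrite !setIT => /(_ (component_infinite cW)) iW.
apply: contrapT => H; apply: iW; apply: (sub_finite_set _ (finite_set0 _)) => p [Wp [z E]].
by apply: H; exists z; rewrite -E.
Qed.

Section Component.
Variables (W : set pt) (L : fieldType) (phi : {rmorphism {mpoly C[5]} -> L}).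
Hypotheses (iW : infinite_set W) (WZ : W `<=` Z) (ff : is_function_field W phi).

Definition iotaf : {rmorphism C -> L} := phi \o @mpolyC 5 C.

Lemma infinite_coord_zero (S : set pt) j (P : {poly C}) : S `<=` Z -> infinite_set S ->
  (forall z : 'I_5 -> C, S (fun i => Some (z i)) -> root P (z j)) -> P = 0.
Proof.
move=> SZ iS HP; apply/eqP; apply: contrapT => /negP P0.
have := @component_affine S setT SZ; rewrite !setIT => /(_ iS); apply.
apply: (finite_by (f := fun p : pt => p j)).
  apply: (sub_finite_set _ (finite_image Some (finite_roots P0))) => _ [p [Sp [z E]] <-].
  by exists (z j); [apply: HP; rewrite -E|rewrite E].
move=> u; apply: sub_finite_set (fibre j u) => p [[Sp _] pu].
by split=> //; exact: SZ.
Qed.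

Definition upoly j (P : {poly C}) : {mpoly C[5]} := (map_poly (@mpolyC 5 C) P).['X_j].

Lemma upoly_eval j P (z : 'I_5 -> C) : (upoly j P).@[z] = P.[z j].
Proof.
pose psi : {rmorphism {poly C} -> C} := meval z \o (horner_eval 'X_j \o map_poly (@mpolyC 5 C)).
apply: (poly_rmorph_ext (phi := psi) (psi := horner_eval (z j))) => [c|]; rewrite /psi /= !horner_evalE.
  by rewrite map_polyC !hornerC /= mevalC.
by rewrite map_polyX !hornerX mevalXU.
Qed.

Lemma upoly_phi j P : phi (upoly j P) = evp iotaf (phi 'X_j) P.
Proof.
pose psi : {rmorphism {poly C} -> L} := phi \o (horner_eval 'X_j \o map_poly (@mpolyC 5 C)).
apply: (poly_rmorph_ext (phi := psi) (psi := evp iotaf (phi 'X_j))) => [c|]; rewrite /psi /= horner_evalE.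
  by rewrite map_polyC hornerC evpC.
by rewrite map_polyX hornerX evpX.
Qed.

(** An algebraic equation would leave finitely many values of the coordinate, and over each of them
    [Z] has finitely many points. *)
Lemma component_transc j : transc iotaf (phi 'X_j).
Proof.
move=> P; apply: contra_neq; rewrite -upoly_phi => /(proj1 ff) H.
apply: (@infinite_coord_zero W j) => // z Wz.
by apply/rootP; rewrite -upoly_eval; exact: H.
Qed.

Lemma component_zero (f : {mpoly C[5]}) : f \in cgens -> phi f = 0.
Proof.
move=> fg; apply/(proj1 ff) => z /WZ /(_ f fg).
by rewrite /vanishes hval_affine.
Qed.

End Component.

End CouplingSet.

Section BipolyEval.
Variable R : realType.
Local Notation C := R[i].

Lemma mmap_bipoly n (a b : 'I_n) (ab : a != b) (A : comNzRingType)
    (iota : {rmorphism C -> A}) (v : 'I_n -> A) D G :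
  mmap iota v (bipoly a b D G) =
  \sum_(k < D.+1) \sum_(l < D.+1) iota (G k l) * (v a ^+ k * v b ^+ l).
Proof.
rewrite raddf_sum; apply: eq_bigr => k _; rewrite raddf_sum; apply: eq_bigr => l _ /=.
rewrite mmapZ mmapX; congr (_ * _).
rewrite /mmap1 (bigD1 a) //= (bigD1 b) 1?eq_sym //= big1 => [|j /andP [ja jb]].
  by rewrite bimna // bimnb // mulr1.
by rewrite bimn_other.
Qed.

Lemma rmorph_mmap n (A : comNzRingType) (phi : {rmorphism {mpoly C[n]} -> A}) f :
  phi f = mmap (phi \o @mpolyC n C) (fun i => phi 'X_i) f.
Proof.
apply: (mpoly_rmorph_ext (psi := mmap (phi \o @mpolyC n C) (fun i => phi 'X_i))) => [c|i] /=.
  by rewrite mmapC.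
by rewrite mmapX mmap1U.
Qed.

Lemma phi_bipoly n (a b : 'I_n) (ab : a != b) (A : comNzRingType)
    (phi : {rmorphism {mpoly C[n]} -> A}) D G :
  phi (bipoly a b D G) =
  mmap (phi \o @mpolyC n C) (opair (phi 'X_a) (phi 'X_b)) (bipoly (0 : 'I_2) 1 D G).
Proof. by rewrite rmorph_mmap !mmap_bipoly. Qed.

Lemma phi_subst n (a b : 'I_n) (A : comNzRingType)
    (phi : {rmorphism {mpoly C[n]} -> A}) f :
  phi (msubst2 f 'X_a 'X_b) = mmap (phi \o @mpolyC n C) (opair (phi 'X_a) (phi 'X_b)) f.
Proof.
pose psi : {rmorphism {mpoly C[2]} -> A} :=
  phi \o mmap (@mpolyC n C) (opair 'X_a 'X_b).
apply: (mpoly_rmorph_ext (phi := psi)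
   (psi := mmap (phi \o @mpolyC n C) (opair (phi 'X_a) (phi 'X_b)))) => [c|i]; rewrite /psi /=.
  by rewrite !mmapC.
by rewrite !mmapX !mmap1U /opair; case: ifP.
Qed.

Lemma mmap_bipoly_bform G (x y : C) D :
  mmap idfun (opair x y) (bipoly (0 : 'I_2) 1 D G) = bform D G (x, 1) (y, 1).
Proof.
rewrite mmap_bipoly //; apply: eq_bigr => k _; rewrite /bco mulr_suml.
by apply: eq_bigr => l _ /=; rewrite !expr1n !mulr1 mulrA mulrAC.
Qed.

Lemma bform_all0 D G h : (forall x : C, bform D G (x, 1) h = 0) ->
  forall k, (k <= D)%N -> bco D G k h = 0.
Proof.
move=> H k kD; pose P := \poly_(k < D.+1) bco D G k h.
have Pk : P`_k = bco D G k h by rewrite coef_poly ltnS kD.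
suff P0 : P = 0 by rewrite -Pk P0 coef0.
apply/eqP; apply: contrapT => /negP /finite_roots fr; apply: (@infinite_nat).
apply: (finite_by (f := fun k : nat => k%:R : C)).
  by apply: sub_finite_set fr => _ [i _ <-] /=; apply/rootP; rewrite -bform_affine.
move=> u; have [[i iu]|H'] := pselect (exists i : nat, i%:R = u); last first.
  by apply: (sub_finite_set _ (finite_set0 _)) => i [_ /= iu]; apply: H'; exists i.
apply: (sub_finite_set _ (finite_set1 i)) => i' [_ /=]; rewrite -iu => /eqP.
by rewrite eqr_nat => /eqP.
Qed.

(** A root of a nonconstant univariate factor would be the position of a line on which the form
    vanishes identically. *)
Lemma nonvertical_biquadratic G : nonvertical 2 G -> biquadratic (R := R) (bipoly (0 : 'I_2) 1 2 G).
Proof.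
move=> nv; split; first exact: bipoly_neq0.
  by move=> j; rewrite vardeg_bipoly //; case: j => [[|[|//]] ?].
move=> j w h E; rewrite leqNgt; apply/negP => /closed_root_size [c /rootP wc].
have ev x : mmap idfun (fun i => if i == j then x else c) (bipoly (0 : 'I_2) 1 2 G) = 0.
  rewrite E rmorphM /= (eval_univ idfun) rev_ord2 map_poly_id // wc mul0r //.
have [nv1 nv2] := nv; case: j {E} ev => [[|[|//]] j2] ev.
  have [k k2] := nv1 (Some c); rewrite bform_all0 ?eqxx //= => x.
  rewrite -mmap_bipoly_bform; suff -> : opair x c = fun i => if i == Ordinal j2 then x else c by [].
  by apply: functional_extensionality_dep => i; rewrite /opair; case: i => [[|[|//]] ?].
have [k k2] := nv2 (Some c); rewrite bform_all0 ?eqxx //= => x.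
rewrite bform_tr -mmap_bipoly_bform.
suff -> : opair c x = fun i => if i == Ordinal j2 then x else c by [].
by apply: functional_extensionality_dep => i; rewrite /opair; case: i => [[|[|//]] ?].
Qed.

End BipolyEval.

(** * Relations of bidegree (1, 1) *)

Section Mobius.
Variables (R : realType) (L : fieldType).
Local Notation C := R[i].
Variables (iota : {rmorphism C -> L}) (H : nat -> nat -> C).
Hypothesis nH : nonvertical 1 H.

Definition mob_num : {poly C} := - ((H 0 0)%:P + (H 0 1)%:P * 'X).
Definition mob_den : {poly C} := (H 1 0)%:P + (H 1 1)%:P * 'X.

Lemma mob_den_neq0 : mob_den != 0.
Proof.
have [_ /(_ None) [k k1]] := nH; rewrite bco_infty.
apply: contraNneq => /(congr1 (fun p : {poly C} => p`_k)).
rewrite coefD coefC coefCM coefX coef0 /gtr.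
by case: k k1 => [|[|//]] _ /=; rewrite ?mulr0 ?addr0 ?add0r ?mulr1 => ->.
Qed.

Lemma mobius_value (x y : L) : transc iota x ->
  mmap iota (opair y x) (bipoly (0 : 'I_2) 1 1 H) = 0 ->
  evp iota x mob_den != 0 /\ y = evp iota x mob_num / evp iota x mob_den.
Proof.
move=> tx E; have nz := tx _ mob_den_neq0; split=> //.
apply: (mulIf nz); rewrite divfK //; move: E; rewrite mmap_bipoly //.
rewrite !big_ord_recl !big_ord0 /= /bump /opair /= => E.
have -> : evp iota x mob_num = - (iota (H 0 0) + iota (H 0 1) * x).
  by rewrite /mob_num rmorphN rmorphD rmorphM /= !evpC evpX.
have -> : evp iota x mob_den = iota (H 1 0) + iota (H 1 1) * x.
  by rewrite /mob_den rmorphD rmorphM /= !evpC evpX.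
by apply: (eq_lin (k := 1) E); ring.
Qed.

End Mobius.

Lemma mobius_ratf (R : realType) (L : fieldType) (iota : {rmorphism R[i] -> L})
    (H : nat -> nat -> R[i]) (x y : L) : nonvertical 1 H -> transc iota x ->
  mmap iota (opair y x) (bipoly (0 : 'I_2) 1 1 H) = 0 -> ratf iota x y.
Proof.
move=> nH tx /(mobius_value nH tx) [_ ->].
by apply: (sf_div (ratf_subfield _ _)); exact: ratf_evp.
Qed.

Lemma mobius_ratf' (R : realType) (L : fieldType) (iota : {rmorphism R[i] -> L})
    (H : nat -> nat -> R[i]) (x y : L) : nonvertical 1 H -> transc iota y ->
  mmap iota (opair y x) (bipoly (0 : 'I_2) 1 1 H) = 0 -> ratf iota y x.
Proof.
move=> nH ty E; apply: (mobius_ratf (nonvertical_tr nH) ty).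
rewrite -[RHS]E !mmap_bipoly // exchange_big; apply: eq_bigr => k _; apply: eq_bigr => l _.
by rewrite /gtr /opair /= [X in _ * X]mulrC.
Qed.

(** * Classification of couplings *)

Section Classify.
Variable R : realType.
Local Notation C := R[i].
Local Notation pt := ('I_5 -> CP1 R).
Variables G1 G2 H1 H2 : nat -> nat -> C.
Hypotheses (nG1 : nonvertical 2 G1) (nG2 : nonvertical 2 G2)
  (nH1 : nonvertical 1 H1) (nH2 : nonvertical 1 H2).

Notation o0 := (@Ordinal 5 0 isT).
Notation o1 := (@Ordinal 5 1 isT).
Notation o2 := (@Ordinal 5 2 isT).
Notation o3 := (@Ordinal 5 3 isT).
Notation o4 := (@Ordinal 5 4 isT).

Let Z := zeros (cgens G1 G2 H1 H2).
Let comp W := irreducible_component Z W.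
Let g1 : {mpoly C[2]} := bipoly (0 : 'I_2) 1 2 G1.
Let g2 : {mpoly C[2]} := bipoly (0 : 'I_2) 1 2 G2.

Section OneComponent.
Variables (W : set pt) (L : fieldType) (phi : {rmorphism {mpoly C[5]} -> L}).
Hypotheses (cW : comp W) (ff : is_function_field W phi).

Local Notation iota := (iotaf phi).
Local Notation x := (phi 'X_o0).
Local Notation y := (phi 'X_o1).
Local Notation z := (phi 'X_o2).
Local Notation e := (phi 'X_o4).

Let iW : infinite_set W := component_infinite nG1 nG2 nH1 nH2 cW.
Let WZ : W `<=` Z. Proof. by case: cW. Qed.

Lemma comp_transc j : transc iota (phi 'X_j).
Proof. exact: (component_transc nG1 nG2 nH1 nH2 iW WZ ff). Qed.

Let zero f : f \in cgens G1 G2 H1 H2 -> phi f = 0.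
Proof. exact: (component_zero WZ ff). Qed.

Lemma comp_rel1 : mmap iota (opair x y) g1 = 0.
Proof. by rewrite -(phi_bipoly (a := o0) (b := o1)) // zero // !inE eqxx. Qed.
Lemma comp_rel2 : mmap iota (opair y z) g2 = 0.
Proof. by rewrite -(phi_bipoly (a := o1) (b := o2)) // zero // !inE eqxx orbT. Qed.
Lemma comp_rel3 : mmap iota (opair (phi 'X_o3) y) (bipoly (0 : 'I_2) 1 1 H1) = 0.
Proof. by rewrite -(phi_bipoly (a := o3) (b := o1)) // zero // !inE eqxx !orbT. Qed.
Lemma comp_rel4 : mmap iota (opair e z) (bipoly (0 : 'I_2) 1 1 H2) = 0.
Proof. by rewrite -(phi_bipoly (a := o4) (b := o2)) // zero // !inE eqxx !orbT. Qed.

Lemma comp_linked1 : linked iota x y.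
Proof.
exact: (biquadratic_linked (nonvertical_biquadratic nG1) (comp_transc _) (comp_transc _) comp_rel1).
Qed.
Lemma comp_linked2 : linked iota y z.
Proof.
exact: (biquadratic_linked (nonvertical_biquadratic nG2) (comp_transc _) (comp_transc _) comp_rel2).
Qed.
Lemma comp_ze : ratf iota z e.
Proof. exact: (mobius_ratf nH2 (comp_transc _) comp_rel4). Qed.
Lemma comp_ez : ratf iota e z.
Proof. exact: (mobius_ratf' nH2 (comp_transc _) comp_rel4). Qed.
(* O turns out to be all of L. Hence every nonzero polynomial function on W divides a
   polynomial in x_2 alone, which has finitely many zeros on W. *)
Let O : set L := [set u | exists (k : {poly C}) V, k != 0 /\ evp iota y k * u = phi V].

Let O_phi V : O (phi V).
Proof. by exists 1, V; rewrite oner_eq0 evp1 mul1r. Qed.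

Let OD u v : O u -> O v -> O (u + v).
Proof.
move=> [k [V [k0 E]]] [k' [V' [k0' E']]].
exists (k * k'), (upoly o1 k' * V + upoly o1 k * V'); split; first by rewrite mulf_neq0.
by rewrite rmorphD !rmorphM /= !upoly_phi -E -E' ?evpM; ring.
Qed.

Let OM u v : O u -> O v -> O (u * v).
Proof.
move=> [k [V [k0 E]]] [k' [V' [k0' E']]].
exists (k * k'), (V * V'); split; first by rewrite mulf_neq0.
by rewrite rmorphM /= -E -E' ?evpM; ring.
Qed.

Let O_ratf : ratf iota y `<=` O.
Proof.
move=> u /ratfP [p [q [q0 ->]]]; exists q, (upoly o1 p); split.
  by apply: contraNneq q0 => ->; rewrite evp0.
by rewrite upoly_phi mulrC divfK.
Qed.

Let O_adjoin (K : set L) w : is_subfield K -> K `<=` O -> O w -> quadratic_over K w ->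
  adjoin K [set w] `<=` O.
Proof.
move=> sK KO Ow qw; have [Kw|nKw] := pselect (K w).
  by rewrite adjoin_id // => _ ->.
by rewrite adjoin_qext // => _ [a [b [/KO Ka /KO Kb ->]]]; apply: OD => //; exact: OM.
Qed.

(** L is obtained from C(y) by adjoining x and then z, each of degree at most 2, and elements a + b
    w of such an extension stay in [O]. *)
Let O_all u : O u.
Proof.
pose K := adjoin (ratf iota y) [set x].
pose E := adjoin K [set z].
have sK : is_subfield K by exact: adjoin_subfield.
have sE : is_subfield E by exact: adjoin_subfield.
have [_ qx _] := comp_linked1; have [qz _ _] := comp_linked2.
have KO : K `<=` O by exact: (O_adjoin (ratf_subfield _ _) O_ratf (O_phi _) qx).
have EO : E `<=` O.
  by apply: O_adjoin => //; apply: quadratic_sub qz; exact: adjoin_base.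
apply: EO; have [f [g [_ ->]]] := proj2 ff u.
have KE : K `<=` E by exact: adjoin_base.
have yE : ratf iota y `<=` E by move=> t ty; apply: KE; exact: adjoin_base.
have zE : ratf iota z `<=` E.
  apply: adjoin_min => //; last by move=> _ ->; exact: adjoin_gen1.
  by move=> _ [c _ <-]; apply: yE; exact: ratf_const.
have phiE h : E (phi h).
  rewrite rmorph_mmap /mmap; apply: (sf_sum sE) => m; apply: (sfM sE).
    by apply: yE; exact: (@ratf_const _ _ iota y (h@_m)).
  rewrite /mmap1; apply: (sf_prod sE) => j; apply: (sfX sE).
  case: (ord5P j) => [[]|[]] ->.
  - by apply: KE; exact: adjoin_gen1.
  - by apply: yE; exact: ratf_gen.
  - exact: adjoin_gen1.
  - by apply: yE; exact: (mobius_ratf nH1 (comp_transc _) comp_rel3).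
  - by apply: zE; exact: comp_ze.
exact: (sf_div sE).
Qed.

(** If [phi f] had an inverse, some multiple of f would equal on W a nonzero polynomial in x_2, and
    infinitely many zeros of f on W would be zeros of that polynomial. *)
Lemma infinite_zero (f : {mpoly C[5]}) :
  infinite_set (W `&` [set p | exists2 t : 'I_5 -> C, p = (fun j => Some (t j)) & f.@[t] = 0]) ->
  phi f = 0.
Proof.
move=> iS; apply/eqP; apply: contrapT => /negP f0.
have [k [V [k0 E]]] := O_all (phi f)^-1.
suff : k = 0 by move/eqP: k0.
apply: (@infinite_coord_zero _ _ _ _ _ nG1 nG2 nH1 nH2 _ o1 k _ iS).
  by move=> p [Wp _]; exact: WZ.
move=> t [Wt [t' E' ft]]; have tt' : t = t'.
  by apply: functional_extensionality_dep => j; have := congr1 (fun g => g j) E' => -[].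
have : phi (f * V - upoly o1 k) = 0.
  by rewrite rmorphB rmorphM /= -E upoly_phi mulrC -mulrA mulVf // mulr1 subrr.
move=> /(proj1 ff) /(_ t Wt); rewrite mevalB mevalM {1}tt' ft mul0r sub0r => /eqP.
by rewrite oppr_eq0 upoly_eval => /eqP kt; apply/rootP.
Qed.

Definition outer_zero (f : {mpoly C[2]}) (V : set pt) : Prop :=
  forall t : 'I_5 -> C, V (fun j => Some (t j)) -> mmap idfun (opair (t o0) (t o2)) f = 0.

Lemma meval_subst (f : {mpoly C[2]}) (t : 'I_5 -> C) :
  (msubst2 f 'X_o0 'X_o2).@[t] = mmap idfun (opair (t o0) (t o2)) f.
Proof.
pose psi : {rmorphism {mpoly C[2]} -> C} :=
  meval t \o mmap (@mpolyC 5 C) (opair 'X_o0 'X_o2).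
apply: (mpoly_rmorph_ext (phi := psi) (psi := mmap idfun (opair (t o0) (t o2)))) => [c|i];
    rewrite /psi /=.
  by rewrite !mmapC mevalC.
by rewrite !mmapX !mmap1U /opair; case: ifP => _; rewrite mevalXU.
Qed.

Lemma outer_zeroP f : outer_zero f W <-> mmap iota (opair x z) f = 0.
Proof.
rewrite -(phi_subst o0 o2); split=> [H|/(proj1 ff) H t Wt].
  by apply/(proj1 ff) => t Wt; rewrite meval_subst; exact: H.
by rewrite -meval_subst; exact: H.
Qed.

Lemma outer_linear f : irreducible_mpoly f -> outer_zero f W ->
  outer_rational iota x z -> linear_factor f.
Proof.
move=> irrf /outer_zeroP fz.
exact: (outer_rational_factor (comp_transc o0) (comp_transc o2) irrf fz).
Qed.

Lemma outer_quadr f : irreducible_mpoly f -> outer_zero f W ->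
  outer_quadratic iota x z -> quadratic_factor f.
Proof.
move=> irrf /outer_zeroP fz.
exact: (outer_quadratic_factor (comp_transc o0) (comp_transc o2) irrf fz).
Qed.

Lemma outer_quart f : irreducible_mpoly f -> outer_zero f W ->
  outer_quartic iota x z -> ~ linear_factor f /\ ~ quadratic_factor f.
Proof.
move=> irrf /outer_zeroP fz.
exact: (outer_quartic_factor (comp_transc o0) (comp_transc o2) irrf fz).
Qed.

Let l1 := comp_linked1.
Let l2 := comp_linked2.

Lemma comp_case1 : ratf iota x y -> ratf iota y z -> case1 W.
Proof.
move=> xy yz; exists L, phi; split=> //.
exact: (degrees1 comp_ze xy yz).
Qed.

Lemma comp_case2 : ratf iota x y -> ~ ratf iota y z -> case2 W.
Proof.
move=> xy yz; exists L, phi; split=> //; left.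
exact: (degrees2 l1 l2 comp_ze comp_ez xy yz).
Qed.

Lemma comp_case2' : ~ ratf iota x y -> ratf iota y z -> case2 W.
Proof.
move=> xy yz; exists L, phi; split=> //; right.
exact: (degrees2' l1 l2 xy yz).
Qed.

Hypotheses (nxy : ~ ratf iota x y) (nyz : ~ ratf iota y z).

Lemma comp_case3 : ratf iota x z -> case3 W.
Proof.
move=> xz; exists L, phi; split=> //.
exact: (degrees3 l1 comp_ze nxy xz).
Qed.

Lemma comp_case4 : adjoin (ratf iota y) [set x] z -> ~ ratf iota x z -> case4 W.
Proof.
move=> H xz; exists L, phi; split=> //.
exact: (degrees4 l1 l2 comp_ze comp_ez nxy nyz H xz).
Qed.

Lemma comp_case5 : ~ adjoin (ratf iota y) [set x] z -> ~ adjoin (ratf iota x) [set z] y -> case5 W.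
Proof.
move=> H H'; exists L, phi; split=> //.
exact: (degrees5 l1 l2 comp_ze comp_ez nxy nyz H H').
Qed.

Lemma comp_case6 : ~ adjoin (ratf iota y) [set x] z -> adjoin (ratf iota x) [set z] y -> case6 W.
Proof.
move=> H H'; exists L, phi; split=> //.
exact: (degrees6 l1 l2 comp_ze comp_ez nxy H H').
Qed.

End OneComponent.
End Classify.

(** * Comparison of components, and components on which a factor vanishes *)

Section Coupling.
Variable R : realType.
Local Notation C := R[i].
Local Notation pt := ('I_5 -> CP1 R).
Variables G1 G2 H1 H2 : nat -> nat -> C.
Hypotheses (nG1 : nonvertical 2 G1) (nG2 : nonvertical 2 G2)
  (nH1 : nonvertical 1 H1) (nH2 : nonvertical 1 H2).

Notation o0 := (@Ordinal 5 0 isT).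
Notation o1 := (@Ordinal 5 1 isT).
Notation o2 := (@Ordinal 5 2 isT).
Notation o3 := (@Ordinal 5 3 isT).
Notation o4 := (@Ordinal 5 4 isT).

Let Z := zeros (cgens G1 G2 H1 H2).
Let comp W := irreducible_component Z W.
Let g1 : {mpoly C[2]} := bipoly (0 : 'I_2) 1 2 G1.
Let g2 : {mpoly C[2]} := bipoly (0 : 'I_2) 1 2 G2.
Let bg1 := nonvertical_biquadratic nG1.
Let bg2 := nonvertical_biquadratic nG2.

Local Notation ff W := (fun (L : fieldType) (phi : {rmorphism {mpoly C[5]} -> L}) =>
  is_function_field W phi).

Section TwoComponents.
Variables (W W' : set pt) (L L' : fieldType).
Variables (phi : {rmorphism {mpoly C[5]} -> L}) (phi' : {rmorphism {mpoly C[5]} -> L'}).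
Hypotheses (cW : comp W) (cW' : comp W').
Hypotheses (ffW : is_function_field W phi) (ffW' : is_function_field W' phi').

Local Notation iota := (iotaf phi).
Local Notation iota' := (iotaf phi').
Local Notation x := (phi 'X_o0).
Local Notation y := (phi 'X_o1).
Local Notation z := (phi 'X_o2).
Local Notation x' := (phi' 'X_o0).
Local Notation y' := (phi' 'X_o1).
Local Notation z' := (phi' 'X_o2).

Let t j : transc iota (phi 'X_j) := comp_transc nG1 nG2 nH1 nH2 cW ffW j.
Let t' j : transc iota' (phi' 'X_j) := comp_transc nG1 nG2 nH1 nH2 cW' ffW' j.
Let r1 := comp_rel1 cW ffW.
Let r1' := comp_rel1 cW' ffW'.
Let r2 := comp_rel2 cW ffW.
Let r2' := comp_rel2 cW' ffW'.

Lemma uniform12 : ratf iota x y -> ratf iota' x' y'.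
Proof. exact: (linear_uniform bg1 (t o0) (t o1) (t' o0) (t' o1) r1 r1'). Qed.

Lemma uniform23 : ratf iota y z -> ratf iota' y' z'.
Proof. exact: (linear_uniform bg2 (t o1) (t o2) (t' o1) (t' o2) r2 r2'). Qed.

Hypotheses (nyx : ~ ratf iota y x) (nyx' : ~ ratf iota' y' x').

Lemma uniform_ext : adjoin (ratf iota y) [set x] z -> adjoin (ratf iota' y') [set x'] z'.
Proof. exact: (same_ext_uniform bg1 bg2 (t o1) (t' o1) r1 r1' r2 r2' nyx nyx'). Qed.

(** The same [phi] is a function field of both components, so that cases 5 and 6 cannot occur on
    different components. *)
Lemma uniform_ff : ~ adjoin (ratf iota y) [set x] z -> ~ adjoin (ratf iota' y') [set x'] z' ->
  is_function_field W' phi.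
Proof.
move=> nz nz'; split; last exact: (proj2 ffW).
move=> F; rewrite -(proj1 ffW'); apply: (kernel_uniform bg1 bg2 (t o1) (t' o1) r1 r1' r2 r2'
  nyx nyx' nz nz') => // j.
have dX (a : L) : evp iota a 1 != 0 by rewrite evp1 oner_eq0.
case: (ord5P j) => [[]|[]] ->.
- exists x, x', 'X, 1; split; rewrite ?evpX ?evp1 ?divr1 ?oner_eq0 //; by constructor 1.
- exists y, y', 'X, 1; split; rewrite ?evpX ?evp1 ?divr1 ?oner_eq0 //; by constructor 2.
- exists z, z', 'X, 1; split; rewrite ?evpX ?evp1 ?divr1 ?oner_eq0 //; by constructor 3.
- have [d E] := mobius_value nH1 (t o1) (comp_rel3 cW ffW).
  have [d' E'] := mobius_value nH1 (t' o1) (comp_rel3 cW' ffW').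
  by exists y, y', (mob_num H1), (mob_den H1); split=> //; constructor 2.
- have [d E] := mobius_value nH2 (t o2) (comp_rel4 cW ffW).
  have [d' E'] := mobius_value nH2 (t' o2) (comp_rel4 cW' ffW').
  by exists z, z', (mob_num H2), (mob_den H2); split=> //; constructor 3.
Qed.

End TwoComponents.

Definition all_outer (P : {mpoly C[2]} -> set pt -> Prop) : Prop :=
  forall f W, irreducible_mpoly f -> comp W -> outer_zero f W -> P f W.

Lemma coupling_classification :
  [\/ (forall W, comp W -> case1 W) /\ all_outer (fun f _ => linear_factor f),
      (forall W, comp W -> case2 W) /\ all_outer (fun f _ => quadratic_factor f),
      (forall W, comp W -> case3 W \/ case4 W) /\
        all_outer (fun f W => linear_factor f /\ case3 W \/ quadratic_factor f /\ case4 W) |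
      (forall W, comp W -> case5 W) /\ all_outer (fun f _ => quadratic_factor f) \/
      (forall W, comp W -> case6 W) /\
        all_outer (fun f _ => ~ linear_factor f /\ ~ quadratic_factor f)].
Proof.
(* [W0] is the component with which all the others are compared; if there were none, the first
   alternative would hold vacuously. *)
have [[W0 c0]|H] := pselect (exists W, comp W); last first.
  by constructor 1; split=> [W cW|f W _ cW _]; case: H; exists W.
have gen W (cW : comp W) := component_generic nG1 nG2 nH1 nH2 cW.
have [L0 [phi0 ff0]] := gen W0 c0.
have lk1 W L phi (cW : comp W) (fW : ff W L phi) := comp_linked1 nG1 nG2 nH1 nH2 cW fW.
have lk2 W L phi (cW : comp W) (fW : ff W L phi) := comp_linked2 nG1 nG2 nH1 nH2 cW fW.
have [_ _ Exy0] := lk1 _ _ _ c0 ff0.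
have [xy0|nxy0] := pselect (ratf (iotaf phi0) (phi0 'X_o0) (phi0 'X_o1));
  have [yz0|nyz0] := pselect (ratf (iotaf phi0) (phi0 'X_o1) (phi0 'X_o2)).
- constructor 1; split=> [W cW|f W irrf cW fW]; have [L [phi ffW]] := gen W cW;
    have xy := uniform12 c0 cW ff0 ffW xy0; have yz := uniform23 c0 cW ff0 ffW yz0.
    exact: (comp_case1 nG1 nG2 nH1 nH2 cW ffW xy yz).
  exact: (outer_linear nG1 nG2 nH1 nH2 cW ffW irrf fW
            (outer_A (lk1 _ _ _ cW ffW) (lk2 _ _ _ cW ffW) xy yz)).
- constructor 2; split=> [W cW|f W irrf cW fW]; have [L [phi ffW]] := gen W cW;
    have xy := uniform12 c0 cW ff0 ffW xy0;
    have nyz := contra_not (uniform23 cW c0 ffW ff0) nyz0.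
    exact: (comp_case2 nG1 nG2 nH1 nH2 cW ffW xy nyz).
  exact: (outer_quadr nG1 nG2 nH1 nH2 cW ffW irrf fW
            (outer_B1 (lk1 _ _ _ cW ffW) (lk2 _ _ _ cW ffW) xy nyz)).
- constructor 2; split=> [W cW|f W irrf cW fW]; have [L [phi ffW]] := gen W cW;
    have nxy := contra_not (uniform12 cW c0 ffW ff0) nxy0;
    have yz := uniform23 c0 cW ff0 ffW yz0.
    exact: (comp_case2' nG1 nG2 nH1 nH2 cW ffW nxy yz).
  exact: (outer_quadr nG1 nG2 nH1 nH2 cW ffW irrf fW
            (outer_B2 (lk1 _ _ _ cW ffW) (lk2 _ _ _ cW ffW) nxy yz)).
have nxy W L phi (cW : comp W) (fW : ff W L phi) := contra_not (uniform12 cW c0 fW ff0) nxy0.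
have nyz W L phi (cW : comp W) (fW : ff W L phi) := contra_not (uniform23 cW c0 fW ff0) nyz0.
have nyx W L phi (cW : comp W) (fW : ff W L phi) :
    ~ ratf (iotaf phi) (phi 'X_o1) (phi 'X_o0).
  by have [_ _ E] := lk1 _ _ _ cW fW; move=> /E; exact: (nxy _ _ _ cW fW).
have [xz0|nxz0] := pselect (adjoin (ratf (iotaf phi0) (phi0 'X_o1)) [set phi0 'X_o0] (phi0 'X_o2)).
  constructor 3; split=> [W cW|f W irrf cW fW]; have [L [phi ffW]] := gen W cW;
    have xz := uniform_ext c0 cW ff0 ffW (nyx _ _ _ c0 ff0) (nyx _ _ _ cW ffW) xz0;
    have n1 := nxy _ _ _ cW ffW; have n2 := nyz _ _ _ cW ffW;
    have [H|H] := pselect (ratf (iotaf phi) (phi 'X_o0) (phi 'X_o2)).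
  - by left; exact: (comp_case3 nG1 nG2 nH1 nH2 cW ffW n1 H).
  - by right; exact: (comp_case4 nG1 nG2 nH1 nH2 cW ffW n1 n2 xz H).
  - left; split; last exact: (comp_case3 nG1 nG2 nH1 nH2 cW ffW n1 H).
    exact: (outer_linear nG1 nG2 nH1 nH2 cW ffW irrf fW
            (outer_C2_rat (lk1 _ _ _ cW ffW) (lk2 _ _ _ cW ffW) n1 n2 xz H)).
  - right; split; last exact: (comp_case4 nG1 nG2 nH1 nH2 cW ffW n1 n2 xz H).
    exact: (outer_quadr nG1 nG2 nH1 nH2 cW ffW irrf fW
            (outer_C2_quad (lk1 _ _ _ cW ffW) (lk2 _ _ _ cW ffW) n1 n2 xz H)).
have nxz W L phi (cW : comp W) (fW : ff W L phi) :=
  contra_not (uniform_ext cW c0 fW ff0 (nyx _ _ _ cW fW) (nyx _ _ _ c0 ff0)) nxz0.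
(* From here on all components share [phi0], and the choice between cases 5 and 6 is made once. *)
have ff0W W (cW : comp W) : is_function_field W phi0.
  have [L [phi ffW]] := gen W cW.
  exact: (uniform_ff c0 cW ff0 ffW (nyx _ _ _ c0 ff0) (nyx _ _ _ cW ffW) nxz0 (nxz _ _ _ cW ffW)).
have [H|H] := pselect (adjoin (ratf (iotaf phi0) (phi0 'X_o0)) [set phi0 'X_o2] (phi0 'X_o1)).
  constructor 4; right; split=> [W cW|f W irrf cW fW]; have ffW := ff0W W cW.
    exact: (comp_case6 nG1 nG2 nH1 nH2 cW ffW nxy0 nxz0 H).
  exact: (outer_quart nG1 nG2 nH1 nH2 cW ffW irrf fW
            (outer_C1_quartic (lk1 _ _ _ cW ffW) (lk2 _ _ _ cW ffW) nxy0 nyz0 nxz0 H)).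
constructor 4; left; split=> [W cW|f W irrf cW fW]; have ffW := ff0W W cW.
  exact: (comp_case5 nG1 nG2 nH1 nH2 cW ffW nxy0 nyz0 nxz0 H).
exact: (outer_quadr nG1 nG2 nH1 nH2 cW ffW irrf fW
          (outer_C1_quad (lk1 _ _ _ cW ffW) (lk2 _ _ _ cW ffW) nxy0 nyz0 nxz0 H)).
Qed.

Lemma infinite_complex : infinite_set [set: C].
Proof.
move=> fC; apply: infinite_nat; apply: (finite_by (f := fun k : nat => k%:R : C)).
  exact: sub_finite_set fC.
move=> u; have [[i iu]|H'] := pselect (exists i : nat, i%:R = u); last first.
  by apply: (sub_finite_set _ (finite_set0 _)) => i [_ /= iu]; apply: H'; exists i.
apply: (sub_finite_set _ (finite_set1 i)) => i' [_ /=]; rewrite -iu => /eqP.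
by rewrite eqr_nat => /eqP.
Qed.

Lemma nonunit_vardeg (f : {mpoly C[2]}) : f != 0 -> f \isn't a GRing.unit ->
  exists j, (0 < vardeg j f)%N.
Proof.
move=> f0 uf; apply: contrapT => H; case/negP: uf; rewrite mpoly_unit_msize //.
apply/bigmax_leqP_seq => m mf _.
suff -> : m = 0%MM by rewrite mf0.
apply/mnmP => j; rewrite mnm0E; apply/eqP; rewrite -leqn0 leqNgt; apply/negP => mj.
apply: H; exists j; apply: leq_trans mj _.
exact: (@leq_bigmax_seq _ _ predT (fun m : 'X_{1..2} => m j) _ mf isT).
Qed.

(** In a variable of positive degree there is a root over each value of the other variable that is
    not a zero of the leading coefficient. *)
Lemma infinite_pairs (f : {mpoly C[2]}) : irreducible_mpoly f ->
  infinite_set [set ab : C * C | mmap idfun (opair ab.1 ab.2) f = 0].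
Proof.
move=> [f0 uf _] fin; have [j dj] := nonunit_vardeg f0 uf.
pose P := curry j f; have sP : (1 < size P)%N.
  by move: dj; rewrite vardegE /P; case: (size _) => [|[|]].
pose pr (ab : C * C) := opair ab.1 ab.2 (rev_ord j).
have lP : lead_coef P != 0 by rewrite lead_coef_eq0 -size_poly_gt0 ltnW.
apply: infinite_complex.
apply: (sub_finite_set _ (_ : finite_set (pr @` [set ab : C * C | mmap idfun (opair ab.1 ab.2) f = 0]
   `|` [set a | root (lead_coef P) a]))).
  move=> a _; have [ra|ra] := boolP (root (lead_coef P) a); [by right|left].
  pose Q := map_poly (horner_eval a) P.
  have sQ : size Q = size P by exact: size_poly_eq.
  have [b /rootP rb] : exists b, root Q b by apply: closed_root_size; rewrite sQ.
  pose v (i : 'I_2) := if i == j then b else a.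
  have vE : opair (v 0) (v 1) = v.
    by apply: functional_extensionality_dep; case=> [[|[|//]] ?]; rewrite /opair /=; congr (v _); apply: val_inj.
  exists (v 0, v 1); last by rewrite /pr /= vE /v rev_ord2.
  rewrite /= vE (eval_curry idfun v j) /v rev_ord2 eqxx -[RHS]rb.
  congr (_.[b]); apply: eq_map_poly => c /=; by rewrite map_poly_id.
rewrite finite_setU; split; first exact: finite_image.
exact: finite_roots.
Qed.

(** The infinitely many zeros of f lift to [Z], which is a finite union of irreducible sets, so
    infinitely many lifts lie on one component; there f vanishes identically. *)
Lemma outer_component (f : {mpoly C[2]}) : irreducible_mpoly f ->
  (forall a b : C, mmap idfun (opair a b) f = 0 ->
     exists p, [/\ Z p, p o0 = Some a & p o2 = Some b]) ->
  exists W, comp W /\ outer_zero f W.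
Proof.
move=> irrf lift.
pose S := [set p | Z p /\ exists a b : C, [/\ p o0 = Some a, p o2 = Some b & mmap idfun (opair a b) f = 0]].
have iS : infinite_set S.
  move=> fS; apply: (infinite_pairs irrf).
  pose pr (p : pt) : C * C := (odflt 0 (p o0), odflt 0 (p o2)).
  apply: (sub_finite_set _ (finite_image pr fS)) => -[a b] /= fab.
  have [p [Zp p0 p2]] := lift a b fab.
  by exists p; [split=> //; exists a, b|rewrite /pr p0 p2].
have cZ : zariski_closed Z by exact: closed_zeros.
have [|V [irrV VZ iV]] := infinite_fin_irr (closed_fin_irr cZ) _ iS; first by move=> p [].
have [W [cW VW]] := component_ex cZ irrV VZ.
exists W; split=> //; have [L [phi ffW]] := component_generic nG1 nG2 nH1 nH2 cW.
have [_ WZ _] := cW.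
have iWS : infinite_set (W `&` S).
  by apply: contra_not iV; apply: sub_finite_set => p [Sp Vp]; split=> //; exact: VW.
have := component_affine nG1 nG2 nH1 nH2 WZ iWS => iWA.
apply/(outer_zeroP ffW); rewrite -(phi_subst o0 o2).
apply: (infinite_zero nG1 nG2 nH1 nH2 cW ffW).
apply: contra_not iWA; apply: sub_finite_set => p [[Wp [_ [a [b [p0 p2 fab]]]]] [t E]].
split=> //; exists t => //; rewrite meval_subst.
by move: p0 p2; rewrite E => -[->] [->].
Qed.

End Coupling.

(** * Resultants *)

Section Resultants.
Variable A : comNzRingType.

(** Entries given by a function of natural numbers keep the minors in the same form, so that
    determinants of concrete size unfold by computation. *)
Lemma det_nat_rec n (f : nat -> nat -> A) :
  \det (\matrix_(i < n.+1, j < n.+1) f i j) =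
  \sum_(j < n.+1) f 0%N j * ((-1) ^+ j * \det (\matrix_(i < n, k < n) f i.+1 (bump j k))).
Proof.
rewrite (expand_det_row _ ord0); apply: eq_bigr => j _; rewrite mxE; congr (_ * _).
rewrite /cofactor add0n; congr (_ * \det _).
by apply/matrixP => i k; rewrite !mxE.
Qed.

Lemma det_nat3 (f : nat -> nat -> A) : \det (\matrix_(i < 3, j < 3) f i j) =
  f 0%N 0%N * (f 1%N 1%N * f 2%N 2%N - f 1%N 2%N * f 2%N 1%N)
  - f 0%N 1%N * (f 1%N 0%N * f 2%N 2%N - f 1%N 2%N * f 2%N 0%N)
  + f 0%N 2%N * (f 1%N 0%N * f 2%N 1%N - f 1%N 1%N * f 2%N 0%N).
Proof.
have H j := @det_nat_rec 1 (fun i k => f i.+1 (bump j k)).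
rewrite det_nat_rec !big_ord_recl big_ord0 !H !big_ord_recl !big_ord0.
rewrite !det_mx11 !mxE /bump /=; ring.
Qed.

Lemma det_nat4 (f : nat -> nat -> A) : \det (\matrix_(i < 4, j < 4) f i j) =
  let m j k l := f 1%N j * (f 2%N k * f 3%N l - f 2%N l * f 3%N k)
  - f 1%N k * (f 2%N j * f 3%N l - f 2%N l * f 3%N j)
  + f 1%N l * (f 2%N j * f 3%N k - f 2%N k * f 3%N j) in
  f 0%N 0%N * m 1%N 2%N 3%N - f 0%N 1%N * m 0%N 2%N 3%N
  + f 0%N 2%N * m 0%N 1%N 3%N - f 0%N 3%N * m 0%N 1%N 2%N.
Proof.
have H j := det_nat3 (fun i k => f i.+1 (bump j k)).
rewrite det_nat_rec !big_ord_recl big_ord0 !H /bump /=; ring.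
Qed.

Lemma det_cast n m (f : nat -> nat -> A) (M : 'M[A]_n) : n = m ->
  (forall i j, M i j = f i j) -> \det M = \det (\matrix_(i < m, j < m) f i j).
Proof.
by move=> <- H; congr (\det _); apply/matrixP => i j; rewrite mxE.
Qed.

Lemma resultantE (p q : {poly A}) dp dq : (size p).-1 = dp -> (size q).-1 = dq ->
  resultant p q = \det (\matrix_(i < dq + dp, j < dq + dp)
    (if (i < dq)%N then p`_(j - i) *+ (i <= j)%N
     else q`_(j - (i - dq)) *+ (i - dq <= j)%N)).
Proof.
move=> sp sq; rewrite /resultant.
apply: (det_cast (f := fun i j => if (i < dq)%N then p`_(j - i) *+ (i <= j)%N
     else q`_(j - (i - dq)) *+ (i - dq <= j)%N)); first by rewrite sp sq.
move=> i j; rewrite Sylvester_mxE; case: splitP => k /= ->.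
  by rewrite -sq ltn_ord.
by rewrite -sq ltnNge leq_addr /= addKn.
Qed.

Lemma size_quadratic (p0 p1 p2 : A) : p2 != 0 ->
  size (p2%:P * 'X^2 + p1%:P * 'X + p0%:P) = 3%N.
Proof.
move=> p20; rewrite -addrA size_polyDl; first by rewrite size_mulXn ?polyC_eq0 // size_polyC p20.
rewrite size_mulXn ?polyC_eq0 // size_polyC p20 size_MXaddC.
by case: ifP => // _; rewrite ltnS; exact: size_polyC_leq1.
Qed.

Lemma coef_quadratic (p0 p1 p2 : A) k : (p2%:P * 'X^2 + p1%:P * 'X + p0%:P)`_k =
  match k with 0%N => p0 | 1%N => p1 | 2%N => p2 | _ => 0 end.
Proof.
rewrite !coefD !coefCM coefXn coefX coefC.
by case: k => [|[|[|k]]]; rewrite /= ?mulr0 ?mulr1 ?add0r ?addr0.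
Qed.

Lemma resultant21 (p0 p1 p2 q0 q1 : A) : p2 != 0 -> q1 != 0 ->
  resultant (p2%:P * 'X^2 + p1%:P * 'X + p0%:P) (q1%:P * 'X + q0%:P) =
  p2 * q0 ^+ 2 - p1 * q0 * q1 + p0 * q1 ^+ 2.
Proof.
move=> p20 q10.
have sq : size (q1%:P * 'X + q0%:P) = 2%N.
  by rewrite size_MXaddC polyC_eq0 (negPf q10) size_polyC q10.
have cq k : (q1%:P * 'X + q0%:P)`_k = match k with 0%N => q0 | 1%N => q1 | _ => 0 end.
  rewrite coefD coefCM coefX coefC.
  by case: k => [|[|k]]; rewrite /= ?mulr0 ?mulr1 ?add0r ?addr0.
rewrite (@resultantE _ _ 2 1) ?size_quadratic ?sq //.
set p := (_ + p0%:P); set q := (_ + q0%:P).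
rewrite (det_nat3 (fun i j => if (i < 1)%N then p`_(j - i) *+ (i <= j)%N
  else q`_(j - (i - 1)) *+ (i - 1 <= j)%N)) /= /p /q.
rewrite !coef_quadratic !cq /= ?mulr1n ?mulr0n; ring.
Qed.

Lemma resultant22 (p0 p1 p2 q0 q1 q2 : A) : p2 != 0 -> q2 != 0 ->
  resultant (p2%:P * 'X^2 + p1%:P * 'X + p0%:P) (q2%:P * 'X^2 + q1%:P * 'X + q0%:P) =
  (p2 * q0 - q2 * p0) ^+ 2 - (p2 * q1 - q2 * p1) * (p1 * q0 - q1 * p0).
Proof.
move=> p20 q20.
rewrite (@resultantE _ _ 2 2) ?size_quadratic //.
set p := (_ + p0%:P); set q := (_ + q0%:P).
rewrite (det_nat4 (fun i j => if (i < 2)%N then p`_(j - i) *+ (i <= j)%N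
  else q`_(j - (i - 2)) *+ (i - 2 <= j)%N)) /= /p /q.
rewrite !coef_quadratic /= ?mulr1n ?mulr0n; ring.
Qed.

End Resultants.

(** * The polynomials of a mesh *)

Lemma eq_lin2 (A : comNzRingType) (k k' a c c' : A) :
  c = 0 -> c' = 0 -> a = k * c + k' * c' -> a = 0.
Proof. by move=> -> -> ->; rewrite !mulr0 addr0. Qed.

Lemma eq_lin3 (A : comNzRingType) (k k' k'' a c c' c'' : A) :
  c = 0 -> c' = 0 -> c'' = 0 -> a = k * c + k' * c' + k'' * c'' -> a = 0.
Proof. by move=> -> -> -> ->; rewrite !mulr0 !addr0. Qed.

Lemma mulf_sqr_eq0 (A : idomainType) (t w : A) : t != 0 -> w * t ^+ 2 = 0 -> w = 0.
Proof. by move=> t0 /eqP; rewrite mulf_eq0 expf_eq0 (negPf t0) andbF orbF => /eqP. Qed.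

Section BipolySubst.
Variable R : realType.
Local Notation C := R[i].

Lemma hcoord_neq0 (q : CP1 R) : ((hcoord q).1 != 0) || ((hcoord q).2 != 0).
Proof. by case: q => [w|] /=; rewrite oner_eq0 ?orbT. Qed.

Lemma bipolyX n (a b : 'I_n) D (G : nat -> nat -> C) :
  bipoly a b D G = \sum_(k < D.+1) \sum_(l < D.+1) (G k l)%:MP * ('X_a ^+ k * 'X_b ^+ l).
Proof.
apply: eq_bigr => k _; apply: eq_bigr => l _.
by rewrite /bimn mpolyXD !mpolyXn mul_mpolyC.
Qed.

Lemma msubst2_bipoly n (a b : 'I_n) D (G : nat -> nat -> C) :
  msubst2 (bipoly 0 1 D G) 'X_a 'X_b = bipoly a b D G.
Proof.
transitivity (mmap (@mpolyC n C) (opair 'X_a 'X_b) (bipoly (0 : 'I_2) 1 D G)); first by [].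
by rewrite mmap_bipoly // [RHS]bipolyX.
Qed.

End BipolySubst.

Section MeshPolynomials.
Variables (R : realType) (M : mesh R).
Local Notation C := R[i].
Local Notation "r %:C" := (real_complex R r) (at level 1, format "r %:C").

(* F_i = q / p, so that y_i = (p x + q) / (p - q x), including F_i = oo. *)
Definition Fden (i : 'I_4) : C := if coef_F M i is Some _ then 1 else 0.
Definition Fnum (i : 'I_4) : C := if coef_F M i is Some r then r%:C else 1.
(** At p = 0 and q = 1 the form y (p - q x) - (q + p x) is the opposite of y x + 1. *)
Definition Fsgn (i : 'I_4) : C := if coef_F M i is Some _ then 1 else -1.

(** F_i is real or infinite, hence different from the square roots of -1, where the substitution
    would degenerate. *)
Lemma Fnorm_neq0 i : Fden i ^+ 2 + Fnum i ^+ 2 != 0.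
Proof.
rewrite /Fden /Fnum; case: coef_F => [r|]; last by rewrite expr0n add0r expr1n oner_eq0.
rewrite expr1n -rmorphXn -(rmorph1 (real_complex R)) -rmorphD fmorph_eq0.
by rewrite gt_eqF // ltr_pwDl // sqr_ge0.
Qed.

(** The coefficients of g^(i)(x, (p x' + q) / (p - q x')) multiplied by (p - q x')^2. *)
Definition Gmesh (i : 'I_4) (k l : nat) : C :=
  let a := (coef_a M i)%:C in let b := (coef_b M i)%:C in
  let c := (coef_c M i)%:C in let e := (coef_e M i)%:C in
  let p := Fden i in let q := Fnum i in
  match k, l with
  | 2, 2 => a * p ^+ 2 + b * q ^+ 2
  | 2, 1 => 2 * p * q * (a - b)
  | 2, 0 => a * q ^+ 2 + b * p ^+ 2
  | 1, 2 => - (p * q)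
  | 1, 1 => p ^+ 2 - q ^+ 2
  | 1, 0 => p * q
  | 0, 2 => c * p ^+ 2 + e * q ^+ 2
  | 0, 1 => 2 * p * q * (c - e)
  | 0, 0 => c * q ^+ 2 + e * p ^+ 2
  | _, _ => 0
  end.

Definition Hmesh (i : 'I_4) (k l : nat) : C :=
  match k, l with
  | 1, 0 => Fsgn i * Fden i
  | 1, 1 => - (Fsgn i * Fnum i)
  | 0, 0 => - (Fsgn i * Fnum i)
  | 0, 1 => - (Fsgn i * Fden i)
  | _, _ => 0
  end.

Lemma Hpoly_bipoly i : Hpoly M i = bipoly 0 1 1 (Hmesh i).
Proof.
rewrite bipolyX !big_ord_recl !big_ord0 /bump /= /Hpoly /Fsgn /Fden /Fnum /cst.
case: coef_F => [r|]; rewrite !(mpolyCN, mpolyCM, mpolyC1, mpolyC0) /=; ring.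
Qed.

Lemma Hmesh_nonvertical i : nonvertical 1 (Hmesh i).
Proof.
have nF := Fnorm_neq0 i; have s0 : Fsgn i != 0.
  by rewrite /Fsgn; case: coef_F => [r|]; rewrite ?oppr_eq0 oner_eq0.
set P := Fden i in nF *; set Q := Fnum i in nF *; set s := Fsgn i in s0 *.
split=> q; have := hcoord_neq0 q; set u := (hcoord q).1; set v := (hcoord q).2 => uv;
  apply: contrapT => H.
- have z k : (k <= 1)%N -> bco 1 (Hmesh i) k (hcoord q) = 0.
    by move=> k1; apply/eqP; apply: contrapT => /negP nz; apply: H; exists k.
  have := z 1%N isT; have := z 0%N isT.
  rewrite /bco !big_ord_recl !big_ord0 /bump /= -/u -/v -/P -/Q -/s => E0 E1.
  (* The multipliers here and below invert a linear system in (u, v) whose determinant is P^2 + Q^2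
     up to sign. *)
  have Eu : s * (P ^+ 2 + Q ^+ 2) * u = 0.
    by apply: (eq_lin2 (k := - P) (k' := - Q) E0 E1); ring.
  have Ev : s * (P ^+ 2 + Q ^+ 2) * v = 0.
    by apply: (eq_lin2 (k := - Q) (k' := P) E0 E1); ring.
  have sF : s * (P ^+ 2 + Q ^+ 2) != 0 by rewrite mulf_neq0.
  by move: uv; rewrite -(mulrI_eq0 u (mulfI sF)) -(mulrI_eq0 v (mulfI sF)) Eu Ev eqxx.
have z k : (k <= 1)%N -> bco 1 (gtr (Hmesh i)) k (hcoord q) = 0.
  by move=> k1; apply/eqP; apply: contrapT => /negP nz; apply: H; exists k.
have := z 1%N isT; have := z 0%N isT.
rewrite /bco /gtr !big_ord_recl !big_ord0 /bump /= -/u -/v -/P -/Q -/s => E0 E1.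
have Eu : s * (P ^+ 2 + Q ^+ 2) * u = 0.
  by apply: (eq_lin2 (k := P) (k' := - Q) E0 E1); ring.
have Ev : s * (P ^+ 2 + Q ^+ 2) * v = 0.
  by apply: (eq_lin2 (k := - Q) (k' := - P) E0 E1); ring.
have sF : s * (P ^+ 2 + Q ^+ 2) != 0 by rewrite mulf_neq0.
by move: uv; rewrite -(mulrI_eq0 u (mulfI sF)) -(mulrI_eq0 v (mulfI sF)) Eu Ev eqxx.
Qed.

Hypothesis hns : mesh_nonsingular M.

(** These are the pairs whose common vanishing would make both a e and b c zero; a line in the curve
    would force one of them to vanish. *)
Lemma nonsingular_cases i : let a := (coef_a M i)%:C in let b := (coef_b M i)%:C in
  let c := (coef_c M i)%:C in let e := (coef_e M i)%:C in
  [/\ (a != 0) || (b != 0), (a != 0) || (c != 0), (b != 0) || (e != 0) & (c != 0) || (e != 0)].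
Proof.
rewrite /= !fmorph_eq0; have H := @hns i.
split; rewrite -negb_and; apply/negP => /andP [/eqP h1 /eqP h2]; apply: H;
  by rewrite h1 h2 ?mul0r ?mulr0.
Qed.

Lemma Gmesh_nonvertical i : nonvertical 2 (Gmesh i).
Proof.
have nF := Fnorm_neq0 i; have [] := nonsingular_cases i.
set a := (coef_a M i)%:C; set b := (coef_b M i)%:C.
set c := (coef_c M i)%:C; set e := (coef_e M i)%:C.
set P := Fden i in nF *; set Q := Fnum i in nF *.
move=> ab ac be ce; split=> q; have := hcoord_neq0 q; set u := (hcoord q).1; set v := (hcoord q).2 => uv;
  apply: contrapT => H.
- have z k : (k <= 2)%N -> bco 2 (Gmesh i) k (hcoord q) = 0.
    by move=> k1; apply/eqP; apply: contrapT => /negP nz; apply: H; exists k.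
  have := z 2%N isT; have := z 1%N isT; have := z 0%N isT.
  rewrite /bco !big_ord_recl !big_ord0 /bump /= -/u -/v -/P -/Q -/a -/b -/c -/e.
  (* [Y : Y'] is the value of y_i that corresponds to x_{i+1} = [u : v]; in these coordinates the
     three coefficients are those of g^(i). *)
  pose Y := P * u + Q * v; pose Y' := P * v - Q * u.
  rewrite [X in X = 0 -> _](_ : _ = c * Y ^+ 2 + e * Y' ^+ 2); last by rewrite /Y /Y'; ring.
  move=> E0; rewrite [X in X = 0 -> _](_ : _ = Y * Y'); last by rewrite /Y /Y'; ring.
  move=> E1; rewrite [X in X = 0 -> _](_ : _ = a * Y ^+ 2 + b * Y' ^+ 2); last by rewrite /Y /Y'; ring.
  move=> E2; have YY : (Y != 0) || (Y' != 0).
    move: uv; apply: contraTT; rewrite !negb_or !negbK => /andP [/eqP Y0 /eqP Y0'].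
    have Eu : (P ^+ 2 + Q ^+ 2) * u = 0.
      by apply: (eq_lin2 (k := P) (k' := - Q) Y0 Y0'); rewrite /Y /Y'; ring.
    have Ev : (P ^+ 2 + Q ^+ 2) * v = 0.
      by apply: (eq_lin2 (k := Q) (k' := P) Y0 Y0'); rewrite /Y /Y'; ring.
    by rewrite -(mulrI_eq0 u (mulfI nF)) -(mulrI_eq0 v (mulfI nF)) Eu Ev eqxx.
  move: E1 => /eqP; rewrite mulf_eq0 => /orP [] /eqP y0.
    move: YY E0 E2; rewrite y0 eqxx expr0n /= !mulr0 !add0r => Y0' /(mulf_sqr_eq0 Y0') e0 /(mulf_sqr_eq0 Y0') b0.
    by move: be; rewrite b0 e0 eqxx.
  move: YY E0 E2; rewrite y0 eqxx orbF expr0n /= !mulr0 !addr0 => Y0 /(mulf_sqr_eq0 Y0) c0 /(mulf_sqr_eq0 Y0) a0.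
  by move: ac; rewrite a0 c0 eqxx.
have z k : (k <= 2)%N -> bco 2 (gtr (Gmesh i)) k (hcoord q) = 0.
  by move=> k1; apply/eqP; apply: contrapT => /negP nz; apply: H; exists k.
have := z 2%N isT; have := z 1%N isT; have := z 0%N isT.
rewrite /bco /gtr !big_ord_recl !big_ord0 /bump /= -/u -/v -/P -/Q -/a -/b -/c -/e => E0 E1 E2.
have nF2 : (P ^+ 2 + Q ^+ 2) ^+ 2 != 0 by rewrite expf_neq0.
pose s := (P ^+ 2 + Q ^+ 2) ^+ 2.
(* The multipliers undo the substitution on quadratic forms in x_{i+1}, up to the factor (P^2 +
   Q^2)^2, and recover the coefficients of g^(i) in y_i. *)
have Ea : s * (a * u ^+ 2 + c * v ^+ 2) = 0.
  by apply: (eq_lin3 (k := Q ^+ 2) (k' := P * Q) (k'' := P ^+ 2) E0 E1 E2); rewrite /s; ring.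
have Eb : s * (b * u ^+ 2 + e * v ^+ 2) = 0.
  by apply: (eq_lin3 (k := P ^+ 2) (k' := - (P * Q)) (k'' := Q ^+ 2) E0 E1 E2); rewrite /s; ring.
have Em : s * (u * v) = 0.
  by apply: (eq_lin3 (k := 2 * P * Q) (k' := P ^+ 2 - Q ^+ 2) (k'' := - (2 * P * Q)) E0 E1 E2); rewrite /s; ring.
move/eqP: Ea; rewrite mulf_eq0 (negPf nF2) /= => /eqP Ea.
move/eqP: Eb; rewrite mulf_eq0 (negPf nF2) /= => /eqP Eb.
move/eqP: Em; rewrite mulf_eq0 (negPf nF2) /= mulf_eq0 => /orP [] /eqP w0.
  move: uv Ea Eb; rewrite w0 eqxx expr0n /= !mulr0 !add0r => v0 /(mulf_sqr_eq0 v0) c0 /(mulf_sqr_eq0 v0) e0.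
  by move: ce; rewrite c0 e0 eqxx.
move: uv Ea Eb; rewrite w0 eqxx orbF expr0n /= !mulr0 !addr0 => u0 /(mulf_sqr_eq0 u0) a0 /(mulf_sqr_eq0 u0) b0.
by move: ab; rewrite a0 b0 eqxx.
Qed.

End MeshPolynomials.

Section PolySubst.
Variable R : realType.
Local Notation C := R[i].

Definition upol n (j : 'I_n) D (c : nat -> C) : {mpoly C[n]} :=
  \sum_(k < D.+1) (c k)%:MP * 'X_j ^+ k.

Lemma upol_neq0 n (j : 'I_n) D c : (exists2 k, (k <= D)%N & c k != 0) -> upol j D c != 0.
Proof.
move=> [k kD ck]; apply: contra_neq ck => E; rewrite -[RHS](mcoeff0 C (U_(j) *+ k)%MM) -E.
pose k' : 'I_D.+1 := Ordinal (kD : (k < D.+1)%N).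
rewrite raddf_sum /= (bigD1 k') //= mcoeffCM mpolyXn mcoeffX eqxx mulr1 big1 ?addr0 // => i ik.
rewrite mcoeffCM mpolyXn mcoeffX; case: eqP => [/(congr1 (fun m : 'X_{1..n} => m j))|]; last by rewrite mulr0.
by rewrite !mulmnE mnm1E eqxx !mul1n => E'; case/eqP: ik; apply: val_inj.
Qed.

Lemma eval_upol n (j : 'I_n) D c v : mmap idfun v (upol j D c) = \sum_(k < D.+1) c k * v j ^+ k.
Proof.
rewrite raddf_sum; apply: eq_bigr => k _ /=.
by rewrite rmorphM rmorphXn /= mmapC mmapX mmap1U.
Qed.

Lemma psubst2_bipoly D (G : nat -> nat -> C) u v :
  psubst2 (bipoly 0 1 D G) u v =
  \sum_(k < D.+1) \sum_(l < D.+1) (G k l)%:MP%:P * (u ^+ k * v ^+ l).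
Proof.
transitivity (mmap (@polyC {mpoly C[2]} \o @mpolyC 2 C) (opair u v) (bipoly (0 : 'I_2) 1 D G)); first by [].
by rewrite mmap_bipoly.
Qed.

Lemma psubst2_left (G : nat -> nat -> C) (j : 'I_2) :
  psubst2 (bipoly 0 1 2 G) ('X_j)%:P 'X =
  (upol j 2 (G^~ 2%N))%:P * 'X^2 + (upol j 2 (G^~ 1%N))%:P * 'X + (upol j 2 (G^~ 0%N))%:P.
Proof.
rewrite psubst2_bipoly exchange_big /= /upol !big_ord_recr !big_ord0 /=.
by rewrite !(polyCD, polyCM, polyC_exp); ring.
Qed.

Lemma psubst2_right (G : nat -> nat -> C) (j : 'I_2) :
  psubst2 (bipoly 0 1 2 G) 'X ('X_j)%:P =
  (upol j 2 (G 2%N))%:P * 'X^2 + (upol j 2 (G 1%N))%:P * 'X + (upol j 2 (G 0%N))%:P.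
Proof.
rewrite psubst2_bipoly /= /upol !big_ord_recr !big_ord0 /=.
by rewrite !(polyCD, polyCM, polyC_exp); ring.
Qed.

Lemma psubst2_right1 (H : nat -> nat -> C) (j : 'I_2) :
  psubst2 (bipoly 0 1 1 H) 'X ('X_j)%:P =
  (upol j 1 (H 1%N))%:P * 'X + (upol j 1 (H 0%N))%:P.
Proof.
rewrite psubst2_bipoly /= /upol !big_ord_recr !big_ord0 /=.
by rewrite !(polyCD, polyCM, polyC_exp); ring.
Qed.

Lemma nonvertical_col D (G : nat -> nat -> C) : nonvertical D G -> exists2 k, (k <= D)%N & G k D != 0.
Proof. by move=> [/(_ None) [k kD]]; rewrite bco_infty; exists k. Qed.

Lemma nonvertical_row D (G : nat -> nat -> C) : nonvertical D G -> exists2 k, (k <= D)%N & G D k != 0.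
Proof. by move=> [_ /(_ None) [k kD]]; rewrite bco_infty; exists k. Qed.

End PolySubst.

Section MeshGens.
Variables (R : realType) (M : mesh R).
Local Notation C := R[i].
Local Notation "r %:C" := (real_complex R r) (at level 1, format "r %:C").

Definition gcoef (i : 'I_4) (k l : nat) : C :=
  match k, l with
  | 2, 2 => (coef_a M i)%:C
  | 2, 0 => (coef_b M i)%:C
  | 0, 2 => (coef_c M i)%:C
  | 1, 1 => 1
  | 0, 0 => (coef_e M i)%:C
  | _, _ => 0
  end.

Lemma gpoly_bipoly i : gpoly M i = bipoly 0 1 2 (gcoef i).
Proof.
rewrite bipolyX !big_ord_recl !big_ord0 /bump /= /gpoly /cst.
rewrite !(mpolyC1, mpolyC0) /=; ring.
Qed.

Hypothesis hns : mesh_nonsingular M.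

Lemma gtilde_bipoly i : gtilde M i = bipoly 0 1 2 (Gmesh M i).
Proof.
(* The resultant depends on the actual degrees in y_i: its leading coefficients must be nonzero for
   the formula in degrees 2 and 1 to apply. *)
have p20 : upol (0 : 'I_2) 2 ((gcoef i)^~ 2%N) != 0.
  apply: upol_neq0; have [_ /orP [h|h] _ _] := nonsingular_cases hns i; by [exists 2%N|exists 0%N].
have q10 : upol (1 : 'I_2) 1 (Hmesh M i 1%N) != 0.
  by apply: upol_neq0; exact: nonvertical_row (Hmesh_nonvertical M i).
rewrite /gtilde gpoly_bipoly Hpoly_bipoly psubst2_left psubst2_right1 resultant21 //.
rewrite bipolyX /upol !big_ord_recl !big_ord0 /bump /Gmesh /gcoef /Hmesh /=.
rewrite /Fsgn /Fden /Fnum; case: coef_F => [r|];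
  rewrite !(mpolyCD, mpolyCB, mpolyCN, mpolyCM, mpolyC1, mpolyC0, rmorphXn) /=; ring.
Qed.

Lemma coupling_gens_bipoly s : coupling_gens M s =
  cgens (Gmesh M s) (Gmesh M (s + 1)) (Hmesh M s) (Hmesh M (s + 1)).
Proof.
by rewrite /coupling_gens !gtilde_bipoly !Hpoly_bipoly !msubst2_bipoly.
Qed.

End MeshGens.

(** * Eliminants and their factors *)

(** The root is sought in CP^1, since the expression also vanishes when both leading coefficients
    do, and the common root is then infinity. *)
Lemma common_root (R : realType) (p0 p1 p2 q0 q1 q2 : R[i]) :
  [|| p0 != 0, p1 != 0 | p2 != 0] ->
  (p2 * q0 - q2 * p0) ^+ 2 - (p2 * q1 - q2 * p1) * (p1 * q0 - q1 * p0) = 0 <->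
  exists t : CP1 R, let: (u, v) := hcoord t in
    p2 * u ^+ 2 + p1 * u * v + p0 * v ^+ 2 = 0 /\
    q2 * u ^+ 2 + q1 * u * v + q0 * v ^+ 2 = 0.
Proof.
move=> pn0; split=> [E|[[w|] /= [Ep Eq]]]; last 2 first.
- have -> : p0 = - (p2 * w ^+ 2 + p1 * w) by apply: (eq_lin (k := 1) Ep); ring.
  have -> : q0 = - (q2 * w ^+ 2 + q1 * w) by apply: (eq_lin (k := 1) Eq); ring.
  ring.
- have -> : p2 = 0 by rewrite -Ep; ring.
  have -> : q2 = 0 by rewrite -Eq; ring.
  ring.
have [p20|p20] := eqVneq p2 0.
  have [q20|q20] := eqVneq q2 0.
    by exists None => /=; rewrite p20 q20; split; ring.
  have {}E : q2 * p0 ^+ 2 - q1 * p1 * p0 + q0 * p1 ^+ 2 = 0.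
    by apply: (mulfI q20); rewrite mulr0 -E p20; ring.
  have p10 : p1 != 0.
    move: pn0; rewrite p20 eqxx orbF; apply: contraTneq => p10; move/eqP: E.
    by rewrite p10 mulr0 mul0r subr0 expr0n mulr0 addr0 mulf_eq0 (negPf q20) expf_eq0 negb_or eqxx /= => ->.
  exists (Some (- p0 / p1)) => /=; rewrite p20; split; first by field.
  by rewrite -[RHS](mul0r (p1 ^- 2)) -E; field.
have [r Dr] : exists w, p2 * w ^+ 2 + p1 * w + p0 = 0.
  have s3 : (1 < size (p2%:P * 'X^2 + p1%:P * 'X + p0%:P)%R)%N by rewrite size_quadratic.
  have [w /rootP] := closed_root_size s3.
  by rewrite !(hornerD, hornerM, hornerXn, hornerX, hornerC); exists w.
pose s := - p1 / p2 - r.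
have Dp1 : p1 = - p2 * (r + s) by rewrite /s; field.
have Dp0 : p0 = p2 * r * s by apply: (eq_lin (k := 1) Dr); rewrite /s; field.
(* The resultant is the square of [p2] times the values of the second quadratic at the two roots of
   the first. *)
have /eqP : p2 ^+ 2 * ((q2 * r ^+ 2 + q1 * r + q0) * (q2 * s ^+ 2 + q1 * s + q0)) = 0.
  by rewrite -E Dp1 Dp0; ring.
rewrite mulf_eq0 expf_eq0 (negPf p20) /= mulf_eq0 => /orP [] /eqP H.
  by exists (Some r); rewrite /= Dp1 Dp0; split; first ring; rewrite -H; ring.
by exists (Some s); rewrite /= Dp1 Dp0; split; first ring; rewrite -H; ring.
Qed.

Lemma rmorph_resultant22 (A B : comNzRingType) (phi : {rmorphism A -> B})
    (p0 p1 p2 q0 q1 q2 : A) (r0 r1 r2 s0 s1 s2 : B) : p2 != 0 -> q2 != 0 ->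
  phi p0 = r0 -> phi p1 = r1 -> phi p2 = r2 -> phi q0 = s0 -> phi q1 = s1 -> phi q2 = s2 ->
  phi (resultant (p2%:P * 'X^2 + p1%:P * 'X + p0%:P) (q2%:P * 'X^2 + q1%:P * 'X + q0%:P)) =
  (r2 * s0 - s2 * r0) ^+ 2 - (r2 * s1 - s2 * r1) * (r1 * s0 - s1 * r0).
Proof.
by move=> p20 q20 <- <- <- <- <- <-; rewrite resultant22 // !(rmorphB, rmorphM, rmorphXn).
Qed.

Section Eliminant.
Variables (R : realType) (j : 'I_2).
Local Notation C := R[i].
Variables G G' : nat -> nat -> C.
Hypotheses (nG : nonvertical 2 G) (nG' : nonvertical 2 G').

(** [j] is 0 for the first eliminant and 1 for the second, whose coupling runs from x_3 back to
    x_1. *)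
Definition eliminant : {mpoly C[2]} :=
  resultant (psubst2 (bipoly 0 1 2 G) ('X_j)%:P 'X)
            (psubst2 (bipoly 0 1 2 G') 'X ('X_(rev_ord j))%:P).

Lemma eliminantP v : mmap idfun v eliminant = 0 <->
  exists t : CP1 R, bform 2 G (v j, 1) (hcoord t) = 0 /\
    bform 2 G' (hcoord t) (v (rev_ord j), 1) = 0.
Proof.
rewrite /eliminant psubst2_left psubst2_right.
have E k : mmap idfun v (upol j 2 (G^~ k)) = bco 2 (gtr G) k (v j, 1).
  by rewrite eval_upol; apply: eq_bigr => i _; rewrite expr1n mulr1.
have E' k : mmap idfun v (upol (rev_ord j) 2 (G' k)) = bco 2 G' k (v (rev_ord j), 1).
  by rewrite eval_upol; apply: eq_bigr => i _; rewrite expr1n mulr1.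
have p20 : upol j 2 (G^~ 2%N) != 0 by apply: upol_neq0; exact: nonvertical_col nG.
have q20 : upol (rev_ord j) 2 (G' 2%N) != 0 by apply: upol_neq0; exact: nonvertical_row nG'.
have -> := rmorph_resultant22 (phi := mmap idfun v) p20 q20 (E _) (E _) (E _) (E' _) (E' _) (E' _).
rewrite common_root; last first.
  have [_ /(_ (Some (v j))) [k k2 nz]] := nG.
  by case: k k2 nz => [|[|[|//]]] _ /= ->; rewrite ?orbT.
split=> -[t]; case Et : (hcoord t) => [x y] H; exists t; move: H; rewrite Et -?[bform 2 G _ _]bform_tr !bform2E /=.
  by move=> [E1 E2]; split; [rewrite -[RHS]E1|rewrite -[RHS]E2]; ring.
by move=> [E1 E2]; split; [rewrite -[RHS]E1|rewrite -[RHS]E2]; ring.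
Qed.

(** A value of the first outer coordinate allows finitely many middle ones, and each of these
    finitely many values of the other outer coordinate. In particular the eliminant cannot be the
    zero polynomial. *)
Lemma eliminant_fibre a :
  finite_set [set b | exists2 v, v j = a & v (rev_ord j) = b /\ mmap idfun v eliminant = 0].
Proof.
have [nv1 nv2] := nG; have [nv1' nv2'] := nG'.
have fT : finite_set [set t : CP1 R | bform 2 G (a, 1) (hcoord t) = 0].
  have := @bform_finite _ 2 (gtr G) (a, 1) (nv2 (Some a)).
  by apply: sub_finite_set => t /= E; rewrite bform_tr.
have : finite_set (\bigcup_(t in [set t : CP1 R | bform 2 G (a, 1) (hcoord t) = 0])
    [set b : CP1 R | bform 2 G' (hcoord t) (hcoord b) = 0]).
  apply: bigcup_finite; [exact: fT|move=> t _].
  have := @bform_finite _ 2 (gtr G') (hcoord t) (nv2' t).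
  by apply: sub_finite_set => b /= E; rewrite bform_tr.
move=> fB; apply: (finite_by (f := @Some C)).
  apply: sub_finite_set fB => _ [b [v vj [vr /eliminantP [t [E1 E2]]]] <-].
  by exists t; [rewrite -vj|move: E2; rewrite vr].
move=> u; apply: (sub_finite_set _ (finite_set1 (odflt 0 u))) => b [_ /= <-] //.
Qed.

Lemma eliminant_neq0 : eliminant != 0.
Proof.
apply/eqP => E; have := eliminant_fibre 0; rewrite E => H; apply: (@infinite_complex R).
apply: sub_finite_set H => b _ /=; exists (fun i => if i == j then 0 else b).
  by rewrite eqxx.
by rewrite mmap0 ifN //; case: (j) => [[|[|//]] ?].
Qed.

End Eliminant.

(** * Common divisors in C[x_1, x_3] *)

Section Gcd.
Variable R : realType.
Local Notation C := R[i].
Implicit Types f g h p q d : {mpoly C[2]}.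

Lemma mdvdMl p f g : mdvd p f -> mdvd p (g * f).
Proof. by move=> [k ->]; exists (g * k); rewrite mulrA. Qed.

Lemma mdvd_trans f g h : mdvd f g -> mdvd g h -> mdvd f h.
Proof. by move=> fg [k ->]; exact: mdvdMl. Qed.

Lemma irreducible_mpoly_prime f g h : irreducible_mpoly f -> mdvd f (g * h) ->
  mdvd f g \/ mdvd f h.
Proof.
move=> irrf [p /(congr1 (curry _)) gh]; have [f0 uf _] := irrf.
have [j] := nonunit_vardeg f0 uf; rewrite vardegE => sf.
have sf1 : (1 < size (curry j f))%N by case: (size _) sf => [|[]].
have := gh j; rewrite !rmorphM /= => E.
have lift q : (exists k, curry j q = k * curry j f) -> mdvd f q.
  by move=> [k Ek]; exists (uncurry j k); rewrite -[q](curryK j) Ek rmorphM /= curryK.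
have [/lift|/lift] := irreducible_prime (irreducible_curry j irrf) sf1 E; by [left|right].
Qed.

Lemma nonunit_factor d : d != 0 -> d \isn't a GRing.unit -> exists f, irreducible_factor f d.
Proof.
move=> d0 ud; have := @irreducible_factor_ex R (fun g => g \isn't a GRing.unit) d.
case=> // [u uu|p q|f [irrf _]]; [by rewrite uu| |by exists f].
by rewrite unitrM negb_and => /orP.
Qed.

(** Ensures that the chosen [dM] is a gcd and not the default value. Common irreducible factors are
    split off one at a time, and primality tells how a common divisor meets the factor removed. *)
Lemma gcd_ex f g : f != 0 -> g != 0 -> exists d, is_gcd f g d.
Proof.
have [n] := ubnP (msize f); elim: n => // n IHn in f g *.
rewrite ltnS => szf f0 g0.
have [[p [irrp [[f1 fE] [g1 gE]]]]|H] :=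
    pselect (exists p, irreducible_mpoly p /\ (mdvd p f /\ mdvd p g)); last first.
  exists 1; split=> [||d df dg]; [by exists f; rewrite mulr1|by exists g; rewrite mulr1|].
  have [ud|ud] := boolP (d \is a GRing.unit); first by exists d^-1; rewrite mulVr.
  have [|p [irrp pd]] := nonunit_factor _ ud.
    by apply: contraNneq f0 => d0; case: df => q ->; rewrite d0 mulr0.
  by case: H; exists p; split=> //; split; exact: mdvd_trans pd _.
have [p0 up _] := irrp.
have f10 : f1 != 0 by apply: contraNneq f0 => z; rewrite fE z mul0r.
have g10 : g1 != 0 by apply: contraNneq g0 => z; rewrite gE z mul0r.
have sz1 : (msize f1 < n)%N.
  apply: leq_trans szf; rewrite fE msizeM //; move: up; rewrite mpoly_unit_msize // -ltnNge.
  have := f10; rewrite -msize_poly_eq0.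
  by case: (msize p) => [|[|k]] //; case: (msize f1) => // l _ _; rewrite addSn addnS /= ltnS addnS ltnS leq_addr.
have [d1 [[a1 f1E] [b1 g1E] gd1]] := IHn f1 g1 sz1 f10 g10.
exists (d1 * p); split=> [||d df dg].
- by exists a1; rewrite mulrA -f1E.
- by exists b1; rewrite mulrA -g1E.
have [[e dE]|npd] := pselect (mdvd p d).
  have cancel h h1 : h = h1 * p -> mdvd d h -> mdvd e h1.
    move=> hE [k kE]; exists k; apply: (mulIf p0); by rewrite -hE kE dE mulrA.
  by have [k ->] := gd1 e (cancel _ _ fE df) (cancel _ _ gE dg); exists k; rewrite dE mulrA.
have cancel h h1 : h = h1 * p -> mdvd d h -> mdvd d h1.
  move=> hE [k kE]; have : mdvd p (k * d) by exists h1; rewrite -kE.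
  move=> /(irreducible_mpoly_prime irrp) [[k' k'E]|//]; exists k'.
  by apply: (mulIf p0); rewrite -hE kE k'E mulrAC.
by have [k ->] := gd1 d (cancel _ _ fE df) (cancel _ _ gE dg); exists (k * p); rewrite mulrAC.
Qed.

(** Take an irreducible factor of f whose zeros in S have infinitely many first coordinates. If it
    did not divide g, eliminating the second variable would leave finitely many of them. *)
Lemma common_factor f g (S : set (C * C)) : f != 0 ->
  (forall ab, S ab -> mmap idfun (opair ab.1 ab.2) f = 0 /\ mmap idfun (opair ab.1 ab.2) g = 0) ->
  infinite_set (fst @` S) -> exists p, irreducible_factor p f /\ mdvd p g.
Proof.
move=> f0 Sz iS; pose V (p : {mpoly C[2]}) := [set ab : C * C | mmap idfun (opair ab.1 ab.2) p = 0].
have finite_univ w T : w != 0 -> T `<=` V (univ 1 w) -> finite_set (fst @` T).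
  move=> w0 TV; apply: sub_finite_set (finite_roots w0) => _ [ab /TV /= abT <-].
  by apply/rootP; rewrite -abT eval_univ map_poly_id // rev_ord21.
have [|p q||p [pf ip]] := @irreducible_factor_ex R (fun p => infinite_set (fst @` (S `&` V p))) f _ _ f0.
- move=> u uu; apply; rewrite (_ : S `&` V u = set0) ?image_set0; first exact: finite_set0.
  apply/seteqP; split=> // ab [_ /= Vu].
  by have := rmorph_unit (mmap idfun (opair ab.1 ab.2)) uu; rewrite /= Vu unitr0.
- rewrite -not_andP => H [fp fq]; apply: H.
  have : finite_set (fst @` (S `&` V p) `|` fst @` (S `&` V q)) by rewrite finite_setU.
  apply: sub_finite_set => _ [ab [Sab /= Vpq] <-]; move/eqP: Vpq.
  by rewrite rmorphM mulf_eq0 => /orP [] /eqP H; [left|right]; exists ab.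
- by apply: contra_not iS; apply: sub_finite_set => _ [ab Sab <-]; exists ab => //; split=> //; case: (Sz ab Sab).
exists p; split=> //; have [irrp _] := pf; have [p0 _ _] := irrp.
have [d0|] := posnP (vardeg 1 p).
  have [w pE] := vardeg0 d0; case: ip; apply: (@finite_univ w); last by rewrite -pE => ab [].
  by apply: contraNneq p0 => w0; rewrite pE w0 -uncurryC polyC0 rmorph0.
move=> /(mpoly_bezout g irrp) [//|[u [v [w [w0 E]]]]].
case: ip; apply: (finite_univ w _ w0) => ab [/Sz [_ Eg] /= Ep].
by rewrite /V /= -E rmorphD !rmorphM /= Ep Eg !mulr0 addr0.
Qed.

End Gcd.

(** * Exchange of the two variables *)

Section Swap.
Variable R : realType.
Local Notation C := R[i].
Implicit Types f g h p q d : {mpoly C[2]}.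

(** The second coupling has x_3 as first outer coordinate, whereas both eliminants are written in
    the order x_1, x_3. *)
Definition swap_mpoly f : {mpoly C[2]} := mmap (@mpolyC 2 C) (opair 'X_1 'X_0) f.
HB.instance Definition _ := GRing.RMorphism.copy swap_mpoly (mmap (@mpolyC 2 C) (opair 'X_1 'X_0)).

Lemma swap_mpolyK : involutive swap_mpoly.
Proof.
move=> f; apply: (mpoly_rmorph_ext (phi := swap_mpoly \o swap_mpoly) (psi := idfun)) => [c|i] /=.
  by rewrite /swap_mpoly !mmapC.
rewrite /swap_mpoly mmapX mmap1U /opair; case: i => [[|[|//]] ?] /=; rewrite mmapX mmap1U /=;
  by congr 'X_[U_(_)]; apply: val_inj.
Qed.

Lemma eval_swap f (a b : C) : mmap idfun (opair a b) (swap_mpoly f) = mmap idfun (opair b a) f.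
Proof.
rewrite -[swap_mpoly f]/(msubst2 f 'X_1 'X_0) (phi_subst 1 0 (mmap idfun (opair a b))).
rewrite /= !mmapX !mmap1U /=.
apply: (mpoly_rmorph_ext (phi := mmap (mmap idfun (opair a b) \o @mpolyC 2 C) (opair b a))
  (psi := mmap idfun (opair b a))) => [c|i] /=.
  by rewrite !mmapC /= mmapC.
by rewrite !mmapX.
Qed.

Lemma vardeg_swap j f : vardeg (rev_ord j) (swap_mpoly f) = vardeg j f.
Proof.
rewrite !vardegE; suff -> : curry (rev_ord j) (swap_mpoly f) = curry j f by [].
apply: (mpoly_rmorph_ext (phi := curry (rev_ord j) \o swap_mpoly) (psi := curry j)) => [c|i] /=.
  by rewrite /swap_mpoly mmapC !curryC.
rewrite /swap_mpoly mmapX mmap1U /opair.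
by case: j i => [[|[|//]] ?] [[|[|//]] ?]; rewrite /= !curryX.
Qed.

Lemma swap_irreducible f : irreducible_mpoly f -> irreducible_mpoly (swap_mpoly f).
Proof.
have unitS p : swap_mpoly p \is a GRing.unit -> p \is a GRing.unit.
  by move=> /(rmorph_unit swap_mpoly); rewrite /= swap_mpolyK.
move=> [f0 uf irrf]; split; first by apply: contraNneq f0 => E; rewrite -[f]swap_mpolyK E rmorph0.
  by apply: contra uf; exact: unitS.
move=> p q /(congr1 swap_mpoly); rewrite swap_mpolyK rmorphM => /irrf [] /unitS; by [left|right].
Qed.

Lemma swap_linear f : linear_factor (swap_mpoly f) <-> linear_factor f.
Proof. by rewrite /linear_factor -!(vardeg_swap _ f) rev_ord20 rev_ord21; split=> -[]. Qed.

Lemma swap_quadratic f : quadratic_factor (swap_mpoly f) <-> quadratic_factor f.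
Proof. by rewrite /quadratic_factor -!(vardeg_swap _ f) rev_ord20 rev_ord21; split=> -[]. Qed.

End Swap.

(** * Flexible meshes *)

Section Mesh.
Variables (R : realType) (M : mesh R).
Hypothesis hns : mesh_nonsingular M.
Local Notation C := R[i].
Local Notation G := (Gmesh M).

Lemma succ2 : 2 + 1 = 3 :> 'I_4. Proof. exact: val_inj. Qed.
Lemma succ3 : 3 + 1 = 0 :> 'I_4. Proof. exact: val_inj. Qed.

Lemma Rt1_eliminant : Rt1 M = eliminant 0 (G 0) (G 1).
Proof. by rewrite /Rt1 !gtilde_bipoly // /eliminant rev_ord20. Qed.

Lemma Rt2_eliminant : Rt2 M = eliminant 1 (G 2) (G 3).
Proof. by rewrite /Rt2 !gtilde_bipoly // /eliminant rev_ord21. Qed.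

Lemma matchingP p : zeros (matching_gens M) p <->
  forall i, bform 2 (G i) (hcoord (p i)) (hcoord (p (i + 1))) = 0.
Proof.
have ne (i : 'I_4) : i != i + 1 by case: i => [[|[|[|[|//]]]] ?].
have nG i := Gmesh_nonvertical hns i.
split=> [H i|H f /mapP [i _ ->]]; last first.
  by rewrite gtilde_bipoly // msubst2_bipoly; apply/vanishes_bipoly.
apply/(vanishes_bipoly (ne i) p (nG i)); rewrite -msubst2_bipoly -gtilde_bipoly //.
by apply: H; apply: map_f; rewrite mem_enum.
Qed.

Lemma matching_fibre i c : finite_set (zeros (matching_gens M) `&` [set p | p i = c]).
Proof.
have fG i' a : finite_set [set b : CP1 R | bform 2 (G i') (hcoord a) (hcoord b) = 0].
  have [_ nv] := Gmesh_nonvertical hns i'.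
  by apply: sub_finite_set (bform_finite (nv a)) => b /= <-; rewrite bform_tr.
have step i' a (S : set ('I_4 -> CP1 R)) : S `<=` zeros (matching_gens M) `&` [set p | p i' = a] ->
    (forall b, finite_set (S `&` [set p | p (i' + 1) = b])) -> finite_set S.
  move=> SZ H; apply: (finite_by (f := fun p => p (i' + 1))) => //.
  by apply: sub_finite_set (fG i' a) => _ [p /SZ [/matchingP Zp <-] <-]; exact: Zp.
apply: (step i c) => // c1; apply: (step (i + 1) c1) => [p [[]]//|c2].
apply: (step (i + 1 + 1) c2) => [p [[[]]]//|c3].
pose q j := if j == i then c else if j == i + 1 then c1 else if j == i + 1 + 1 then c2 else c3.
apply: (sub_finite_set _ (finite_set1 q)) => p [[[[_ /= p0] /= p1] /= p2] /= p3].
apply: functional_extensionality_dep => j; rewrite /q.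
case: eqP => [->//|/eqP n0]; case: eqP => [->//|/eqP n1]; case: eqP => [->//|/eqP n2].
rewrite -p3; congr (p _); apply/val_inj; move: i j n0 n1 n2 {p0 p1 p2 p3 q}.
by case=> [[|[|[|[|//]]]] ?]; case=> [[|[|[|[|//]]]] ?].
Qed.

(** On the zero set of the matching each coordinate has finite fibres. So infinitely many finite
    values of x_1 occur together with a finite x_3, and x_2 and x_4 show that both eliminants vanish
    there. *)
Lemma flexible_common_factor : flexible M ->
  exists f, irreducible_factor f (Rt1 M) /\ mdvd f (Rt2 M).
Proof.
move=> fl; have nG i := Gmesh_nonvertical hns i.
pose S := [set ab : C * C | mmap idfun (opair ab.1 ab.2) (Rt1 M) = 0 /\ mmap idfun (opair ab.1 ab.2) (Rt2 M) = 0].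
apply: (common_factor (S := S)) => //; first by rewrite Rt1_eliminant; apply: eliminant_neq0.
move=> fS; apply: fl; apply: (sub_finite_set (B := zeros (matching_gens M) `&` [set p | p 2 = None] `|`
    zeros (matching_gens M) `&` [set p | p 2 <> None])).
  by move=> p Zp; have [?|?] := pselect (p 2 = None); [left|right].
rewrite finite_setU; split; first exact: matching_fibre.
apply: (finite_by (f := fun p => p 0)); last first.
  by move=> u; apply: sub_finite_set (matching_fibre 0 u) => p [[]].
apply: (sub_finite_set (B := [set None] `|` Some @` (fst @` S))); last first.
  by rewrite finite_setU; split; [exact: finite_set1|exact: finite_image].
move=> _ [p [/matchingP Zp] + <-]; case p2: (p 2) => [b|//] _.
case p0: (p 0) => [a|]; last by left.
right; exists a => //; exists (a, b) => //.
have E0 := Zp 0; have E1 := Zp 1; have E2 := Zp 2; have E3 := Zp 3.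
rewrite add0r p0 in E0; rewrite -[1 + 1]/(2 : 'I_4) p2 in E1; rewrite succ2 p2 in E2.
rewrite succ3 p0 in E3; split.
  by rewrite Rt1_eliminant; apply/eliminantP => //; exists (p 1); rewrite rev_ord20.
by rewrite Rt2_eliminant; apply/eliminantP => //; exists (p 3); rewrite rev_ord21.
Qed.

Lemma dM_factor f : irreducible_mpoly f ->
  irreducible_factor f (dM M) <-> mdvd f (Rt1 M) /\ mdvd f (Rt2 M).
Proof.
have nG i := Gmesh_nonvertical hns i.
have [d1 d2 gd] : is_gcd (Rt1 M) (Rt2 M) (dM M).
  apply: xgetPex; apply: gcd_ex.
    by rewrite Rt1_eliminant; apply: eliminant_neq0.
  by rewrite Rt2_eliminant; apply: eliminant_neq0.
move=> irrf; split=> [[_ fd]|[f1 f2]]; last by split=> //; exact: gd.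
by split; [exact: mdvd_trans fd d1|exact: mdvd_trans fd d2].
Qed.

Lemma coupling_lift j G1 G2 H1 H2 (nG1 : nonvertical 2 G1) (nG2 : nonvertical 2 G2)
    (nH1 : nonvertical 1 H1) (nH2 : nonvertical 1 H2) (f : {mpoly C[2]}) v :
  mdvd f (eliminant j G1 G2) -> mmap idfun v f = 0 ->
  exists p, [/\ zeros (cgens G1 G2 H1 H2) p, p (@Ordinal 5 0 isT) = Some (v j) &
    p (@Ordinal 5 2 isT) = Some (v (rev_ord j))].
Proof.
move=> [q qE] fv; have [t [E1 E2]] : exists t : CP1 R, bform 2 G1 (v j, 1) (hcoord t) = 0 /\
    bform 2 G2 (hcoord t) (v (rev_ord j), 1) = 0.
  by apply/(eliminantP j nG1 nG2); rewrite qE rmorphM /= fv mulr0.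
have [y1 Ey1] := @bform_root _ 1 H1 (hcoord t) isT.
have [y2 Ey2] := @bform_root _ 1 H2 (v (rev_ord j), 1) isT.
exists (fun i => nth None [:: Some (v j); t; Some (v (rev_ord j)); y1; y2] i); split=> //.
by apply/(ZP nG1 nG2 nH1 nH2).
Qed.

(** [factor] is abstract because the factors of the second eliminant are read with x_1 and x_3
    exchanged. The third alternative gathers the involutive-rational, rational-quadratic and
    purely-quadratic couplings. *)
Definition coupling_type (s : 'I_4) (factor : {mpoly C[2]} -> Prop) : Prop :=
  [\/ purely_rational M s /\ (forall f, factor f -> linear_factor f),
      half_quadratic M s /\ (forall f, factor f -> quadratic_factor f),
      (forall W, coupling_component M s W -> case3 W \/ case4 W) /\
        (forall f, factor f ->
           linear_factor f /\ (exists2 W, coupling_component M s W & case3 W) \/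
           quadratic_factor f /\ (exists2 W, coupling_component M s W & case4 W)) |
      involutive_quadratic M s /\ (forall f, factor f -> quadratic_factor f) \/
      quartic M s /\ (forall f, factor f -> ~ linear_factor f /\ ~ quadratic_factor f)].

Lemma coupling_typeP s (factor : {mpoly C[2]} -> Prop) :
  (forall f, factor f -> irreducible_mpoly f) ->
  (forall f, factor f -> forall a b : C, mmap idfun (opair a b) f = 0 ->
     exists p, [/\ zeros (coupling_gens M s) p, p (@Ordinal 5 0 isT) = Some a &
       p (@Ordinal 5 2 isT) = Some b]) ->
  coupling_type s factor.
Proof.
rewrite /coupling_type /purely_rational /half_quadratic /involutive_quadratic /quartic.
rewrite /coupling_component coupling_gens_bipoly // => irrF liftF.
have nG i := Gmesh_nonvertical hns i; have nH i := Hmesh_nonvertical M i.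
have comp f (Ff : factor f) := outer_component (nG s) (nG (s + 1)) (nH s) (nH (s + 1)) (irrF f Ff) (liftF f Ff).
have [] := coupling_classification (nG s) (nG (s + 1)) (nH s) (nH (s + 1)).
- move=> [c H]; constructor 1; split=> // f Ff; have [W [cW oW]] := comp f Ff.
  exact: H (irrF f Ff) cW oW.
- move=> [c H]; constructor 2; split=> // f Ff; have [W [cW oW]] := comp f Ff.
  exact: H (irrF f Ff) cW oW.
- move=> [c H]; constructor 3; split=> // f Ff; have [W [cW oW]] := comp f Ff.
  by have [[]|[]] := H f W (irrF f Ff) cW oW; [left|right]; split=> //; exists W.
move=> [] [c H]; constructor 4; [left|right]; split=> // f Ff; have [W [cW oW]] := comp f Ff;
  exact: H (irrF f Ff) cW oW.
Qed.

Lemma coupling1_type : coupling_type 0 (fun f => irreducible_factor f (Rt1 M)).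
Proof.
have nG i := Gmesh_nonvertical hns i; have nH i := Hmesh_nonvertical M i.
apply: coupling_typeP => [f []//|f [_ fR] a b fab].
rewrite coupling_gens_bipoly // add0r; rewrite Rt1_eliminant in fR.
have := coupling_lift (nG 0) (nG 1) (nH 0) (nH 1) fR fab.
by rewrite rev_ord20.
Qed.

Lemma coupling2_type : coupling_type 2 (fun f => irreducible_factor f (Rt2 M)).
Proof.
have nG i := Gmesh_nonvertical hns i; have nH i := Hmesh_nonvertical M i.
have : coupling_type 2 (fun f => irreducible_factor (swap_mpoly f) (Rt2 M)).
  apply: coupling_typeP => [f [irrf _]|f [_ fR] a b fab].
    by rewrite -[f]swap_mpolyK; exact: swap_irreducible.
  rewrite coupling_gens_bipoly // succ2.
  rewrite -[f]swap_mpolyK eval_swap in fab; rewrite Rt2_eliminant in fR.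
  have := coupling_lift (nG 2) (nG 3) (nH 2) (nH 3) fR fab.
  by rewrite rev_ord21.
have sw f : irreducible_factor f (Rt2 M) -> irreducible_factor (swap_mpoly (swap_mpoly f)) (Rt2 M).
  by rewrite swap_mpolyK.
move=> [] => [[c H]|[c H]|[c H]|[[c H]|[c H]]].
- by constructor 1; split=> // f /sw /H /swap_linear.
- by constructor 2; split=> // f /sw /H /swap_quadratic.
- by constructor 3; split=> // f /sw /H; rewrite swap_linear swap_quadratic.
- by constructor 4; left; split=> // f /sw /H /swap_quadratic.
by constructor 4; right; split=> // f /sw /H; rewrite swap_linear swap_quadratic.
Qed.

(** Either all components are of case 3, or some other one is of case 4 and both cases occur. *)
Lemma inv_or_rat_quadraticI s : (forall W, coupling_component M s W -> case3 W \/ case4 W) ->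
  (exists2 W, coupling_component M s W & case3 W) -> inv_or_rat_quadratic M s.
Proof.
move=> H E3; have [c|] := pselect (involutive_rational M s); first by left.
move=> /existsNP [W /not_implyP [cW n3]]; right; split=> //; exists W => //.
by have [] := H W cW.
Qed.

Lemma rat_or_pure_quadraticI s : (forall W, coupling_component M s W -> case3 W \/ case4 W) ->
  (exists2 W, coupling_component M s W & case4 W) -> rat_or_pure_quadratic M s.
Proof.
move=> H E4; have [c|] := pselect (purely_quadratic M s); first by right.
move=> /existsNP [W /not_implyP [cW n4]]; left; split=> //; exists W => //.
by have [] := H W cW.
Qed.

End Mesh.

(** * The eleven classes *)

Lemma linear_not_quadratic (R : realType) (f : {mpoly R[i][2]}) :
  linear_factor f -> quadratic_factor f -> False.
Proof. by case=> l _ [q _]; rewrite l in q. Qed.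

Theorem theorem1p1 (R : realType) (M : mesh R)
    (hns : mesh_nonsingular M) (hfl : flexible M) :
  class_PR M \/ class_HQ M \/ class_IR M \/ class_RQ M \/ class_PQ M \/
  class_IQ M \/ class_Q M \/
  class_PR_IR M \/ class_HQ_IQ M \/ class_HQ_PQ M \/ class_PQ_IQ M.
Proof.
have [f [f1 f2']] := flexible_common_factor hns hfl; have [irrf f1'] := f1.
have f2 : irreducible_factor f (Rt2 M) := conj irrf f2'.
have dvdE g : irreducible_factor g (dM M) ->
    irreducible_factor g (Rt1 M) /\ irreducible_factor g (Rt2 M).
  move=> gd; have [irrg _] := gd; have [g1 g2] := (dM_factor hns irrg).1 gd.
  exact: (conj (conj irrg g1) (conj irrg g2)).
have fd : irreducible_factor f (dM M) := (dM_factor hns irrf).2 (conj f1' f2').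
(* Twenty-five pairs of types, the second varying faster; those that belong to no class are refuted
   by the bidegree of [f]. *)
case: (coupling1_type hns) => [[c1 H1]|[c1 H1]|[c1 H1]|[[c1 H1]|[c1 H1]]];
case: (coupling2_type hns) => [[c2 H2]|[c2 H2]|[c2 H2]|[[c2 H2]|[c2 H2]]];
  have F1 := H1 f f1; have F2 := H2 f f2; clear f1 f2 f1' f2'.
- by left; split.
- by case: (linear_not_quadratic F1 F2).
- have [[_ e2]|[F2' _]] := F2; last by case: (linear_not_quadratic F1 F2').
  by do 7!right; left; left; split=> //; exact: inv_or_rat_quadraticI.
- by case: (linear_not_quadratic F1 F2).
- by case: F2.
- by case: (linear_not_quadratic F2 F1).
- by right; left; split.
- have [[F2' _]|[_ e2]] := F2; first by case: (linear_not_quadratic F2' F1).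
  by do 9!right; left; left; split=> //; exact: rat_or_pure_quadraticI.
- by do 8!right; left; left; split.
- by case: F2.
- have [[_ e1]|[F1' _]] := F1; last by case: (linear_not_quadratic F2 F1').
  by do 7!right; left; right; split=> //; exact: inv_or_rat_quadraticI.
- have [[F1' _]|[_ e1]] := F1; first by case: (linear_not_quadratic F1' F2).
  by do 9!right; left; right; split=> //; exact: rat_or_pure_quadraticI.
(* Each factor of [dM] vanishes on a component of either coupling. A linear one and a quadratic one
   thus produce components of cases 3 and 4 on both sides. *)
- have RQ : has_linear (dM M) -> has_quadratic (dM M) -> class_RQ M.
    move=> hl hq; have [g /dvdE [g1 g2] gl] := hl; have [h /dvdE [h1 h2] hqd] := hq.
    have [[_ a1]|[/(linear_not_quadratic gl)//]] := H1 g g1.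
    have [[_ a2]|[/(linear_not_quadratic gl)//]] := H2 g g2.
    have [[/linear_not_quadratic/(_ hqd)//]|[_ b1]] := H1 h h1.
    have [[/linear_not_quadratic/(_ hqd)//]|[_ b2]] := H2 h h2.
    by split=> //; split.
  have dl g : irreducible_factor g (dM M) -> linear_factor g \/ quadratic_factor g.
    by move=> /dvdE [g1 _]; case: (H1 g g1) => -[]; [left|right].
  (* If some factor of [dM] is not of the kind of [f], both kinds occur and the class is RQ;
     otherwise the kind of [f] decides between IR and PQ. *)
  have [[l1 e1]|[q1 e1]] := F1.
    have [lin|] := pselect (forall g, irreducible_factor g (dM M) -> linear_factor g); last first.
      move=> /existsNP [g /not_implyP [gd nl]]; do 3!right; left; apply: RQ; [by exists f|exists g; first exact: gd].
      by case: (dl g gd).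
    have [[_ e2]|[q2 _]] := F2; last by case: (linear_not_quadratic l1 q2).
    by do 2!right; left; split; [split; exact: inv_or_rat_quadraticI|split; [exists f|]].
  have [qua|] := pselect (forall g, irreducible_factor g (dM M) -> quadratic_factor g); last first.
    move=> /existsNP [g /not_implyP [gd nq]]; do 3!right; left; apply: RQ; [exists g; first exact: gd|by exists f].
    by case: (dl g gd).
  have [[l2 _]|[_ e2]] := F2; first by case: (linear_not_quadratic l2 q1).
  by do 4!right; left; split; [split; exact: rat_or_pure_quadraticI|split; [exists f|]].
- have [[F1' _]|[_ e1]] := F1; first by case: (linear_not_quadratic F1' F2).
  by do 10!right; right; split=> //; exact: rat_or_pure_quadraticI.
- by case: F2 => nl nq; case: F1 => -[].
- by case: (linear_not_quadratic F2 F1).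
- by do 8!right; left; right; split.
- have [[F2' _]|[_ e2]] := F2; first by case: (linear_not_quadratic F2' F1).
  by do 10!right; left; split=> //; exact: rat_or_pure_quadraticI.
- by do 5!right; left; split.
- by case: F2.
- by case: F1.
- by case: F1.
- by case: F1 => nl nq; case: F2 => -[].
- by case: F1.
by do 6!right; left; split.
Qed.
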